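(* Let $r\ge 2$ be an integer and let $\gamma=(\gamma_1,\dots,\gamma_{r-1})\in\mathbb{R}^{r-1}$ satisfy $\gamma_k\ge -1+\frac{k}{r}$ for all $k\in\{1,\dots,r-1\}$. Let $T\in\mathcal{H}'_r(\mathbb{C})$. If $T$ is nonzero, then the map $u\mapsto T\star_\gamma u$ from $\mathcal{H}_r(\mathbb{C})$ into itself is surjective.
   Context: A function $u:\mathbb{C}\to\mathbb{C}$ is $r$-even if $u(\omega^k z)=u(z)$ for all $z\in\mathbb{C}$ and $k\in\{1,\dots,r-1\}$, where $\omega=e^{2i\pi/r}$. $\mathcal{H}_r(\mathbb{C})$ is the Fréchet space of all $r$-even entire functions with the topology of uniform convergence on compact subsets of $\mathbb{C}$; $\mathcal{H}'_r(\mathbb{C})$ is its dual. The hyper-Bessel operator is $B_r=\frac{1}{z^{r-1}}\prod_{i=1}^{r-1}\big(z\frac{d}{dz}+(r\gamma_i+1)\big)\frac{d}{dz}$. For $u\in\mathcal{H}_r(\mathbb{C})$, $B_ru$, defined for $z\ne0$, extends to an entire function, and $B_ru$ denotes this extension, which lies in $\mathcal{H}_r(\mathbb{C})$. With $\mathbb{N}=\{0,1,\dots\}$, $\alpha_{rn}(\gamma)=r^{rn}\,n!\prod_{i=1}^{r-1}\frac{\Gamma(\gamma_i+n+1)}{\Gamma(\gamma_i+1)}$, $n\in\mathbb{N}$. The generalized translations are $(T^\gamma_zu)(w)=\sum_{n=0}^{\infty}\frac{w^{rn}}{\alpha_{rn}(\gamma)}B_r^nu(z)$ for $z,w\in\mathbb{C}$,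 $u\in\mathcal{H}_r(\mathbb{C})$; they map $\mathcal{H}_r(\mathbb{C})$ into itself. For $T\in\mathcal{H}'_r(\mathbb{C})$ and $u\in\mathcal{H}_r(\mathbb{C})$, the generalized convolution is $(T\star_\gamma u)(z)=\langle T,T^\gamma_zu\rangle$, $z\in\mathbb{C}$; it belongs to $\mathcal{H}_r(\mathbb{C})$. *)

(* Defs.v *)
From HB Require Import structures.
From mathcomp Require Import all_boot all_order all_algebra.
From mathcomp Require Import all_classical all_reals all_analysis.
From mathcomp Require Export complex.

Set Implicit Arguments.
Unset Strict Implicit.
Unset Printing Implicit Defensive.

Import Order.TTheory GRing.Theory Num.Theory numFieldNormedType.Exports.
Local Open Scope classical_set_scope.
Local Open Scope ring_scope.
Local Open Scope complex_scope.

(* Topology and norm of the complex field, seen as a normed module over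
   itself; in particular [derivable f z 1] is complex differentiability. *)
#[export, non_forgetful_inheritance]
HB.instance Definition _ (R : realType) := GRing.ComAlgebra.copy R[i] R[i]^o.
#[export, non_forgetful_inheritance]
HB.instance Definition _ (R : realType) := Vector.copy R[i] R[i]^o.
#[export, non_forgetful_inheritance]
HB.instance Definition _ (R : realType) := NormedModule.copy R[i] R[i]^o.

Section HyperBessel.
Variables (R : realType) (r : nat).
Local Notation C := R[i].

Definition entire (u : C -> C) := forall z : C, derivable u z 1.

(* exp(2 i pi / r) *)
Definition omega : C :=
  cos (2 * pi / r%:R : R) +i* sin (2 * pi / r%:R : R).

Definition r_even (u : C -> C) :=
  forall (z : C) (k : nat), (1 <= k <= r.-1)%N -> u (omega ^+ k * z) = u z.

(* The carrier type is that of functions with the topology of uniform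
   convergence on compact sets, of which the space of r-even entire functions
   is a subspace. *)
Definition Hr : set {family compact, C -> C} :=
  [set u | entire u /\ r_even u].

(* An element of the dual of [Hr] is represented by any extension to all
   functions; only its values on [Hr] are relevant. *)
Definition dual_Hr (T : {family compact, C -> C} -> C) :=
  (forall (a : C) (u v : C -> C), Hr u -> Hr v ->
     T (a *: u + v) = a * T u + T v) /\
  {within Hr, continuous T}.

(* [gamma i] stands for gamma_(i+1) of the usual 1-based indexing. *)
Variable gamma : 'I_r.-1 -> R.

Definition hyper_Bessel_formula (u : C -> C) (z : C) : C :=
  (z ^+ r.-1)^-1 *
  (\big[(fun P Q => P \o Q)/id]_(i < r.-1)
     (fun (f : C -> C) (w : C) => w * f^`()%classic w + (r%:R * gamma i + 1)%:C * f w))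
  u^`()%classic z.

(* The value at 0 is that of the continuous extension. *)
Definition hyper_Bessel (u : C -> C) (z : C) : C :=
  if z == 0 then lim (hyper_Bessel_formula u w @[w --> (0 : C)^'])
  else hyper_Bessel_formula u z.

Definition Gamma (x : R) : R :=
  \int[lebesgue_measure]_(t in `]0, +oo[) (t `^ (x - 1) * expR (- t)).

Definition alpha (n : nat) : R :=
  r%:R ^+ (r * n) * n`!%:R *
  \prod_(i < r.-1) (Gamma (gamma i + n%:R + 1) / Gamma (gamma i + 1)).

Definition translation (z : C) (u : C -> C) (w : C) : C :=
  limn (series (fun n =>
    w ^+ (r * n) / (alpha n)%:C * iter n hyper_Bessel u z)).

Definition convolution (T : {family compact, C -> C} -> C) (u : C -> C)
  (z : C) : C := T (translation z u).

End HyperBessel.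

(* Main.v *)
Require Import Defs.
From mathcomp Require Import all_boot all_order all_algebra.
From mathcomp Require Import all_classical all_reals all_analysis.
From mathcomp Require Import measurable_realfun ring lra zify.

(* In the basis e_n(z) = z^(rn) / alpha_n the operator B_r is the left shift, so
   for u = sum u_n e_n and t_n = <T, e_n> the m-th coordinate of T * u is
   sum_n t_n u_(n+m), that is phi(S) u with S the left shift and
   phi(x) = sum_n t_n x^n.  Since alpha_n grows like c^n (n!)^r, continuity of T
   makes phi an entire function with |t_n| <= M A^n / (n!)^r.

   To solve phi(S) u = g, write the j-th unit sequence as the mean of
   (l^(m-j))_m over a circle |l| = rho_j and divide by the eigenvalue phi(l):
     u_m = sum_j g_j mean_(|l| = rho_j) l^(m-j) / phi(l).
   This converges to an admissible sequence as soon as rho_j is comparable with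
   (j+1)^r and |phi| >= c b^-j on that circle.  Such circles are found by
   truncating phi at degree L j with L large and fixed: a polynomial of degree N
   with constant term t_0 has modulus at least |t_0| kappa^N on some circle with
   radius in [rho, 2 rho] (Cartan), while the tail of phi is of size
   (const / L^r)^(L j).

   That r-even entire functions are power series in z^r is Cauchy's theorem; it
   is proved by Goursat's bisection in logarithmic coordinates, the integral over
   a segment being a limit of dyadic Riemann sums. *)

Import Order.TTheory GRing.Theory Num.Theory numFieldNormedType.Exports.
Set Implicit Arguments.
Unset Strict Implicit.
Unset Printing Implicit Defensive.
Local Open Scope classical_set_scope.
Local Open Scope ring_scope.
Local Open Scope complex_scope.

(** The circles vary with [j] for a reason. A datum [g] is only known to satisfy
    [|g_j| <= C eps^j (j!)^r] for each [eps]. On a circle of radius about [(j+1)^r] the factor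
    [rho_j^-j] is at most [(j!)^-r], which cancels that growth, while [rho_j^m] costs [(m!)^r h^-m]
    times an exponential in [j], as one term of an exponential series shows. Every loss left over,
    [b^j] included, is exponential in [j] and is absorbed by [eps]. Hence the lower bound for
    [|phi|] may degrade exponentially in [j] but no faster; Cartan's estimate loses a fixed factor
    per root, so the truncation degree is taken proportional to [j]. The outcome is a formula for a
    right inverse of [phi(S)], with no closed range or duality argument. The hypothesis on [gamma]
    enters through [n + 1 + gamma_i >= (n+1) / r], which keeps [alpha_n] positive and its ratios
    comparable with [(n+1)^r]. A functional that is nonzero on some r-even entire function has some
    [t_n] nonzero; when [t_0 = 0], a power of [x] is first divided out of [phi]. *)

(** * The complex modulus as a real number, and completeness of the complex field *)

Section Modulus.
Variable R : realType.
Local Notation C := R[i].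

(* The modulus as a real number: the norm of [R[i]] takes its values in [R[i]]. *)
Definition nc (z : C) : R := ComplexField.Normc.normc z.

Lemma normE (z : C) : `|z| = (nc z)%:C.
Proof. by []. Qed.

Lemma nc_ge0 (z : C) : 0 <= nc z.
Proof. by rewrite -lecR -normE normr_ge0. Qed.

Lemma nc0 : nc 0 = 0.
Proof. exact: ComplexField.Normc.normc0. Qed.

Lemma nc1 : nc 1 = 1.
Proof. exact: ComplexField.Normc.normc1. Qed.

Lemma ncM (x y : C) : nc (x * y) = nc x * nc y.
Proof. exact: ComplexField.Normc.normcM. Qed.

Lemma ncV (x : C) : nc x^-1 = (nc x)^-1.
Proof. exact: ComplexField.Normc.normcV. Qed.

Lemma ncX (x : C) n : nc (x ^+ n) = nc x ^+ n.
Proof. by elim: n => [|n IH]; rewrite ?expr0 ?nc1 // !exprS ncM IH. Qed.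

Lemma ncN (x : C) : nc (- x) = nc x.
Proof. exact: normcN. Qed.

Lemma ncB (x y : C) : nc (x - y) = nc (y - x).
Proof. by rewrite -ncN opprB. Qed.

Lemma ncD (x y : C) : nc (x + y) <= nc x + nc y.
Proof. exact: le_normcD. Qed.

Lemma nc_tri (x y z : C) : nc (x - z) <= nc (x - y) + nc (y - z).
Proof. by rewrite (le_trans _ (ncD _ _))// addrA subrK. Qed.

Lemma nc_sub (x y : C) : nc x - nc y <= nc (x - y).
Proof. by rewrite lerBlDr (le_trans _ (ncD _ _))// subrK. Qed.

Lemma nc_eq0 (x : C) : nc x = 0 -> x = 0.
Proof. exact: ComplexField.Normc.eq0_normc. Qed.

Lemma nc_gt0 (x : C) : (0 < nc x) = (x != 0).
Proof.
rewrite lt_neqAle nc_ge0 andbT eq_sym; congr negb.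
by apply/eqP/eqP => [/nc_eq0//|->]; rewrite nc0.
Qed.

Lemma ncR (x : R) : nc x%:C = `|x|.
Proof. by rewrite /nc /= expr0n /= addr0 sqrtr_sqr. Qed.

Lemma nc_nat (n : nat) : nc n%:R = n%:R.
Proof. by rewrite -(rmorph_nat (real_complex R)) ncR normr_nat. Qed.

Lemma nc_Re (z : C) : `|complex.Re z| <= nc z.
Proof. by rewrite -lecR; exact: normc_ge_Re. Qed.

Lemma nc_i (x : R) : nc (0 +i* x) = `|x|.
Proof. by rewrite /nc /= expr0n /= add0r sqrtr_sqr. Qed.

Lemma nc_Im (z : C) : `|complex.Im z| <= nc z.
Proof.
case: z => a b /=; rewrite -sqrtr_sqr /nc /=.
by rewrite ler_sqrt ?addr_ge0 ?sqr_ge0// lerDr sqr_ge0.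
Qed.

Lemma nc_ReIm (z : C) : nc z <= `|complex.Re z| + `|complex.Im z|.
Proof.
have -> : nc z = nc ((complex.Re z)%:C + (0 +i* complex.Im z)).
  by congr nc; case: z => a b; simpc.
by rewrite (le_trans (ncD _ _))// ncR nc_i.
Qed.

Lemma nc_sum (I : Type) (s : seq I) (P : pred I) (F : I -> C) :
  nc (\sum_(i <- s | P i) F i) <= \sum_(i <- s | P i) nc (F i).
Proof.
elim/big_ind2 : _ => [|x a y b xa yb|//]; first by rewrite nc0.
exact: le_trans (ncD _ _) (lerD xa yb).
Qed.

Lemma nc_small (z : C) : (forall e : R, 0 < e -> nc z <= e) -> z = 0.
Proof.
move=> H; apply: nc_eq0; apply/eqP; rewrite eq_le nc_ge0 andbT.
by apply/ler_addgt0Pl => e e0; rewrite addr0 H.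
Qed.

Lemma nbhs_ncP (z : C) (A : set C) :
  nbhs z A <-> exists2 e : R, 0 < e & forall w, nc (w - z) < e -> A w.
Proof.
split.
  move=> /nbhs_ballP[e /= e0 eA].
  (* Positivity in the order of [R[i]] forces the complex radius [e] to be real. *)
  move: e0 (e0); rewrite ltcE /= => /andP[/eqP ie re] _.
  exists (complex.Re e) => // w wz; apply: eA; rewrite -ball_normE /= distrC.
  by rewrite normE ltcE /= -ie eqxx.
move=> [e e0 eA]; apply/nbhs_ballP; exists e%:C => /=; first by rewrite ltcR.
by move=> w; rewrite -ball_normE /= distrC normE ltcR => /eA.
Qed.

Lemma cvg_ncP (T : Type) (F : set_system T) {FF : Filter F} (f : T -> C) (l : C) :
  (f x @[x --> F] --> l) <->
  forall e : R, 0 < e -> \forall x \near F, nc (f x - l) < e.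
Proof.
split=> [H e e0|H A /nbhs_ncP[e e0 eA]].
  by apply: (H (fun w => nc (w - l) < e)); apply/nbhs_ncP; exists e.
by apply: filterS (H _ e0) => x; exact: eA.
Qed.

Lemma cvgn_ncP (u : nat -> C) (l : C) :
  (u n @[n --> \oo] --> l) <->
  forall e : R, 0 < e -> exists N, forall n, (N <= n)%N -> nc (u n - l) < e.
Proof.
rewrite cvg_ncP; split=> H e /H.
  by move=> [N _ HN]; exists N => n Nn; exact: HN.
by move=> [N HN]; exists N.
Qed.

Lemma limn_nc (u : nat -> C) (l : C) :
  (forall e : R, 0 < e -> exists N, forall n, (N <= n)%N -> nc (u n - l) < e) ->
  limn u = l.
Proof. by move=> /cvgn_ncP H; apply: cvg_lim. Qed.

Lemma real_cauchy (u : nat -> R) :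
  (forall e : R, 0 < e -> exists N, forall n m, (N <= n)%N -> (N <= m)%N ->
     `|u n - u m| < e) ->
  exists l : R, forall e : R, 0 < e -> exists N, forall n, (N <= n)%N ->
     `|u n - l| < e.
Proof.
move=> H.
have : cvgn u.
  apply: cauchy_cvg; apply: cauchy_exP => e e0.
  have [N HN] := H _ e0.
  by exists (u N), N => // n Nn; rewrite /ball /= HN.
move=> /cvgrPdist_lt ul; exists (limn u) => e /ul[N _ HN].
by exists N => n Nn; rewrite distrC; exact: HN.
Qed.

Lemma complex_cauchy (u : nat -> C) :
  (forall e : R, 0 < e -> exists N, forall n m, (N <= n)%N -> (N <= m)%N ->
     nc (u n - u m) < e) ->
  exists l : C, forall e : R, 0 < e -> exists N, forall n, (N <= n)%N ->
     nc (u n - l) < e.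
Proof.
move=> H.
have [|a Ha] := @real_cauchy (fun n => complex.Re (u n)).
  move=> e e0; have [N HN] := H e e0; exists N => n m Nn Nm.
  rewrite (le_lt_trans _ (HN n m Nn Nm))// (le_trans _ (nc_Re _))//.
  by case: (u n) (u m) => [? ?] [? ?].
have [|b Hb] := @real_cauchy (fun n => complex.Im (u n)).
  move=> e e0; have [N HN] := H e e0; exists N => n m Nn Nm.
  rewrite (le_lt_trans _ (HN n m Nn Nm))// (le_trans _ (nc_Im _))//.
  by case: (u n) (u m) => [? ?] [? ?].
exists (a +i* b) => e e0.
have e20 : 0 < e / 2 by lra.
have [N1 H1] := Ha _ e20; have [N2 H2] := Hb _ e20.
exists (maxn N1 N2) => n; rewrite geq_max => /andP[/H1 h1 /H2 h2].
apply: (le_lt_trans (nc_ReIm _)).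
by move: h1 h2; case: (u n) => x y /=; lra.
Qed.

End Modulus.

(** * Series dominated by a geometric series *)

Section GeometricSeries.
Variable R : realType.
Local Notation C := R[i].

Implicit Types (a b : nat -> C) (M K : R) (c : C).

Definition csum (a : nat -> C) : C := limn (series a).

(* All series below are dominated by a geometric series of ratio 1/2, so that
   explicit tail bounds replace convergence arguments. *)
Definition gdom (M : R) (a : nat -> C) := forall n, nc (a n) <= M * 2^-1 ^+ n.

Lemma half_small (e : R) : 0 < e -> exists N, forall n, (N <= n)%N ->
  2^-1 ^+ n < e.
Proof.
move=> e0.
have : @GRing.exp R 2^-1 @ \oo --> 0 by apply: cvg_expr; rewrite gtr0_norm; lra.
move=> /cvgrPdist_lt/(_ _ e0)[N _ HN]; exists N => n /HN /=.
by rewrite sub0r normrN ger0_norm// exprn_ge0// invr_ge0.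
Qed.

Lemma halfM_small (K e : R) : 0 < e -> exists N, forall n, (N <= n)%N ->
  K * 2^-1 ^+ n < e.
Proof.
move=> e0.
have K0 : 0 < `|K| + 1 by rewrite ltr_wpDl.
have [N HN] := half_small (divr_gt0 e0 K0).
exists N => n /HN; rewrite ltr_pdivlMr// mulrC => h.
rewrite (le_lt_trans _ h)// ler_wpM2r ?exprn_ge0//.
by rewrite (le_trans (ler_norm _))// lerDl.
Qed.

Lemma half_expS n : 2^-1 ^+ n = 2 * 2^-1 ^+ n.+1 :> R.
Proof. by rewrite exprS mulrA mulfV ?mul1r. Qed.

Lemma sum_half m n : (m <= n)%N ->
  \sum_(m <= k < n) 2^-1 ^+ k = 2 * 2^-1 ^+ m - 2 * 2^-1 ^+ n :> R.
Proof.
elim: n => [|n IH].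
  by rewrite leqn0 => /eqP->; rewrite big_geq// subrr.
rewrite leq_eqVlt => /orP[/eqP->|]; first by rewrite big_geq// subrr.
move=> mn; rewrite big_nat_recr//= IH//.
by rewrite (half_expS n); ring.
Qed.

Lemma gdom_ge0 M a : gdom M a -> 0 <= M.
Proof. by move=> /(_ 0%N); rewrite expr0 mulr1; apply: le_trans (nc_ge0 _). Qed.

Lemma gdom_block M a m n : gdom M a -> (m <= n)%N ->
  nc (\sum_(m <= k < n) a k) <= 2 * M * 2^-1 ^+ m.
Proof.
move=> aM mn; rewrite (le_trans (nc_sum _ _ _))//.
rewrite (le_trans (ler_sum _ (fun k _ => aM k)))// -mulr_sumr sum_half//.
have := gdom_ge0 aM; have : 0 <= 2^-1 ^+ n :> R by rewrite exprn_ge0.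
nra.
Qed.

Lemma csum_cvg M a : gdom M a -> series a n @[n --> \oo] --> csum a.
Proof.
move=> aM; suff [l /cvgn_ncP H] : exists l : C,
    forall e : R, 0 < e -> exists N, forall n, (N <= n)%N -> nc (series a n - l) < e.
  by rewrite /csum (cvg_lim _ H).
apply: complex_cauchy => e e0.
have [N HN] := halfM_small (2 * M) e0.
exists N; suff H n m : (N <= n)%N -> (n <= m)%N -> nc (series a m - series a n) < e.
  move=> n m Nn Nm; have [/H|/ltnW/H] := leqP m n; last first.
    by rewrite ncB; exact.
  exact.
move=> Nn nm; rewrite sub_series_geq//.
exact: le_lt_trans (gdom_block aM nm) (HN _ Nn).
Qed.

Lemma csum_approx M a n : gdom M a ->
  nc (csum a - \sum_(k < n) a k) <= 2 * M * 2^-1 ^+ n.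
Proof.
move=> aM; apply/ler_addgt0Pl => e e0.
have /cvgn_ncP/(_ _ e0)[N HN] := csum_cvg aM.
pose m := maxn N n.
rewrite (le_trans (nc_tri _ (series a m) _))// lerD//.
  by rewrite ncB ltW// HN// leq_maxl.
rewrite -[X in series a m - X](big_mkord xpredT).
by rewrite sub_series_geq ?leq_maxr//; apply: gdom_block aM _; rewrite leq_maxr.
Qed.

Lemma csum_le M a : gdom M a -> nc (csum a) <= 2 * M.
Proof.
move=> aM; have := @csum_approx M a 0 aM.
by rewrite big_ord0 subr0 expr0 mulr1.
Qed.

(** A geometric bound on the remainders gives convergence and identifies the sum at once, so no
    domination of [a] has to be established beforehand. *)
Lemma csum_unique (K : R) a (s : C) :
  (forall n, nc (s - \sum_(k < n) a k) <= K * 2^-1 ^+ n) -> csum a = s.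
Proof.
move=> H; apply: limn_nc => e e0.
have [N HN] := halfM_small K e0.
exists N => n Nn; rewrite ncB /series /= big_mkord.
exact: le_lt_trans (H _) (HN _ Nn).
Qed.

Lemma csum_eq a b : a =1 b -> csum a = csum b.
Proof. by move=> /funext ->. Qed.

Lemma gdomD M N a b : gdom M a -> gdom N b -> gdom (M + N) (fun n => a n + b n).
Proof.
by move=> aM bN n; rewrite (le_trans (ncD _ _))// mulrDl lerD.
Qed.

Lemma gdomZ M c a : gdom M a -> gdom (nc c * M) (fun n => c * a n).
Proof. by move=> aM n; rewrite ncM -mulrA ler_wpM2l// nc_ge0. Qed.

Lemma csumD M N a b : gdom M a -> gdom N b ->
  csum (fun n => a n + b n) = csum a + csum b.
Proof.
move=> aM bN; apply: (@csum_unique (2 * M + 2 * N)) => n.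
rewrite big_split/= opprD addrACA (le_trans (ncD _ _))// mulrDl lerD//;
  exact: csum_approx.
Qed.

Lemma csumZ M c a : gdom M a -> csum (fun n => c * a n) = c * csum a.
Proof.
move=> aM; apply: (@csum_unique (nc c * (2 * M))) => n.
by rewrite -mulr_sumr -mulrBr ncM -mulrA ler_wpM2l ?nc_ge0//; exact: csum_approx.
Qed.

Lemma csumB M N a b : gdom M a -> gdom N b ->
  csum (fun n => a n - b n) = csum a - csum b.
Proof.
move=> aM bN; rewrite -mulN1r -(csumZ (-1) bN).
rewrite -(csumD aM (gdomZ (-1) bN)); apply: csum_eq => n.
by rewrite mulN1r.
Qed.

Lemma csum0 : csum (fun=> 0) = 0.
Proof.
apply: (@csum_unique 0) => n; rewrite big1// subrr nc0 mul0r//.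
Qed.

Lemma csum_sum (I : Type) (s : seq I) (M : I -> R) (a : I -> nat -> C) :
  (forall i, gdom (M i) (a i)) ->
  gdom (\sum_(i <- s) M i) (fun n => \sum_(i <- s) a i n) /\
  csum (fun n => \sum_(i <- s) a i n) = \sum_(i <- s) csum (a i).
Proof.
move=> aM; elim: s => [|i s [IH1 IH2]].
  rewrite !big_nil; split.
    by move=> n; rewrite big_nil nc0 mul0r.
  by rewrite -[RHS]csum0; apply: csum_eq => n; rewrite big_nil.
rewrite !big_cons; have E : (fun n => \sum_(j <- i :: s) a j n) =
    (fun n => a i n + \sum_(j <- s) a j n).
  by apply/funext => n; rewrite big_cons.
by rewrite E (csumD (aM i) IH1) IH2; split=> //; exact: gdomD.
Qed.

Lemma csum_recl M a : gdom M a -> csum a = a 0%N + csum (fun n => a n.+1).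
Proof.
move=> aM; apply: (@csum_unique (2 * M)) => -[|n].
  rewrite big_ord0 subr0 expr0 mulr1 (le_trans (ncD _ _))//.
  have h1 := aM 0%N; rewrite expr0 mulr1 in h1.
  have : gdom (M / 2) (fun n => a n.+1).
    by move=> n; rewrite (le_trans (aM _))// exprS; lra.
  by move=> /csum_le; lra.
rewrite big_ord_recl /= opprD addrACA subrr add0r.
have : gdom (M / 2) (fun n => a n.+1).
  by move=> k; rewrite (le_trans (aM _))// exprS; lra.
by move=> /(csum_approx n); rewrite exprS; lra.
Qed.

(** After removal of [N] columns, the tail of row [n] is at most [2 M 2^-n 2^-N]; summing these over
    the rows leaves [4 M 2^-N]. *)
Lemma csum_exchange M (x : nat -> nat -> C) :
  (forall n m, nc (x n m) <= M * 2^-1 ^+ n * 2^-1 ^+ m) ->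
  csum (fun n => csum (x n)) = csum (fun m => csum (x ^~ m)).
Proof.
move=> xM; apply/esym/(@csum_unique (4 * M)) => N.
have gr n : gdom (M * 2^-1 ^+ n) (x n) by move=> m; exact: xM.
have gc m : gdom (M * 2^-1 ^+ m) (x ^~ m) by move=> n; rewrite mulrAC; exact: xM.
have gs : gdom (2 * M) (fun n => csum (x n)).
  by move=> n; rewrite (le_trans (csum_le (gr n)))// mulrA.
have [gF <-] := csum_sum (index_enum 'I_N) (fun i : 'I_N => gc i).
rewrite -(csumB gs gF) [leRHS](_ : _ = 2 * (2 * M * 2^-1 ^+ N)); last by ring.
apply: csum_le => n.
by rewrite (le_trans (csum_approx N (gr n)))// -!mulrA (mulrC (2^-1 ^+ n)).
Qed.

End GeometricSeries.

(** * Means over [0, 1] as limits of dyadic Riemann sums *)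

Section Mean.
Variable R : realType.
Local Notation C := R[i].
Implicit Types (f : R -> C) (e : R).

(** Dyadic subdivisions make the halving of the interval an exact identity between sums ([dsumS]),
    as Goursat's bisection requires. *)
Definition dsum (p : nat) f : C :=
  (2^-1 ^+ p)%:C * \sum_(0 <= k < 2 ^ p) f (k%:R * 2^-1 ^+ p).

Definition mean f : C := limn (dsum ^~ f).

Definition cont01 f := forall x e, 0 <= x <= 1 -> 0 < e ->
  exists2 d, 0 < d & forall y, 0 <= y <= 1 -> `|y - x| < d -> nc (f y - f x) < e.

(** Compactness of [0, 1] through a supremum. Let [A] be the set of [s] such that [0, s] admits a
    uniform [h]. Beyond a point of [A] close to [sup A], the centre [sup A] itself serves, so [A]
    contains [min 1 (sup A + d (sup A) / 2)]; this forces 1 to lie in [A]. *)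
Lemma lebesgue_number01 (d : R -> R) : (forall x, 0 <= x <= 1 -> 0 < d x) ->
  exists2 h, 0 < h & forall x, 0 <= x <= 1 ->
    exists c, [/\ 0 <= c <= 1, `|x - c| < d c & h <= d c].
Proof.
move=> dP.
pose A := [set s | 0 <= s <= 1 /\ exists2 h, 0 < h & forall x, 0 <= x <= s ->
    exists c, [/\ 0 <= c <= 1, `|x - c| < d c & h <= d c]].
have A0 : A 0.
  split; first by rewrite lexx ler01.
  exists (d 0) => [|x]; first by apply: dP; rewrite lexx ler01.
  rewrite -eq_le => /eqP <-; exists 0.
  by rewrite subrr normr0 lexx ler01 lexx dP// lexx ler01.
have ubA : ubound A 1 by move=> s [/andP[]].
have hsA : has_sup A by split; [exists 0|exists 1].
have s0 : 0 <= sup A by apply: ub_le_sup => //; exists 1.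
have s1 : sup A <= 1 by apply: ge_sup => //; exists 0.
have ds : 0 < d (sup A) by apply: dP; rewrite s0 s1.
have [a Aa sa] := sup_adherent ds hsA.
have [/andP[a0 a1] [h h0 hP]] := Aa.
pose s := Num.min 1 (sup A + d (sup A) / 2).
have As : A s.
  split.
    rewrite /s ge_min lexx /= le_min ler01 /=; lra.
  exists (Num.min h (d (sup A))) => [|x /andP[x0 xs]].
    by rewrite lt_min h0 ds.
  have [xa|ax] := leP x a.
    have [|c [c1 c2 c3]] := hP x; first by rewrite x0.
    by exists c; split => //; rewrite ge_min c3.
  exists (sup A); split; first by rewrite s0.
    move: xs; rewrite /s le_min => /andP[_ xs].
    rewrite ltr_norml; apply/andP; split; lra.
  by rewrite ge_min lexx orbT.
have ss : s <= sup A by apply: ub_le_sup => //; exists 1.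
move: As => [_ [k k0 kP]]; exists k => // x /andP[x0 x1]; apply: kP.
rewrite x0 /=; move: ss; rewrite /s ge_min le_min x1 /=; lra.
Qed.

Lemma cont01_unif f : cont01 f -> forall e, 0 < e ->
  exists2 h, 0 < h & forall x y, 0 <= x <= 1 -> 0 <= y <= 1 -> `|x - y| < h ->
    nc (f x - f y) < e.
Proof.
move=> fc e e0.
have e20 : 0 < e / 2 by lra.
have H x : exists d, 0 <= x <= 1 -> 0 < d /\
    forall y, 0 <= y <= 1 -> `|y - x| < d -> nc (f y - f x) < e / 2.
  have [x01|x01] := pselect (0 <= x <= 1); last by exists 0.
  by have [d d0 dP] := fc x _ x01 e20; exists d.
have [d dP] := choice H.
(* Halved radii: a point within [h] of [x] stays in the full interval around the centre found for
   [x]. *)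
have [|h h0 hP] := @lebesgue_number01 (fun x => d x / 2).
  by move=> x /dP[d0 _]; lra.
exists h => // x y x01 y01 xy; have [c [c01 xc hc]] := hP x x01.
have [dc Hc] := dP c c01.
have h1 : nc (f x - f c) < e / 2 by apply: Hc => //; lra.
have h2 : nc (f y - f c) < e / 2.
  apply: Hc => //.
  have -> : y - c = (y - x) + (x - c) by ring.
  rewrite (le_lt_trans (ler_normD _ _))//.
  by rewrite distrC; lra.
apply: (le_lt_trans (nc_tri _ (f c) _)).
by rewrite (ncB (f c)); lra.
Qed.

Lemma dsum0 f : dsum 0 f = f 0.
Proof. by rewrite /dsum expr0 mul1r big_nat1 mul0r. Qed.

Lemma dsumS p f : dsum p.+1 f =
  2^-1 * (dsum p (fun x => f (2^-1 * x)) + dsum p (fun x => f (2^-1 * x + 2^-1))).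
Proof.
rewrite /dsum -mulrDr expnS mul2n -addnn.
rewrite (@big_cat_nat _ _ _ (2 ^ p))//= ?leq_addr//.
rewrite -{2}[(2 ^ p)%N]add0n big_addn addnK.
rewrite exprS rmorphM/= rmorphV ?unitfE// rmorph_nat -mulrA; congr (_ * (_ * (_ + _))).
  by apply: eq_bigr => k _; congr f; rewrite mulrCA.
apply: eq_bigr => k _; congr f.
rewrite natrD mulrDl mulrCA; congr (_ + _).
rewrite natrX mulrCA -exprMn mulfV ?expr1n ?mulr1//.
Qed.

Lemma half_expM p : (2^-1 ^+ p) * (2 ^ p)%:R = 1 :> R.
Proof. by rewrite natrX -exprMn mulVf// expr1n. Qed.

Lemma dsum_arg p k : (k < 2 ^ p)%N -> 0 <= (k%:R * 2^-1 ^+ p : R) <= 1.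
Proof.
move=> kp; rewrite mulr_ge0 ?exprn_ge0//= -[leRHS](half_expM p) mulrC.
by rewrite ler_wpM2l ?exprn_ge0// ler_nat ltnW.
Qed.

Lemma dsum_le p f e : (forall x, 0 <= x <= 1 -> nc (f x) <= e) ->
  nc (dsum p f) <= e.
Proof.
move=> H; rewrite /dsum ncM ncR ger0_norm ?exprn_ge0//.
rewrite big_mkord; apply: (@le_trans _ _ (2^-1 ^+ p * \sum_(k < 2 ^ p) e)).
  rewrite ler_wpM2l ?exprn_ge0// (le_trans (nc_sum _ _ _))//.
  by apply: ler_sum => k _; apply: H; apply: dsum_arg.
by rewrite sumr_const card_ord -[e *+ _]mulr_natl mulrA half_expM mul1r.
Qed.

Lemma dsum_eq p f g : (forall x, 0 <= x <= 1 -> f x = g x) -> dsum p f = dsum p g.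
Proof.
move=> fg; congr (_ * _); rewrite !big_mkord.
by apply: eq_bigr => k _; apply: fg; exact: dsum_arg.
Qed.

Lemma dsumD p f g : dsum p (fun x => f x + g x) = dsum p f + dsum p g.
Proof. by rewrite /dsum big_split mulrDr. Qed.

Lemma dsumZ p c f : dsum p (fun x => c * f x) = c * dsum p f.
Proof. by rewrite /dsum -mulr_sumr mulrCA. Qed.

Lemma dsum_cst p c : dsum p (fun=> c) = c.
Proof.
rewrite /dsum big_mkord sumr_const card_ord -[c *+ _]mulr_natl mulrA.
by rewrite -(rmorph_nat (real_complex R)) -rmorphM half_expM mul1r.
Qed.

(** Induction on [p] through [dsumS]: rescaling each half of [0, 1] turns the scale [2^-(p+1)] into
    [2^-p]. At [p = 0] an average of [f] is compared with [f 0]. *)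
Lemma dsum_refine p q f e :
  (forall x y, 0 <= x <= 1 -> 0 <= y <= 1 -> `|x - y| <= 2^-1 ^+ p ->
     nc (f x - f y) <= e) ->
  nc (dsum (p + q) f - dsum p f) <= e.
Proof.
elim: p f => [|p IH] f H.
  rewrite add0n dsum0 -[f 0](dsum_cst q) -mulN1r -dsumZ -dsumD.
  apply: dsum_le => x x01; rewrite mulN1r; apply: H; rewrite ?lexx ?ler01//.
  by rewrite subr0 expr0 ger0_norm; case/andP: x01.
rewrite addSn !dsumS -mulrBr opprD addrACA ncM ncV nc_nat.
set u := nc _; suff : u <= e + e by lra.
rewrite /u (le_trans (ncD _ _))// lerD//; apply: IH => x y x01 y01 xy.
  apply: H; [lra|lra|].
  by rewrite -mulrBr normrM gtr0_norm// exprS ler_wpM2l.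
apply: H; [lra|lra|].
rewrite (_ : _ - _ = 2^-1 * (x - y)); last by ring.
by rewrite normrM gtr0_norm// exprS ler_wpM2l.
Qed.

Lemma mean_cvg f : cont01 f -> forall e, 0 < e ->
  exists N, forall p, (N <= p)%N -> nc (dsum p f - mean f) < e.
Proof.
move=> fc.
suff [l Hl] : exists l : C, forall e : R, 0 < e -> exists N, forall n, (N <= n)%N ->
    nc (dsum n f - l) < e.
  by move=> e e0; rewrite /mean (limn_nc Hl); exact: Hl.
apply: complex_cauchy => e e0.
have e20 : 0 < e / 3 by lra.
have [h h0 hP] := cont01_unif fc e20.
have [N HN] := half_small h0.
exists N => n m Nn Nm.
have H k : (N <= k)%N -> nc (dsum k f - dsum N f) <= e / 3.
  move=> Nk; rewrite -(subnKC Nk); apply: dsum_refine => x y x01 y01 xy.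
  by apply: ltW; apply: hP => //; rewrite (le_lt_trans xy)// HN.
rewrite (le_lt_trans (nc_tri _ (dsum N f) _))// (ncB (dsum N f)).
by have := H _ Nn; have := H _ Nm; lra.
Qed.

Lemma mean_unique f l : (forall e, 0 < e ->
  exists N, forall p, (N <= p)%N -> nc (dsum p f - l) < e) -> mean f = l.
Proof. exact: limn_nc. Qed.

Lemma mean_eq f g : (forall x, 0 <= x <= 1 -> f x = g x) -> mean f = mean g.
Proof. by move=> fg; congr (limn _); apply/funext => p; exact: dsum_eq. Qed.

Lemma mean_cst c : mean (fun=> c) = c.
Proof.
by apply: mean_unique => e e0; exists 0%N => p _; rewrite dsum_cst subrr nc0.
Qed.

Lemma mean_le f e : cont01 f -> (forall x, 0 <= x <= 1 -> nc (f x) <= e) ->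
  nc (mean f) <= e.
Proof.
move=> fc fe; apply/ler_addgt0Pl => d d0.
have [N HN] := mean_cvg fc d0.
rewrite -[mean f](subrK (dsum N f)) (le_trans (ncD _ _))// lerD//.
  by rewrite ncB ltW// HN.
exact: dsum_le.
Qed.

Lemma meanD f g : cont01 f -> cont01 g ->
  mean (fun x => f x + g x) = mean f + mean g.
Proof.
move=> fc gc; apply: mean_unique => e e0.
have e20 : 0 < e / 2 by lra.
have [N1 H1] := mean_cvg fc e20; have [N2 H2] := mean_cvg gc e20.
exists (maxn N1 N2) => p; rewrite geq_max => /andP[/H1 h1 /H2 h2].
by rewrite dsumD opprD addrACA (le_lt_trans (ncD _ _))//; lra.
Qed.

Lemma meanZ c f : cont01 f -> mean (fun x => c * f x) = c * mean f.
Proof.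
move=> fc; apply: mean_unique => e e0.
have c0 := nc_ge0 c.
have e20 : 0 < e / (nc c + 1) by rewrite divr_gt0//; lra.
have [N HN] := mean_cvg fc e20.
exists N => p /HN; rewrite dsumZ -mulrBr ncM ltr_pdivlMr; last by lra.
by have := nc_ge0 (dsum p f - mean f); nra.
Qed.

Lemma cont01D f g : cont01 f -> cont01 g -> cont01 (fun x => f x + g x).
Proof.
move=> fc gc x e x01 e0.
have e20 : 0 < e / 2 by lra.
have [d1 d10 H1] := fc x _ x01 e20; have [d2 d20 H2] := gc x _ x01 e20.
exists (Num.min d1 d2); first by rewrite lt_min d10.
move=> y y01; rewrite lt_min => /andP[/(H1 _ y01) h1 /(H2 _ y01) h2].
by rewrite opprD addrACA (le_lt_trans (ncD _ _))//; lra.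
Qed.

Lemma cont01Z c f : cont01 f -> cont01 (fun x => c * f x).
Proof.
move=> fc x e x01 e0.
have c0 := nc_ge0 c.
have e20 : 0 < e / (nc c + 1) by rewrite divr_gt0//; lra.
have [d d0 H] := fc x _ x01 e20.
exists d => // y y01 /(H _ y01); rewrite -mulrBr ncM ltr_pdivlMr; last by lra.
by have := nc_ge0 (f y - f x); nra.
Qed.

Lemma cont01_cst c : cont01 (fun=> c).
Proof. by move=> x e _ e0; exists 1 => // y _ _; rewrite subrr nc0. Qed.

Lemma cont01_half f : cont01 f ->
  cont01 (fun x => f (2^-1 * x)) /\ cont01 (fun x => f (2^-1 * x + 2^-1)).
Proof.
move=> fc; split=> x e x01 e0.
  have [|d d0 H] := fc (2^-1 * x) e _ e0; first by lra.
  exists d => // y y01 yx; apply: H; first by lra.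
  by rewrite -mulrBr normrM gtr0_norm//; have := normr_ge0 (y - x); lra.
have [|d d0 H] := fc (2^-1 * x + 2^-1) e _ e0; first by lra.
exists d => // y y01 yx; apply: H; first by lra.
rewrite (_ : _ - _ = 2^-1 * (y - x)); last by ring.
by rewrite normrM gtr0_norm//; have := normr_ge0 (y - x); lra.
Qed.

Lemma mean_halves f : cont01 f ->
  mean f = 2^-1 * (mean (fun x => f (2^-1 * x)) + mean (fun x => f (2^-1 * x + 2^-1))).
Proof.
move=> fc; have [f1 f2] := cont01_half fc.
rewrite -meanD// -meanZ; last exact: cont01D.
apply/esym/mean_unique => e e0.
have [N HN] := mean_cvg fc e0.
exists N => p Np; rewrite dsumZ dsumD -dsumS.
by apply: HN; rewrite (leq_trans Np).
Qed.

Lemma mean_sum (I : Type) (s : seq I) (F : I -> R -> C) :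
  (forall i, cont01 (F i)) ->
  cont01 (fun x => \sum_(i <- s) F i x) /\
  mean (fun x => \sum_(i <- s) F i x) = \sum_(i <- s) mean (F i).
Proof.
move=> Fc; elim: s => [|i s [IH1 IH2]].
  have -> : (fun x => \sum_(i <- [::]) F i x) = fun=> 0.
    by apply/funext => x; rewrite big_nil.
  by rewrite big_nil mean_cst; split => //; exact: cont01_cst.
have -> : (fun x => \sum_(j <- i :: s) F j x) =
    fun x => F i x + \sum_(j <- s) F j x.
  by apply/funext => x; rewrite big_cons.
by rewrite big_cons meanD// IH2; split => //; exact: cont01D.
Qed.

Lemma cont01_id : cont01 (fun x => x%:C).
Proof.
by move=> x e _ e0; exists e => // y _; rewrite -rmorphB ncR.
Qed.

(** Halving the interval gives the equation [m = m / 2 + 1 / 4]. *)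
Lemma mean_id : mean (fun x => x%:C) = 2^-1.
Proof.
have := mean_halves cont01_id.
have -> : (fun x : R => (2^-1 * x)%:C) = (fun x => (2^-1)%:C * x%:C).
  by apply/funext => x; rewrite rmorphM.
have -> : (fun x : R => (2^-1 * x + 2^-1)%:C) =
    (fun x => (2^-1)%:C * x%:C + (2^-1)%:C).
  by apply/funext => x; rewrite rmorphD rmorphM.
have c1 := cont01Z (2^-1)%:C cont01_id.
rewrite meanD//; last exact: cont01_cst.
rewrite mean_cst meanZ; last exact: cont01_id.
rewrite rmorphV ?unitfE// rmorph_nat; set m := mean _ => E.
have E1 : m = m * 2^-1 + 2^-1 * 2^-1 by rewrite {1}E; field.
have E2 : m - m * 2^-1 = 2^-1 * 2^-1 by rewrite {1}E1 addrC addKr.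
have -> : m = 2 * (m - m * 2^-1) by field.
by rewrite E2; field.
Qed.

End Mean.

(** * Goursat's lemma for parallelograms *)

Section Goursat.
Variable R : realType.
Local Notation C := R[i].
Implicit Types (g h : C -> C) (a b c z w D : C) (e x y : R).

Definition ccont g z := forall e, 0 < e ->
  exists2 d : R, 0 < d & forall w, nc (w - z) < d -> nc (g w - g z) < e.

(** The little-o form of the derivative; as [w = z] is allowed, the calculus rules need no
    division. *)
Definition cderiv g z D := forall e, 0 < e ->
  exists2 d : R, 0 < d & forall w, nc (w - z) < d ->
    nc (g w - g z - D * (w - z)) <= e * nc (w - z).

Lemma ccont_path g a b : (forall z, ccont g z) -> cont01 (fun x => g (a + x%:C * b)).
Proof.
move=> gc x e x01 e0.
have [d d0 H] := gc (a + x%:C * b) e e0.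
have b0 := nc_ge0 b.
exists (d / (nc b + 1)); first by rewrite divr_gt0//; lra.
move=> y _; rewrite ltr_pdivlMr; last by lra.
move=> yx; apply: H.
rewrite (_ : _ - _ = (y - x)%:C * b); last by rewrite rmorphB; ring.
by rewrite ncM ncR; have := normr_ge0 (y - x); nra.
Qed.

(** The integral of [g] along the segment from [a] to [a + b]. *)
Definition edge g a b : C := b * mean (fun x => g (a + x%:C * b)).

(** The integral of [g] around the parallelogram with corner [a] and sides [b] and [c]. *)
Definition pgram g a b c : C :=
  edge g a b + edge g (a + b) c - edge g (a + c) b - edge g a c.

Lemma edge_half g a b : (forall z, ccont g z) ->
  edge g a b = edge g a (b / 2) + edge g (a + b / 2) (b / 2).
Proof.
move=> gc; rewrite /edge mean_halves; last exact: ccont_path.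
have E : (2^-1 : R)%:C = 2^-1 by rewrite rmorphV ?unitfE// rmorph_nat.
rewrite [X in 2^-1 * (X + _)](_ : _ = mean (fun x => g (a + x%:C * (b / 2)))).
  rewrite [X in 2^-1 * (_ + X)](_ : _ = mean (fun x => g (a + b / 2 + x%:C * (b / 2)))).
    by field.
  apply: mean_eq => x _; congr g.
  by rewrite rmorphD rmorphM/= E; field.
apply: mean_eq => x _; congr g.
by rewrite rmorphM/= E; field.
Qed.

Lemma pgram_split g a b c : (forall z, ccont g z) ->
  pgram g a b c = pgram g a (b / 2) (c / 2) + pgram g (a + b / 2) (b / 2) (c / 2) +
    pgram g (a + c / 2) (b / 2) (c / 2) + pgram g (a + b / 2 + c / 2) (b / 2) (c / 2).
Proof.
move=> gc; rewrite /pgram !(@edge_half g _ b)// !(@edge_half g _ c)//.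
have -> : a + c / 2 + c / 2 = a + c by field.
have -> : a + b / 2 + b / 2 = a + b by field.
have -> : a + b / 2 + c / 2 + b / 2 = a + b + c / 2 by field.
have -> : a + c / 2 + b / 2 = a + b / 2 + c / 2 by ring.
have -> : a + b / 2 + c / 2 + c / 2 = a + c + b / 2 by field.
ring.
Qed.

Lemma edgeD g h a b : (forall z, ccont g z) -> (forall z, ccont h z) ->
  edge (fun z => g z + h z) a b = edge g a b + edge h a b.
Proof.
by move=> gc hc; rewrite /edge meanD ?mulrDr//; exact: ccont_path.
Qed.

Lemma pgramD g h a b c : (forall z, ccont g z) -> (forall z, ccont h z) ->
  pgram (fun z => g z + h z) a b c = pgram g a b c + pgram h a b c.
Proof. by move=> gc hc; rewrite /pgram !edgeD//; ring. Qed.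

Lemma ccont_affine A D z : ccont (fun z => A + D * z) z.
Proof.
move=> e e0; have D0 := nc_ge0 D.
exists (e / (nc D + 1)); first by rewrite divr_gt0//; lra.
move=> w; rewrite ltr_pdivlMr; last by lra.
move=> wz; rewrite (_ : _ - _ = D * (w - z)); last by ring.
by rewrite ncM; have := nc_ge0 (w - z); nra.
Qed.

Lemma ccontD g h z : ccont g z -> ccont h z -> ccont (fun z => g z + h z) z.
Proof.
move=> gc hc e e0.
have e20 : 0 < e / 2 by lra.
have [d1 d10 H1] := gc _ e20; have [d2 d20 H2] := hc _ e20.
exists (Num.min d1 d2); first by rewrite lt_min d10.
move=> y; rewrite lt_min => /andP[/H1 h1 /H2 h2].
by rewrite opprD addrACA (le_lt_trans (ncD _ _))//; lra.
Qed.

Lemma edge_affine A D a b :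
  edge (fun z => A + D * z) a b = b * (A + D * a + D * b / 2).
Proof.
rewrite /edge; congr (_ * _).
rewrite (_ : (fun _ => _) = fun x => (A + D * a) + D * b * x%:C); last first.
  by apply/funext => x; ring.
rewrite meanD; [|exact: cont01_cst|apply: cont01Z; exact: cont01_id].
by rewrite mean_cst meanZ ?mean_id//; exact: cont01_id.
Qed.

Lemma pgram_affine A D a b c : pgram (fun z => A + D * z) a b c = 0.
Proof. by rewrite /pgram !edge_affine; field. Qed.

Lemma edge_le g a b (S : R) : (forall z, ccont g z) ->
  (forall x, 0 <= x <= 1 -> nc (g (a + x%:C * b)) <= S) ->
  nc (edge g a b) <= nc b * S.
Proof.
move=> gc gS; rewrite /edge ncM ler_wpM2l ?nc_ge0//.
by apply: mean_le => //; exact: ccont_path.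
Qed.

Lemma pgram_le g a b c (S : R) : (forall z, ccont g z) ->
  (forall x y, 0 <= x <= 1 -> 0 <= y <= 1 -> nc (g (a + x%:C * b + y%:C * c)) <= S) ->
  nc (pgram g a b c) <= 2 * (nc b + nc c) * S.
Proof.
move=> gc gS.
have i0 : 0 <= (0 : R) <= 1 by rewrite lexx ler01.
have i1 : 0 <= (1 : R) <= 1 by rewrite lexx ler01.
have h1 : nc (edge g a b) <= nc b * S.
  apply: edge_le => // x x01; have := gS x 0 x01 i0.
  by rewrite rmorph0 mul0r addr0.
have h2 : nc (edge g (a + b) c) <= nc c * S.
  apply: edge_le => // x x01; have := gS 1 x i1 x01.
  by rewrite rmorph1 mul1r.
have h3 : nc (edge g (a + c) b) <= nc b * S.
  apply: edge_le => // x x01; have := gS x 1 x01 i1.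
  by rewrite rmorph1 mul1r addrAC.
have h4 : nc (edge g a c) <= nc c * S.
  apply: edge_le => // x x01; have := gS 0 x i0 x01.
  by rewrite rmorph0 mul0r addr0.
rewrite /pgram (le_trans (ncD _ _))// ncN.
have := ncD (edge g a b + edge g (a + b) c) (- edge g (a + c) b).
have := ncD (edge g a b) (edge g (a + b) c).
by rewrite ncN; lra.
Qed.

Lemma half_nest (x : nat -> R) :
  (forall p, x p <= x p.+1 <= x p + 2^-1 ^+ p.+1) ->
  exists l, forall p, x p <= l <= x p + 2^-1 ^+ p.
Proof.
move=> H.
have mono p q : (p <= q)%N -> x p <= x q <= x p + 2^-1 ^+ p - 2^-1 ^+ q.
  elim: q => [|q IH]; first by rewrite leqn0 => /eqP ->; rewrite addrK lexx.
  rewrite leq_eqVlt => /orP[/eqP->|]; first by rewrite addrK lexx.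
  move=> /IH /andP[h1 h2]; have /andP[h3 h4] := H q.
  by rewrite (half_expS _ q) in h2; apply/andP; split; lra.
have pos p : 0 <= 2^-1 ^+ p :> R by rewrite exprn_ge0.
have ub p q : x q <= x p + 2^-1 ^+ p.
  have [/mono/andP[_]|/ltnW/mono/andP[h _]] := leqP p q; have := pos q; have := pos p.
    by lra.
  by lra.
exists (sup (range x)) => p; apply/andP; split.
  by apply: ub_le_sup; [exists (x 0%N + 2^-1 ^+ 0) => _ [q _ <-] | exists p].
by apply: ge_sup; [exists (x 0%N), 0%N | move=> _ [q _ <-]].
Qed.

(* Goursat: the integral over one of the four half-size parallelograms keeps a
   quarter of the modulus, whereas near the limit point of the bisection [g] is
   affine up to an error that is small relative to the diameter. *)
Lemma pgram_eq0 g a b c : (forall z, ccont g z) ->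
  (forall x y, 0 <= x <= 1 -> 0 <= y <= 1 ->
     exists D, cderiv g (a + x%:C * b + y%:C * c) D) ->
  pgram g a b c = 0.
Proof.
move=> gc gd.
pose l p : R := 2^-1 ^+ p.
pose sq p (s : R * R) := pgram g (a + s.1%:C * b + s.2%:C * c) ((l p)%:C * b) ((l p)%:C * c).
pose W := nc (pgram g a b c).
pose bad p s := l p * l p * W <= nc (sq p s).
pose near (p : nat) (x x' : R) := x' = x \/ x' = x + l p.+1.
have step (ps : nat * (R * R)) : exists s' : R * R, bad ps.1 ps.2 ->
    [/\ bad ps.1.+1 s', near ps.1 ps.2.1 s'.1 & near ps.1 ps.2.2 s'.2].
  case: ps => p [x y] /=.
  (* The value outside [bad] is immaterial; it makes the selection total, so that [choice]
     applies. *)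
  have [|nb] := pselect (bad p (x, y)); last by exists (0, 0).
  rewrite /bad /sq /= pgram_split//.
  have E (u : C) : (l p)%:C * u / 2 = (l p.+1)%:C * u.
    by rewrite /l exprS rmorphM/= rmorphV ?unitfE// rmorph_nat; field.
  rewrite !E.
  have -> : a + x%:C * b + y%:C * c + (l p.+1)%:C * b =
    a + (x + l p.+1)%:C * b + y%:C * c by rewrite rmorphD; ring.
  have -> : a + x%:C * b + y%:C * c + (l p.+1)%:C * c =
    a + x%:C * b + (y + l p.+1)%:C * c by rewrite rmorphD; ring.
  have -> : a + (x + l p.+1)%:C * b + y%:C * c + (l p.+1)%:C * c =
    a + (x + l p.+1)%:C * b + (y + l p.+1)%:C * c by rewrite (rmorphD _ y); ring.
  set w1 := pgram _ _ _ _; set w2 := pgram _ _ _ _; set w3 := pgram _ _ _ _.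
  set w4 := pgram _ _ _ _ => H.
  have lE : l p * l p * W = 4 * (l p.+1 * l p.+1 * W).
    by rewrite /l (half_expS _ p); ring.
  have H4 : 4 * (l p.+1 * l p.+1 * W) <= nc w1 + nc w2 + nc w3 + nc w4.
    rewrite -lE (le_trans H)//.
    have := ncD (w1 + w2 + w3) w4; have := ncD (w1 + w2) w3; have := ncD w1 w2; lra.
  have [h1|h1] := leP (l p.+1 * l p.+1 * W) (nc w1).
    by exists (x, y); split => //=; left.
  have [h2|h2] := leP (l p.+1 * l p.+1 * W) (nc w2).
    by exists (x + l p.+1, y); split => //=; [right|left].
  have [h3|h3] := leP (l p.+1 * l p.+1 * W) (nc w3).
    by exists (x, y + l p.+1); split => //=; [left|right].
  have h4 : l p.+1 * l p.+1 * W <= nc w4 by lra.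
  by exists (x + l p.+1, y + l p.+1); split => //=; right.
have [f fP] := choice step.
pose s := fix s p := if p is q.+1 then f (q, s q) else (0, 0) : R * R.
have sb p : bad p (s p).
  elim: p => [|p IH]; last by have [] := fP (p, s p) IH.
  by rewrite /bad /sq /l /= expr0 rmorph0 rmorph1 !mul1r !mul0r !addr0.
have lS p : 0 <= l p.+1 by rewrite exprn_ge0.
have nearP p x x' : near p x x' -> x <= x' <= x + l p.+1.
  by move=> [->|->]; have := lS p => ?; apply/andP; split; lra.
have [X XP] : exists X, forall p, (s p).1 <= X <= (s p).1 + 2^-1 ^+ p.
  by apply: half_nest => p; have [_ /nearP] := fP (p, s p) (sb p).
have [Y YP] : exists Y, forall p, (s p).2 <= Y <= (s p).2 + 2^-1 ^+ p.
  by apply: half_nest => p; have [_ _ /nearP] := fP (p, s p) (sb p).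
have X01 : 0 <= X <= 1 by have := XP 0%N; rewrite /= expr0 add0r.
have Y01 : 0 <= Y <= 1 by have := YP 0%N; rewrite /= expr0 add0r.
have [D gD] := gd X Y X01 Y01.
set z0 := a + X%:C * b + Y%:C * c in gD.
have W0 : 0 <= W by apply: nc_ge0.
pose B := nc b + nc c.
have B0 : 0 <= B by rewrite addr_ge0 ?nc_ge0.
apply: nc_small => e e0; rewrite -/W.
(* The perimeter of the small parallelogram is [2 B (l p)] and its points lie within [2 B (l p)] of
   [z0], so its integral will be at most [4 B B e' (l p)^2], against the lower bound [(l p)^2 W].
   The [+ 1] keeps the denominator positive. *)
have e40 : 0 < e / (4 * B * B + 1) by rewrite divr_gt0//; nra.
have [d d0 dP] := gD _ e40.
have [p /(_ p (leqnn p))] := halfM_small (2 * B) d0; rewrite -/(l p) => lpd.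
set e' := e / _ in e40 dP.
(* [h] is [g] minus its first-order expansion at [z0]; by [pgram_affine] both have the same
   integral. *)
pose A := g z0 - D * z0.
pose h z := g z + (- A + - D * z).
have hc z : ccont h z by apply: ccontD => //; exact: ccont_affine.
have lp0 : 0 < l p by rewrite exprn_gt0.
have E : sq p (s p) = pgram h (a + (s p).1%:C * b + (s p).2%:C * c)
   ((l p)%:C * b) ((l p)%:C * c).
  rewrite /h pgramD//; last by move=> z; apply: ccont_affine.
  by rewrite pgram_affine addr0.
have := sb p; rewrite /bad E.
have /pgram_le : forall z, ccont h z by [].
move=> /(_ (a + (s p).1%:C * b + (s p).2%:C * c) ((l p)%:C * b) ((l p)%:C * c)
  (e' * (2 * B * l p))) H1 H2.
have H3 : nc (pgram h (a + (s p).1%:C * b + (s p).2%:C * c) ((l p)%:C * b) ((l p)%:C * c))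
    <= 2 * (nc ((l p)%:C * b) + nc ((l p)%:C * c)) * (e' * (2 * B * l p)).
  apply: H1 => x y x01 y01.
  set w := _ + y%:C * _.
  have wz : nc (w - z0) <= 2 * B * l p.
    have -> : w - z0 = ((s p).1 + x * l p - X)%:C * b + ((s p).2 + y * l p - Y)%:C * c.
      by rewrite /w /z0 !(rmorphD, rmorphB, rmorphM)/= ; ring.
    have := XP p; have := YP p; rewrite -/(l p) => Yp Xp.
    rewrite (le_trans (ncD _ _))// !ncM !ncR.
    have n1 : `|(s p).1 + x * l p - X| <= 2 * l p.
      by rewrite ler_norml; apply/andP; split; nra.
    have n2 : `|(s p).2 + y * l p - Y| <= 2 * l p.
      by rewrite ler_norml; apply/andP; split; nra.
    rewrite /B; have := nc_ge0 b; have := nc_ge0 c; nra.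
  have -> : h w = g w - g z0 - D * (w - z0) by rewrite /h /A; ring.
  rewrite (le_trans (dP _ _))//; first exact: le_lt_trans wz lpd.
  by rewrite ler_wpM2l// ltW.
have H4 := le_trans H2 H3.
rewrite !ncM ncR gtr0_norm// in H4.
have H5 : (l p * l p) * W <= (l p * l p) * (4 * B * B * e').
  by rewrite (le_trans H4)// le_eqVlt; apply/orP; left; apply/eqP; rewrite /B; ring.
rewrite ler_pM2l in H5; last by rewrite mulr_gt0.
rewrite (le_trans H5)// /e' mulrA ler_pdivrMr; last by nra.
by nra.
Qed.

End Goursat.

(** * Rules of complex differentiation *)

Section Derivation.
Variable R : realType.
Local Notation C := R[i].
Implicit Types (f g h : C -> C) (a b c z w D E : C) (e x y : R).

Lemma cderiv_ccont f z D : cderiv f z D -> ccont f z.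
Proof.
move=> fD e e0; have [d d0 H] := fD 1 ltr01.
have D0 := nc_ge0 D.
exists (Num.min d (e / (nc D + 1))).
  by rewrite lt_min d0 divr_gt0//; lra.
move=> w; rewrite lt_min ltr_pdivlMr; last by lra.
move=> /andP[/H h1 h2].
rewrite -[f w - f z](subrK (D * (w - z))) (le_lt_trans (ncD _ _))// ncM.
lra.
Qed.

Lemma cderiv_cst c z : cderiv (fun=> c) z 0.
Proof.
move=> e e0; exists 1 => // w _.
by rewrite subrr mul0r subrr nc0 mulr_ge0 ?nc_ge0// ltW.
Qed.

Lemma cderiv_id z : cderiv id z 1.
Proof.
move=> e e0; exists 1 => // w _.
by rewrite mul1r subrr nc0 mulr_ge0 ?nc_ge0// ltW.
Qed.

Lemma cderivD f g z D E : cderiv f z D -> cderiv g z E ->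
  cderiv (fun w => f w + g w) z (D + E).
Proof.
move=> fD gE e e0.
have e20 : 0 < e / 2 by lra.
have [d1 d10 H1] := fD _ e20; have [d2 d20 H2] := gE _ e20.
exists (Num.min d1 d2); first by rewrite lt_min d10.
move=> w; rewrite lt_min => /andP[/H1 h1 /H2 h2].
rewrite (_ : _ - _ - _ = (f w - f z - D * (w - z)) + (g w - g z - E * (w - z))).
  by rewrite (le_trans (ncD _ _))//; lra.
by ring.
Qed.

Lemma cderivM f g z D E : cderiv f z D -> cderiv g z E ->
  cderiv (fun w => f w * g w) z (D * g z + f z * E).
Proof.
move=> fD gE e e0.
have D0 := nc_ge0 D; have fz0 := nc_ge0 (f z); have gz0 := nc_ge0 (g z).
pose K := nc D + nc (f z) + nc (g z) + 1.
have K0 : 0 < K by rewrite /K; lra.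
have e10 : 0 < e / K by rewrite divr_gt0.
have [d1 d10 H1] := fD _ e10; have [d2 d20 H2] := gE _ e10.
have m0 : 0 < Num.min 1 (e / K) by rewrite lt_min ltr01.
have [d3 d30 H3] := cderiv_ccont gE m0.
exists (Num.min d1 (Num.min d2 d3)); first by rewrite !lt_min d10 d20.
move=> w; rewrite !lt_min => /and3P[/H1 h1 /H2 h2 /H3].
rewrite lt_min => /andP[h3 h4].
rewrite (_ : _ - _ - _ = (f w - f z - D * (w - z)) * g w + D * (w - z) * (g w - g z)
  + f z * (g w - g z - E * (w - z))); last by ring.
have hg : nc (g w) <= nc (g z) + 1.
  by rewrite -[g w](subrK (g z)) (le_trans (ncD _ _))//; lra.
rewrite (le_trans (ncD _ _))// (le_trans (lerD (ncD _ _) (lexx _)))// !ncM.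
have wz0 := nc_ge0 (w - z).
have -> : e * nc (w - z) = e / K * nc (w - z) * (nc (g z) + 1) +
    nc D * nc (w - z) * (e / K) + nc (f z) * (e / K * nc (w - z)).
  by rewrite /K; field; rewrite -/K gt_eqF.
rewrite !lerD//.
- by apply: ler_pM => //; apply: nc_ge0.
- by apply: ler_wpM2l; [rewrite mulr_ge0|exact: ltW].
- by apply: ler_wpM2l.
Qed.

Lemma cderiv_inv z : z != 0 -> cderiv (fun w => w^-1) z (- z ^- 2).
Proof.
move=> z0 e e0.
have n0 : 0 < nc z by rewrite nc_gt0.
(* The remainder is exactly [(w - z)^2 / (z^2 w)], and the first radius ensures
   [nc w > nc z / 2]. *)
exists (Num.min (nc z / 2) (e * nc z ^+ 3 / 2)).
  by rewrite lt_min !divr_gt0// mulr_gt0// exprn_gt0.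
move=> w; rewrite lt_min => /andP[h1 h2].
have hw : nc z / 2 < nc w.
  by have := nc_sub z w; rewrite ncB; lra.
have w0 : w != 0 by rewrite -nc_gt0; lra.
rewrite (_ : _ - _ - _ = (w - z) * ((w - z) / (z ^+ 2 * w))); last first.
  by field; rewrite w0.
rewrite ncM mulrC ler_wpM2r ?nc_ge0// ncM ncV ler_pdivrMr; last first.
  by rewrite nc_gt0 mulf_neq0// expf_neq0.
rewrite ncM ncX (le_trans (ltW h2))//.
have -> : e * nc z ^+ 3 / 2 = e * (nc z ^+ 2 * (nc z / 2)) by rewrite exprS; field.
by rewrite ler_wpM2l ?ltW// ltr_pM2l// exprn_gt0.
Qed.

Lemma cderiv_comp f g z D E : cderiv g z D -> cderiv f (g z) E ->
  cderiv (fun w => f (g w)) z (E * D).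
Proof.
move=> gD fE e e0.
have D0 := nc_ge0 D; have E0 := nc_ge0 E.
pose K := nc D + 1 + nc E.
have K0 : 0 < K by rewrite /K; lra.
have e10 : 0 < e / K by rewrite divr_gt0.
have m0 : 0 < Num.min 1 (e / K) by rewrite lt_min ltr01.
have [d1 d10 H1] := fE _ e10; have [d2 d20 H2] := gD _ m0.
have [d3 d30 H3] := cderiv_ccont gD d10.
exists (Num.min d2 d3); first by rewrite !lt_min d20.
move=> w; rewrite !lt_min => /andP[/H2 h2 /H3/H1 h3].
rewrite (_ : _ - _ - _ = (f (g w) - f (g z) - E * (g w - g z)) +
   E * (g w - g z - D * (w - z))); last by ring.
have wz0 := nc_ge0 (w - z).
have h4 : nc (g w - g z - D * (w - z)) <= 1 * nc (w - z).
  by rewrite (le_trans h2)// ler_wpM2r// ge_min lexx.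
have h5 : nc (g w - g z - D * (w - z)) <= e / K * nc (w - z).
  by rewrite (le_trans h2)// ler_wpM2r// ge_min lexx orbT.
have h6 : nc (g w - g z) <= (nc D + 1) * nc (w - z).
  rewrite -[g w - g z](subrK (D * (w - z))) (le_trans (ncD _ _))// ncM.
  lra.
rewrite (le_trans (ncD _ _))// ncM.
have -> : e * nc (w - z) = e / K * ((nc D + 1) * nc (w - z)) + nc E * (e / K * nc (w - z)).
  by rewrite /K; field; rewrite -/K gt_eqF.
rewrite lerD//; last by apply: ler_wpM2l.
by rewrite (le_trans h3)// ler_wpM2l// ltW.
Qed.

Lemma cderiv_near f g z D e : 0 < e -> (forall w, nc (w - z) < e -> f w = g w) ->
  cderiv f z D -> cderiv g z D.
Proof.
move=> e0 fg fD k k0; have [d d0 H] := fD k k0.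
exists (Num.min d e); first by rewrite lt_min d0.
move=> w; rewrite lt_min => /andP[/H h1 we].
by rewrite -!fg// subrr nc0.
Qed.

Lemma cderivX f z D n : cderiv f z D -> exists E, cderiv (fun w => f w ^+ n) z E.
Proof.
move=> fD; elim: n => [|n [E IH]].
  by exists 0; rewrite (_ : (fun _ => _) = fun=> 1)//; exact: cderiv_cst.
exists (D * f z ^+ n + f z * E).
rewrite (_ : (fun _ => _) = fun w => f w * f w ^+ n); last first.
  by apply/funext => w; rewrite exprS.
exact: cderivM.
Qed.

End Derivation.

(** * The complex exponential *)

Section Exponential.
Variable R : realType.
Local Notation C := R[i].
Implicit Types (z w : C) (e x y : R).

Definition cexp z : C := (expR (complex.Re z))%:C * (cos (complex.Im z) +i* sin (complex.Im z)).

Lemma cexpD z w : cexp (z + w) = cexp z * cexp w.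
Proof.
case: z w => [a b] [c d]; rewrite /cexp /= expRD cosD sinD.
by apply/eqP; rewrite eq_complex /=; apply/andP; split; apply/eqP; ring.
Qed.

Lemma cexp0 : cexp 0 = 1.
Proof. by rewrite /cexp /= expR0 cos0 sin0 mul1r. Qed.

Lemma nc_cexp z : nc (cexp z) = expR (complex.Re z).
Proof.
rewrite /cexp ncM ncR ger0_norm ?expR_ge0// /nc /= cos2Dsin2 sqrtr1 mulr1//.
Qed.

Lemma cexp_neq0 z : cexp z != 0.
Proof. by rewrite -nc_gt0 nc_cexp expR_gt0. Qed.

Definition twopii : C := 0 +i* (2 * pi).

Lemma cexp_period z : cexp (z + twopii) = cexp z.
Proof.
rewrite cexpD [cexp twopii]/cexp /= expR0 mul1r mulr_natl cos2pi sin2pi.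
by rewrite mulr1.
Qed.

Lemma real_diff0 (f : R -> R) (l : R) : is_derive (0 : R) 1 f l -> forall e, 0 < e ->
  exists2 d, 0 < d & forall x, `|x| < d -> `|f x - f 0 - l * x| <= e * `|x|.
Proof.
move=> [fd fl] e e0.
move: fd => /cvg_ex[m mP].
have lm : l = m by rewrite -fl; apply: cvg_lim.
move: mP => /cvgrPdist_le/(_ _ e0); rewrite -lm => /nbhs_ballP[d /= d0 H].
exists d => // x xd.
have [->|x0] := eqVneq x 0.
  by rewrite mulr0 !subrr normr0 mulr0.
have := H x; rewrite /ball /= sub0r normrN => /(_ xd x0).
rewrite addr0 /GRing.scale /= mulr1.
have -> : f x - f 0 - l * x = - x * (l - x^-1 * (f x - f 0)) by field.
by move=> h; rewrite normrM normrN mulrC ler_wpM2r.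
Qed.

(** The derivative at 0 comes from those of [expR], [cos] and [sin]; [cexpD] carries it to every
    other point. *)
Lemma cexp_small e : 0 < e ->
  exists2 d : R, 0 < d & forall z, nc z < d -> nc (cexp z - 1 - z) <= e * nc z.
Proof.
move=> e0.
have e20 : 0 < Num.min 1 (e / 16) by rewrite lt_min ltr01; lra.
have [d1 d10 H1] := real_diff0 (is_derive_expR 0) e20.
have [d2 d20 H2] := real_diff0 (is_derive_cos 0) e20.
have [d3 d30 H3] := real_diff0 (is_derive_sin 0) e20.
(* With [t = nc z < e / 16], the real part contributes at most [4 (e / 16) t] and the imaginary part
   at most [4 t^2 + (e / 16) t], that is [9/16] of [e t] in all. *)
exists (Num.min (Num.min d1 d2) (Num.min d3 (Num.min 1 (e / 16)))).
  by rewrite !lt_min d10 d20 d30 ltr01; lra.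
move=> z; rewrite !lt_min => /and4P[/andP[h1 h2] h3 h4 h5].
have hx := nc_Re z; have hy := nc_Im z.
have := H1 _ (le_lt_trans hx h1); have := H2 _ (le_lt_trans hy h2).
have := H3 _ (le_lt_trans hy h3).
rewrite expR0 cos0 sin0 !(oppr0, mul1r, mul0r, subr0, addr0).
set t := nc z in h1 h2 h3 h4 h5 hx hy *.
have -> : cexp z - 1 - z = (expR (complex.Re z) * cos (complex.Im z) - 1 - complex.Re z)
   +i* (expR (complex.Re z) * sin (complex.Im z) - complex.Im z).
  by rewrite /cexp; case: (z) => a b /=; apply/eqP; rewrite eq_complex /=; apply/andP;
     split; apply/eqP; ring.
move: (complex.Re z) (complex.Im z) h1 h2 h3 h4 h5 hx hy => x y h1 h2 h3 h4 h5 hx hy.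
set m := Num.min _ _ => s1 c1 x1.
have m1 : m <= 1 by rewrite ge_min lexx.
have m2 : m <= e / 16 by rewrite ge_min lexx orbT.
have t0 : 0 <= t by apply: nc_ge0.
have m0 : 0 < m by [].
have cc : `|cos y - 1| <= e / 16 * t.
  by rewrite (le_trans c1)// ler_pM// ltW.
have ss : `|sin y - y| <= e / 16 * t.
  by rewrite (le_trans s1)// ler_pM// ltW.
have xx : `|expR x - 1 - x| <= e / 16 * t.
  by rewrite (le_trans x1)// ler_pM// ltW.
have xx1 : `|expR x - 1 - x| <= t.
  by rewrite (le_trans x1)// (le_trans _ hx)// ler_piMl.
have ex : `|expR x - 1| <= 2 * t.
  by rewrite -[expR x - 1](subrK x) (le_trans (ler_normD _ _))//; lra.
have sy : `|sin y| <= 1 by rewrite ler_norml sin_geN1 sin_le1.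
have cy : `|cos y| <= 1 by rewrite ler_norml cos_geN1 cos_le1.
have ex3 : `|expR x| <= 3.
  by rewrite -[expR x](subrK 1) (le_trans (ler_normD _ _))// normr1; lra.
apply: (le_trans (nc_ReIm _)) => /=.
have r1 : `|expR x * cos y - 1 - x| <= 3 * (e / 16 * t) + e / 16 * t.
  rewrite (_ : _ - x = expR x * (cos y - 1) + (expR x - 1 - x)); last by ring.
  by rewrite (le_trans (ler_normD _ _))// normrM lerD// ler_pM.
have sy2 : `|sin y| <= 2 * t.
  rewrite -[sin y](subrK y) (le_trans (ler_normD _ _))//.
  have : `|sin y - y| <= t by rewrite (le_trans s1)// (le_trans _ hy)// ler_piMl.
  lra.
have r2 : `|expR x * sin y - y| <= 2 * t * (2 * t) + e / 16 * t.
  rewrite (_ : _ - y = (expR x - 1) * sin y + (sin y - y)); last by ring.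
  by rewrite (le_trans (ler_normD _ _))// normrM lerD// ler_pM.
have := mulr_ge0 (ltW e0) t0.
nra.
Qed.

Lemma cderiv_cexp z : cderiv cexp z (cexp z).
Proof.
move=> e e0; have n0 : 0 < nc (cexp z) by rewrite nc_gt0 cexp_neq0.
have [d d0 H] := cexp_small (divr_gt0 e0 n0).
exists d => // w /H h.
rewrite -{1}(subrK z w) cexpD.
rewrite (_ : _ - _ - _ = cexp z * (cexp (w - z) - 1 - (w - z))); last by ring.
by rewrite ncM mulrC -ler_pdivlMr// mulrAC.
Qed.

End Exponential.

(** * Circle means, Cauchy's theorem and Taylor series of entire functions *)

Section Cauchy.
Variable R : realType.
Local Notation C := R[i].
Implicit Types (f g h q u : C -> C) (a b c z w D E : C) (e x y s t : R).

Lemma ccont_comp f g z : ccont g z -> ccont f (g z) -> ccont (fun w => f (g w)) z.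
Proof.
move=> gc fc e /fc[d d0 H]; have [k k0 K] := gc d d0.
by exists k => // w /K/H.
Qed.

Lemma ccontM f g z : ccont f z -> ccont g z -> ccont (fun w => f w * g w) z.
Proof.
move=> fc gc e e0.
have fz0 := nc_ge0 (f z); have gz0 := nc_ge0 (g z).
pose K := nc (f z) + nc (g z) + 2.
have K0 : 0 < K by rewrite /K; lra.
have m0 : 0 < Num.min 1 (e / K) by rewrite lt_min ltr01 divr_gt0.
have [d1 d10 H1] := fc _ m0; have [d2 d20 H2] := gc _ m0.
exists (Num.min d1 d2); first by rewrite lt_min d10.
move=> w; rewrite !lt_min => /andP[/H1 + /H2].
rewrite !lt_min !ltr_pdivlMr// => /andP[h1 h2] /andP[h3 h4].
rewrite (_ : _ - _ = (f w - f z) * (g w - g z) + (f w - f z) * g z + f z * (g w - g z));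
  last by ring.
rewrite (le_lt_trans (ncD _ _))// (le_lt_trans (lerD (ncD _ _) (lexx _)))// !ncM.
have := nc_ge0 (f w - f z); have := nc_ge0 (g w - g z).
rewrite /K in h2 h4; nra.
Qed.

(** At some dyadic scale the oscillation is at most 1; induction on the scale merges the bounds
    found on the two halves. *)
Lemma cont01_bounded (F : R -> C) : cont01 F ->
  exists M : R, forall x, 0 <= x <= 1 -> nc (F x) <= M.
Proof.
move=> Fc; have [h h0 hP] := cont01_unif Fc ltr01.
have [p /(_ p (leqnn p)) ph] := half_small h0.
have {hP}H x y : 0 <= x <= 1 -> 0 <= y <= 1 -> `|x - y| <= 2^-1 ^+ p ->
    nc (F x - F y) <= 1.
  by move=> x01 y01 xy; apply/ltW/hP => //; exact: le_lt_trans xy ph.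
elim: p F {Fc ph} H => [|p IH] F H.
  exists (nc (F 0) + 1) => x x01.
  rewrite -[F x](subrK (F 0)) (le_trans (ncD _ _))// addrC lerD2l H//.
    by rewrite lexx ler01.
  by rewrite subr0 expr0 ger0_norm; case/andP: x01.
have [|M1 H1] := IH (fun x => F (2^-1 * x)).
  move=> x y x01 y01 xy; apply: H; [lra|lra|].
  by rewrite -mulrBr normrM gtr0_norm// exprS ler_wpM2l.
have [|M2 H2] := IH (fun x => F (2^-1 * x + 2^-1)).
  move=> x y x01 y01 xy; apply: H; [lra|lra|].
  rewrite (_ : _ - _ = 2^-1 * (x - y)); last by ring.
  by rewrite normrM gtr0_norm// exprS ler_wpM2l.
exists (Num.max M1 M2) => x x01.
have [xh|xh] := leP x 2^-1.
  rewrite le_max; apply/orP; left.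
  have -> : x = 2^-1 * (2 * x) by field.
  by apply: H1; lra.
rewrite le_max; apply/orP; right.
have -> : x = 2^-1 * (2 * x - 1) + 2^-1 by field.
by apply: H2; lra.
Qed.

(** Logarithmic coordinates: the circle of radius [expR s] is described once as [x] runs over
    [0, 1]. *)
Definition circle_pt s x : C := cexp (s%:C + x%:C * twopii R).

(** The contour integral of [f(w) / w] over the circle of radius [expR s], divided by [2 i pi]. *)
Definition circ f s : C := mean (fun x => f (circle_pt s x)).

Lemma nc_circle_pt s x : nc (circle_pt s x) = expR s.
Proof. by rewrite /circle_pt nc_cexp /twopii; simpc. Qed.

Lemma circle_pt_neq0 s x : circle_pt s x != 0.
Proof. exact: cexp_neq0. Qed.

Lemma ccont_cexp f : (forall w, w != 0 -> ccont f w) ->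
  forall z, ccont (fun z => f (cexp z)) z.
Proof.
move=> fc z; apply: ccont_comp; last exact: fc (cexp_neq0 _).
exact: cderiv_ccont (cderiv_cexp z).
Qed.

Lemma circ_cont01 f s : (forall w, w != 0 -> ccont f w) ->
  cont01 (fun x => f (circle_pt s x)).
Proof. by move=> /ccont_cexp; exact: ccont_path. Qed.

Lemma circ_le f s e : (forall w, w != 0 -> ccont f w) ->
  (forall w, nc w = expR s -> nc (f w) <= e) -> nc (circ f s) <= e.
Proof.
move=> fc H; apply: mean_le; first exact: circ_cont01.
by move=> x _; apply: H; rewrite nc_circle_pt.
Qed.

Lemma circ_eq f g s : (forall w, nc w = expR s -> f w = g w) -> circ f s = circ g s.
Proof. by move=> fg; apply: mean_eq => x _; rewrite fg ?nc_circle_pt. Qed.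

(* The map [f \o cexp] has period [twopii], so two opposite edges of the
   parallelogram cancel and the other two are circle means. *)
Lemma circ_const_aux f s t : s <= t -> (forall w, w != 0 -> ccont f w) ->
  (forall w, w != 0 -> expR s <= nc w <= expR t -> exists D, cderiv f w D) ->
  circ f s = circ f t.
Proof.
move=> st fc fd.
have gc := ccont_cexp fc.
have H : pgram (fun z => f (cexp z)) s%:C (t - s)%:C (twopii R) = 0.
  apply: pgram_eq0 => // x y x01 y01.
  set z := _ + _ * twopii R.
  have [|D fD] := fd (cexp z) (cexp_neq0 _).
    rewrite nc_cexp (_ : complex.Re z = s + x * (t - s)); last by rewrite /z /twopii; simpc.
    by rewrite !ler_expR; case/andP: x01 => x0 x1; apply/andP; split; nra.
  by exists (D * cexp z); apply: cderiv_comp => //; exact: cderiv_cexp.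
move: H; rewrite /pgram.
have -> : edge (fun z => f (cexp z)) (s%:C + twopii R) (t - s)%:C =
          edge (fun z => f (cexp z)) s%:C (t - s)%:C.
  by congr (_ * _); apply: mean_eq => x _; rewrite addrAC cexp_period.
set X := edge _ _ (t - s)%:C; rewrite (addrC X) addrK => /eqP.
rewrite subr_eq0 -rmorphD addrC subrK /edge => /eqP/mulfI H; apply/esym/H.
by rewrite eq_complex /= negb_and mulf_neq0 ?orbT// gt_eqF// pi_gt0.
Qed.

(** Continuity uniform in the angle: [lebesgue_number01] is fed with radii that control the
    logarithmic radius [t] and the angle [y] together. *)
Lemma circ_cont f s : (forall w, w != 0 -> ccont f w) -> forall e, 0 < e ->
  exists2 d : R, 0 < d & forall t, `|t - s| < d -> nc (circ f t - circ f s) <= e.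
Proof.
move=> fc e e0.
have gc := ccont_cexp fc.
have e20 : 0 < e / 2 by lra.
have H x : exists d : R, 0 < d /\ forall t y, `|t - s| < d -> `|y - x| < d ->
    nc (f (circle_pt t y) - f (circle_pt s x)) < e / 2.
  have [d d0 dP] := gc (s%:C + x%:C * twopii R) _ e20.
  have K0 : 0 < 1 + 2 * pi :> R by have := pi_gt0 R; lra.
  exists (d / (1 + 2 * pi)); split; first by rewrite divr_gt0.
  move=> t y ts yx; apply: dP.
  rewrite (_ : _ - _ = (t - s)%:C + (y - x)%:C * twopii R); last first.
    by rewrite !rmorphB; ring.
  rewrite (le_lt_trans (ncD _ _))// ncM !ncR nc_i (@ger0_norm _ (2 * pi))//; last first.
    by have := pi_gt0 R; lra.
  move: ts yx; rewrite !ltr_pdivlMr//.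
  have := normr_ge0 (t - s); have := normr_ge0 (y - x); have := pi_gt0 R; nra.
have [d dP] := choice H.
have [|h h0 hP] := @lebesgue_number01 _ d; first by move=> x _; case: (dP x).
exists h => // t ts.
have F1 := circ_cont01 t fc; have F2 := circ_cont01 s fc.
rewrite /circ -mulN1r -meanZ// -meanD//; last exact: cont01Z.
apply: mean_le; first by apply: cont01D => //; exact: cont01Z.
move=> x x01; rewrite mulN1r.
have [c [c01 xc hc]] := hP x x01; have [d0 Hd] := dP c.
have h1 := Hd t x (lt_le_trans ts hc) xc.
have h2 : nc (f (circle_pt s x) - f (circle_pt s c)) < e / 2.
  by apply: Hd => //; rewrite subrr normr0.
rewrite (le_trans (nc_tri _ (f (circle_pt s c)) _))// (ncB (f (circle_pt s c))); lra.
Qed.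

(* Continuity across the circle of radius [expR s0] replaces differentiability
   there. *)
Lemma circ_const f s0 s t : (forall w, w != 0 -> ccont f w) ->
  (forall w, w != 0 -> nc w != expR s0 -> exists D, cderiv f w D) ->
  circ f s = circ f t.
Proof.
move=> fc fd; suff H r : circ f r = circ f s0 by rewrite H H.
apply/eqP; rewrite -subr_eq0; apply/eqP/nc_small => e e0.
have [d d0 dP] := circ_cont s0 fc e0.
have [rs|rs|->] := ltgtP r s0; last by rewrite subrr nc0 ltW.
  pose t0 := Num.max r (s0 - d / 2).
  have t0s : t0 < s0 by rewrite /t0 gt_max rs /=; lra.
  have rt0 : r <= t0 by rewrite /t0 le_max lexx.
  rewrite (@circ_const_aux f r t0)//.
    apply: dP; have : s0 - d / 2 <= t0 by rewrite /t0 le_max lexx orbT.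
    by move=> ?; rewrite ltr_norml; apply/andP; split; lra.
  move=> w w0 /andP[_ wt]; apply: fd => //.
  by rewrite lt_eqF// (le_lt_trans wt)// ltr_expR.
pose t0 := Num.min r (s0 + d / 2).
have t0s : s0 < t0 by rewrite /t0 lt_min rs /=; lra.
have rt0 : t0 <= r by rewrite /t0 ge_min lexx.
rewrite -(@circ_const_aux f t0 r)//.
  apply: dP; have : t0 <= s0 + d / 2 by rewrite /t0 ge_min lexx orbT.
  by move=> ?; rewrite ltr_norml; apply/andP; split; lra.
move=> w w0 /andP[wt _]; apply: fd => //.
by rewrite gt_eqF// (lt_le_trans _ wt)// ltr_expR.
Qed.

Lemma ccont_id z : ccont id z.
Proof. exact: cderiv_ccont (cderiv_id z). Qed.

(** Cauchy's theorem, since the mean of [w q(w)] is up to a constant the contour integral of [q]. It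
    does not depend on the radius, and it tends to 0 with the radius because [q] is bounded near
    0. *)
Lemma circ_idM_eq0 q s0 s : (forall w, ccont q w) ->
  (forall w, w != 0 -> nc w != expR s0 -> exists D, cderiv q w D) ->
  circ (fun w => w * q w) s = 0.
Proof.
move=> qc qd; apply: nc_small => e e0.
have fc w : w != 0 -> ccont (fun w => w * q w) w.
  by move=> _; apply: ccontM => //; exact: ccont_id.
have [d d0 dP] := qc 0 1 ltr01.
have q0 := nc_ge0 (q 0).
pose r := Num.min (d / 2) (e / (nc (q 0) + 1)).
have r0 : 0 < r by rewrite lt_min !divr_gt0//; lra.
rewrite (@circ_const _ s0 s (ln r))//; last first.
  by move=> w w0 /(qd w w0)[D qD]; exists (1 * q w + w * D); exact: cderivM (cderiv_id w) qD.
apply: circ_le => // w; rewrite lnK ?posrE// => wr.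
have h1 : nc (q w - q 0) < 1.
  apply: dP; rewrite subr0 wr.
  have : r <= d / 2 by rewrite ge_min lexx.
  by lra.
have h2 : nc (q w) <= nc (q 0) + 1.
  by rewrite -[q w](subrK (q 0)) (le_trans (ncD _ _))//; lra.
rewrite ncM wr.
have : r <= e / (nc (q 0) + 1) by rewrite ge_min lexx orbT.
rewrite ler_pdivlMr; last by lra.
by apply: le_trans; rewrite ler_wpM2l// ltW.
Qed.

Lemma ccontX f z n : ccont f z -> ccont (fun w => f w ^+ n) z.
Proof.
move=> fc; elim: n => [|n IH].
  rewrite (_ : (fun _ => _) = fun=> 1)//; exact: cderiv_ccont (cderiv_cst 1 z).
rewrite (_ : (fun _ => _) = fun w => f w * f w ^+ n); last first.
  by apply/funext => w; rewrite exprS.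
exact: ccontM.
Qed.

Lemma ccont_inv z : z != 0 -> ccont (fun w => w^-1) z.
Proof. by move=> z0; exact: cderiv_ccont (cderiv_inv z0). Qed.

Lemma circ_X s n : circ (fun w => w ^+ n.+1) s = 0.
Proof.
rewrite (_ : (fun _ => _) = fun w => w * w ^+ n); last first.
  by apply/funext => w; rewrite exprS.
apply: (@circ_idM_eq0 _ 0) => w; first by apply: ccontX; exact: ccont_id.
by move=> _ _; apply: cderivX; exact: cderiv_id.
Qed.

(** Independence of the radius again, now with the radius [expR e^-1 >= e^-1] tending to
    infinity. *)
Lemma circ_VX s n : circ (fun w => w^-1 ^+ n.+1) s = 0.
Proof.
apply: nc_small => e e0.
have fc w : w != 0 -> ccont (fun w => w^-1 ^+ n.+1) w.
  by move=> w0; apply: ccontX; exact: ccont_inv.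
rewrite (@circ_const _ 0 s e^-1)//; last first.
  by move=> w w0 _; apply: cderivX; exact: cderiv_inv.
apply: circ_le => // w wr; rewrite ncX ncV wr.
have ei : 0 < e^-1 by rewrite invr_gt0.
have h : (expR e^-1)^-1 <= e.
  rewrite -[leRHS]invrK lef_pV2 ?posrE ?expR_gt0//.
  by rewrite (le_trans _ (expR_ge1Dx _))// lerDr.
rewrite exprS (le_trans _ h)// ler_piMr ?invr_ge0 ?expR_ge0//.
rewrite exprn_ile1 ?invr_ge0 ?expR_ge0// invf_le1 ?expR_gt0//.
by rewrite (le_trans _ (expR_ge1Dx _))// lerDl ltW.
Qed.

(** The coefficient sequences of power series with infinite radius of convergence. *)
Definition rapid (a : nat -> C) := forall r : R, 0 < r ->
  exists M : R, forall n, nc (a n) * r ^+ n <= M.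

(* The difference quotient [q] at [z] is only known to be continuous at [z],
   which is why [circ_const] tolerates an exceptional circle. *)
Lemma entire_series u : (forall z, exists D, cderiv u z D) ->
  exists2 a : nat -> C, rapid a & forall z, u z = csum (fun n => a n * z ^+ n).
Proof.
move=> ud.
have uc z : ccont u z by have [D uD] := ud z; exact: cderiv_ccont uD.
pose F n w := u w * w^-1 ^+ n.
have Fc n w : w != 0 -> ccont (F n) w.
  by move=> w0; apply: ccontM => //; apply: ccontX; exact: ccont_inv.
(* Cauchy's coefficient formula. By [aE] the radius is free, so a bound for [u] on each circle makes
   [a] rapid. *)
pose a n := circ (F n) 0.
have aE n s : a n = circ (F n) s.
  apply: (@circ_const (F n) 0) => [w w0|w w0 _]; first exact: Fc.
  have [D uD] := ud w; have [E iE] := cderivX n (cderiv_inv w0).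
  by exists (D * w^-1 ^+ n + u w * E); exact: cderivM.
exists a.
  move=> r r0.
  have [M HM] := cont01_bounded (circ_cont01 (ln r) (fun w _ => uc w)).
  exists M => n; rewrite (aE n (ln r)) -ler_pdivlMr ?exprn_gt0//.
  apply: mean_le => [|x x01]; first by apply: circ_cont01 => w; exact: Fc.
  rewrite /F ncM ncX ncV nc_circle_pt lnK ?posrE// -exprVn.
  by rewrite ler_wpM2r ?HM// exprn_ge0// invr_ge0 ltW.
move=> z; have [D uD] := ud z.
pose q w := if w == z then D else (u w - u z) / (w - z).
(* The exceptional circle is the one through [z]. For [z = 0] the bad point lies on no circle and
   any value of [s0] serves. *)
pose s0 := if z == 0 then 0 else ln (nc z).
have qd w : w != z -> exists D, cderiv q w D.
  move=> wz; have [E uE] := ud w.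
  have wz0 : w - z != 0 by rewrite subr_eq0.
  have n0 : 0 < nc (w - z) by rewrite nc_gt0.
  have d1 : cderiv (fun w => u w + - u z) w (E + 0) := cderivD uE (cderiv_cst _ _).
  have d2 : cderiv (fun w => w + - z) w (1 + 0) := cderivD (cderiv_id _) (cderiv_cst _ _).
  have d3 := cderiv_comp d2 (cderiv_inv wz0).
  eexists; apply: cderiv_near n0 _ (cderivM d1 d3) => v vw.
  rewrite /q; case: eqVneq => // vz; move: vw; rewrite vz ncB ltxx //.
have qc w : ccont q w.
  have [->|wz] := eqVneq w z; last by have [E qE] := qd w wz; exact: cderiv_ccont qE.
  move=> e e0; have e20 : 0 < e / 2 by lra.
  have [d d0 H] := uD _ e20; exists d => // v /H h.
  rewrite /q eqxx; case: eqVneq => [_|vz]; first by rewrite subrr nc0.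
  have n0 : 0 < nc (v - z) by rewrite nc_gt0 subr_eq0.
  rewrite (_ : _ - D = (u v - u z - D * (v - z)) / (v - z)); last first.
    by field; rewrite subr_eq0.
  rewrite ncM ncV ltr_pdivrMr//; nra.
have f0 s : circ (fun w => w * q w) s = 0.
  apply: (@circ_idM_eq0 _ s0) => // w w0 ws; apply: qd.
  apply/eqP => wz; move: ws w0; rewrite wz /s0 => + z0.
  by rewrite (negbTE z0) lnK ?eqxx// posrE nc_gt0.
have zq0 := nc_ge0 z.
have r0 : 0 < 2 * nc z + 1 by lra.
(* On this circle [nc (z / w) <= 1/2], so the geometric remainder has ratio 1/2. *)
pose s := ln (2 * nc z + 1).
have Pr x : nc (circle_pt s x) = 2 * nc z + 1 by rewrite nc_circle_pt lnK.
have gc w : w != 0 -> ccont (fun w => w * q w) w.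
  by move=> _; apply: ccontM => //; exact: ccont_id.
have [S HS] := cont01_bounded (circ_cont01 s gc).
have S0 : 0 <= S by apply: le_trans (HS 0 _); rewrite ?nc_ge0// lexx ler01.
apply/esym/(@csum_unique _ (S + nc (u z))) => -[|n].
  by rewrite big_ord0 subr0 expr0 mulr1 lerDr.
pose P := circle_pt s.
(* The remainder: summing [(z / w)^k (u w - u z)] over [k <= n] gives
   [w q(w) - (z / w)^(n+1) w q(w)], and the mean of the first term vanishes by [f0]. *)
pose p x := (z / P x) ^+ n.+1 * (P x * q (P x)).
have pc : cont01 p.
  apply: (@circ_cont01 (fun w => (z / w) ^+ n.+1 * (w * q w))) => w w0.
  apply: ccontM; last exact: gc.
  apply: ccontX; apply: ccontM; last exact: ccont_inv.
  exact: cderiv_ccont (cderiv_cst z w).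
have c1 k : cont01 (fun x => F k (P x)) by apply: circ_cont01 => w; exact: Fc.
have c2 k : cont01 (fun x => (P x)^-1 ^+ k).
  by apply: (@circ_cont01 (fun w => w^-1 ^+ k)) => w w0; apply: ccontX; exact: ccont_inv.
have c3 k : cont01 (fun x => z ^+ k * (F k (P x) + - u z * (P x)^-1 ^+ k)).
  by apply: cont01Z; apply: cont01D => //; exact: cont01Z.
have [_] := mean_sum (index_enum 'I_n.+1) (fun k : 'I_n.+1 => c3 k).
have -> : \sum_(k < n.+1) mean (fun x => z ^+ k * (F k (P x) + - u z * (P x)^-1 ^+ k)) =
    \sum_(k < n.+1) a k * z ^+ k - u z.
  transitivity (\sum_(k < n.+1) (a k * z ^+ k + - u z * (k == 0 :> nat)%:R)).
    apply: eq_bigr => k _; rewrite meanZ; last by apply: cont01D => //; exact: cont01Z.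
    rewrite meanD//; last exact: cont01Z.
    rewrite meanZ// (aE k s) mulrDr mulrC; congr (_ + _).
    have -> : mean (fun x => (P x)^-1 ^+ k) = circ (fun w => w^-1 ^+ k) s by [].
    case: k => -[|k] /= _; last by rewrite circ_VX !mulr0.
    by rewrite expr0 mul1r; congr (_ * _); exact: mean_cst.
  rewrite big_split /=; congr (_ + _).
  rewrite -mulr_sumr big_ord_recl /= big1 ?addr0 ?mulr1// => k _.
have -> : mean (fun x => \sum_(k < n.+1) z ^+ k * (F k (P x) + - u z * (P x)^-1 ^+ k)) =
    - mean p.
  have -> : - mean p = mean (fun x => P x * q (P x) + -1 * p x).
    rewrite meanD; [|exact: circ_cont01 s gc|exact: cont01Z].
    by rewrite meanZ// mulN1r -/(circ (fun w => w * q w) s) f0 add0r.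
  apply: mean_eq => x _.
  have w0 : P x != 0 by exact: circle_pt_neq0.
  have wz : P x != z.
    by apply/eqP => wz; move: (Pr x); rewrite -/(P x) wz; lra.
  have wz0 : P x - z != 0 by rewrite subr_eq0.
  rewrite /p; move: (P x) w0 wz wz0 => w w0 wz wz0.
  transitivity ((u w - u z) * \sum_(k < n.+1) (z / w) ^+ k).
    rewrite mulr_sumr; apply: eq_bigr => k _.
    by rewrite /F exprMn exprVn; ring.
  rewrite /q (negbTE wz).
  have -> : w * ((u w - u z) / (w - z)) + -1 * ((z / w) ^+ n.+1 *
      (w * ((u w - u z) / (w - z)))) =
      - (w * ((u w - u z) / (w - z)) * ((z / w) ^+ n.+1 - 1)) by ring.
  by rewrite subrX1; field; rewrite w0.
move=> E; rewrite ncB -E ncN; apply: mean_le => // x x01.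
rewrite /p ncM ncX (ncM z) ncV Pr.
have h1 : nc z / (2 * nc z + 1) <= 2^-1 by rewrite ler_pdivrMr//; lra.
have h0 : 0 <= nc z / (2 * nc z + 1) by rewrite divr_ge0// ltW.
have h2 : (nc z / (2 * nc z + 1)) ^+ n.+1 <= 2^-1 ^+ n.+1.
  by rewrite lerXn2r ?nnegrE.
have h3 : nc (P x * q (P x)) <= S + nc (u z).
  by rewrite (le_trans (HS _ x01))// lerDl nc_ge0.
by rewrite mulrC; apply: ler_pM => //; rewrite ?nc_ge0 ?exprn_ge0.
Qed.

End Cauchy.

(** * Termwise differentiation and other manipulations of entire power series *)

Section PowerSeries.
Variable R : realType.
Local Notation C := R[i].
Implicit Types (a : nat -> C) (z w : C) (e x y s t : R).

Lemma rapid_gdom a (r : R) : rapid a -> exists M, forall z, nc z <= r ->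
  gdom M (fun n => a n * z ^+ n).
Proof.
move=> ar; have r0 : 0 < 2 * `|r| + 1 by have := normr_ge0 r; lra.
have [M HM] := ar _ r0; exists M => z zr n.
rewrite ncM ncX.
have h : nc z ^+ n <= (2 * `|r| + 1) ^+ n * 2^-1 ^+ n.
  rewrite -exprMn; apply: lerXn2r; rewrite ?nnegrE ?nc_ge0//.
  by rewrite (le_trans zr)// (le_trans (ler_norm _))//; lra.
rewrite (le_trans (ler_wpM2l (nc_ge0 _) h))// mulrA.
by rewrite ler_wpM2r// exprn_ge0.
Qed.

(** The constant is crude, but it is geometric in [n], so rapid coefficients absorb it. The
    induction writes the remainder of order [n + 1] as [w] times the previous one plus
    [n z^(n-1) (w - z)^2]. *)
Lemma expr_taylor1 z w n : nc (w - z) <= 1 ->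
  nc (w ^+ n - z ^+ n - n%:R * z ^+ n.-1 * (w - z)) <=
  nc (w - z) ^+ 2 * (2 * (nc z + 1)) ^+ n.
Proof.
move=> wz1; have z0 := nc_ge0 z; have wz0 := nc_ge0 (w - z).
have hw : nc w <= nc z + 1.
  by rewrite -[w](subrK z) (le_trans (ncD _ _))//; lra.
elim: n => [|n IH].
  by rewrite !expr0 subrr !mul0r subrr nc0 mulr1 exprn_ge0.
rewrite (_ : _ - _ - _ = w * (w ^+ n - z ^+ n - n%:R * z ^+ n.-1 * (w - z)) +
   n%:R * z ^+ n.-1 * (w - z) ^+ 2); last first.
  case: n {IH} => [|n]; first by rewrite /= ?expr0 ?expr1; ring.
  by rewrite /= !exprS -!natr1; ring.
rewrite (le_trans (ncD _ _))// !ncM !ncX nc_nat.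
set s := nc z + 1; set q := nc (w - z) ^+ 2; set E := nc _ in IH *.
have s1 : 1 <= s by rewrite /s; lra.
have h1 : nc w * E <= s * (q * (2 * s) ^+ n).
  by apply: ler_pM => //; apply: nc_ge0.
have h2 : n%:R * nc z ^+ n.-1 <= s * (2 * s) ^+ n.
  rewrite exprMn mulrCA; apply: ler_pM; rewrite ?exprn_ge0//.
    by rewrite -natrX ler_nat ltnW// ltn_expl.
  apply: (@le_trans _ _ (s ^+ n.-1)).
    by apply: lerXn2r; rewrite ?nnegrE /s; lra.
  rewrite -exprS; apply: ler_weXn2l => //.
  by rewrite (leq_trans (leq_pred _)).
have q0 : 0 <= q by rewrite exprn_ge0.
have h3 := ler_wpM2r q0 h2; rewrite (exprS (2 * s) n) (le_trans (lerD h1 h3))//.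
rewrite le_eqVlt; apply/orP; left; apply/eqP; ring.
Qed.

(** By [expr_taylor1] the first-order remainders of the terms add up to at most a constant times
    [nc (w - z)^2]. *)
Lemma csum_cderiv a z : rapid a ->
  cderiv (fun z => csum (fun n => a n * z ^+ n)) z
    (csum (fun n => a n * (n%:R * z ^+ n.-1))).
Proof.
move=> ar e e0.
have z0 := nc_ge0 z.
pose s := 2 * (nc z + 1).
have s0 : 0 < s by rewrite /s; lra.
have [M1 HM1] := rapid_gdom s ar.
have HM : forall n, nc (a n) * s ^+ n <= M1 * 2^-1 ^+ n.
  move=> n; have := HM1 s%:C; rewrite ncR gtr0_norm// => /(_ (lexx _) n).
  by rewrite ncM ncX ncR gtr0_norm.
have M0 : 0 <= M1 by have := HM 0%N; rewrite !expr0 !mulr1; apply: le_trans (nc_ge0 _).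
have [M2 HM2] := rapid_gdom (nc z + 1) ar.
have gD : gdom M1 (fun n => a n * (n%:R * z ^+ n.-1)).
  move=> n; rewrite !ncM ncX nc_nat (le_trans _ (HM n))// ler_wpM2l ?nc_ge0//.
  rewrite /s exprMn; apply: ler_pM; rewrite ?exprn_ge0//.
    by rewrite -natrX ler_nat ltnW// ltn_expl.
  apply: (@le_trans _ _ ((nc z + 1) ^+ n.-1)).
    by apply: lerXn2r; rewrite ?nnegrE; lra.
  by apply: ler_weXn2l; [lra|exact: leq_pred].
exists (Num.min 1 (e / (2 * M1 + 1))); first by rewrite lt_min ltr01 divr_gt0//; lra.
move=> w; rewrite lt_min ltr_pdivlMr; last by lra.
move=> /andP[w1 w2].
have hw : nc w <= nc z + 1.
  by rewrite -[w](subrK z) (le_trans (ncD _ _))//; lra.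
have gw := HM2 w hw; have gz : gdom M2 (fun n => a n * z ^+ n) by apply: HM2; lra.
rewrite mulrC -(csumZ (w - z) gD) -(csumB gw gz).
have gB : gdom (M2 + nc (-1) * M2) (fun n => a n * w ^+ n - a n * z ^+ n).
  by move=> n; have := gdomD gw (gdomZ (-1) gz) n; rewrite mulN1r.
rewrite -(csumB gB (gdomZ (w - z) gD)).
set b := fun n => _.
have gb : gdom (nc (w - z) ^+ 2 * M1) b.
  move=> n; rewrite /b.
  rewrite (_ : _ - _ = a n * (w ^+ n - z ^+ n - n%:R * z ^+ n.-1 * (w - z))); last by ring.
  have q0 : 0 <= nc (w - z) ^+ 2 by rewrite exprn_ge0// nc_ge0.
  rewrite ncM -[leRHS]mulrA; apply: le_trans (ler_wpM2l q0 (HM n)).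
  by rewrite [leRHS]mulrCA ler_wpM2l ?nc_ge0//; apply: expr_taylor1; exact: ltW.
rewrite (le_trans (csum_le gb))//.
have := nc_ge0 (w - z); nra.
Qed.

Lemma csum_shift a (M : R) N : gdom M a ->
  csum a - \sum_(k < N) a k = csum (fun k => a (N + k)%N).
Proof.
move=> aM; apply/esym/(@csum_unique _ (2 * M)) => n.
have E : \sum_(k < N) a k + \sum_(k < n) a (N + k)%N = \sum_(k < N + n) a k.
  by rewrite big_split_ord.
rewrite -addrA -opprD E.
rewrite (le_trans (csum_approx (N + n) aM))// exprD.
have h1 : 2^-1 ^+ N <= 1 :> R by rewrite exprn_ile1// invf_le1// ler1n.
have h2 : 0 <= 2^-1 ^+ n :> R by rewrite exprn_ge0.
rewrite ler_wpM2l ?mulr_ge0 ?(gdom_ge0 aM)// ler_piMl//.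
Qed.

Lemma csum_delta m (c : C) : csum (fun j => if j == m then c else 0) = c.
Proof.
have c0 := nc_ge0 c.
apply: (@csum_unique _ (nc c * 2 ^+ m)) => n.
have [nm|mn] := leqP n m.
  rewrite big1; last by move=> k _; rewrite ltn_eqF// (leq_trans (ltn_ord k)).
  rewrite subr0 -mulrA ler_peMr// -(subnK nm) exprD -mulrA -exprMn mulfV// expr1n mulr1.
  by rewrite exprn_ege1// ler1n.
rewrite (bigD1 (Ordinal mn))//= eqxx big1; last first.
  by move=> k /negbTE kn; case: eqP => // E; move: kn; rewrite -val_eqE /= E eqxx.
by rewrite addr0 subrr nc0 !mulr_ge0// exprn_ge0.
Qed.

End PowerSeries.

(** * Cartan's lower bound for polynomials on a circle *)

Section Cartan.
Variable R : realType.
Local Notation C := R[i].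
Implicit Types (x h : R).

Definition fdiff h (f : R -> R) x := f (x + h) - f x.

(** By Taylor's formula, one difference sends the coefficient of degree [d + 1] to [(d + 1) h] times
    itself in degree [d], and nothing of higher degree survives. *)
Lemma fdiff_poly h d (p : {poly R}) : (size p <= d.+1)%N ->
  iter d (fdiff h) (horner p) = fun=> p`_d * d`!%:R * h ^+ d.
Proof.
elim: d p => [|d IH] p sp.
  apply/funext => x /=; rewrite (size1_polyC sp) hornerC coefC /= expr0 !mulr1//.
pose q := \sum_(i < d.+1) (h ^+ i.+1 *: p^`N(i.+1)).
have E : fdiff h (horner p) = horner q.
  apply/funext => x; rewrite /fdiff (nderiv_taylor_wide (mulrC _ _) sp).
  rewrite big_ord_recl expr0 mulr1 nderivn0 addrAC subrr add0r.
  rewrite /q horner_sum; apply: eq_bigr => i _.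
  by rewrite hornerZ mulrC.
rewrite iterSr E IH.
  apply/funext => x; rewrite /q coef_sum big_ord_recl /= expr1 big1 => [|i _].
    by rewrite coefZ coef_nderivn add1n bin1 addr0 -mulr_natr factS natrM exprS; ring.
  rewrite coefZ coef_nderivn nth_default ?mul0rn ?mulr0//.
  by rewrite (leq_trans sp)//= /bump /=; lia.
apply: (leq_trans (size_sum _ _ _)); apply/bigmax_leqP => i _.
rewrite (leq_trans (size_scale_leq _ _))// (leq_trans (size_poly _ _))//.
by rewrite leq_subLR (leq_trans sp)//; lia.
Qed.

Lemma fdiff_le h d (f : R -> R) x (B : R) :
  (forall k, (k <= d)%N -> `|f (x + k%:R * h)| <= B) ->
  `|iter d (fdiff h) f x| <= 2 ^+ d * B.
Proof.
elim: d f B => [|d IH] f B H.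
  by have := H 0%N (leqnn _); rewrite mul0r addr0 expr0 mul1r.
rewrite iterSr exprSr -mulrA; apply: IH => k kd.
rewrite /fdiff (le_trans (ler_normB _ _))//.
have h1 := H k (leqW kd); have h2 := H k.+1 kd.
rewrite -natr1 mulrDl mul1r addrA in h2.
lra.
Qed.

Lemma fact_expn (n : nat) : (0 < n)%N -> n%:R ^+ n < expR 1 ^+ n * n`!%:R :> R.
Proof.
case: n => // n _; have := @expR_ge1Dxn R n.+1%:R n (ler0n _ _).
rewrite -expRM_natl mulr1 => h.
rewrite -ltr_pdivrMr ?ltr0n ?fact_gt0//.
by rewrite (lt_le_trans _ h)// ltrDr.
Qed.

(* The [d]-th finite difference with step [r / d] of the monic polynomial with
   roots [s] equals [d! (r / d) ^ d]. *)
Lemma cartan_real (s : seq R) (r : R) : 0 < r ->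
  exists2 x, r <= x <= 2 * r &
    (r / (2 * expR 1)) ^+ size s <= \prod_(a <- s) `|x - a|.
Proof.
move=> r0; have [->|sn] := eqVneq s [::].
  by exists r; rewrite ?big_nil ?expr0//; apply/andP; split; lra.
have d0 : (0 < size s)%N by case: (s) sn.
set d := size s in d0 *.
have dR : 0 < d%:R :> R by rewrite ltr0n.
pose p := \prod_(a <- s) ('X - a%:P).
have sp : size p = d.+1 by rewrite size_prod_XsubC.
have pd : p`_d = 1.
  by have /monicP := monic_prod_XsubC s xpredT id; rewrite lead_coefE -/p sp.
have pE x : `|p.[x]| = \prod_(a <- s) `|x - a|.
  by rewrite horner_prod normr_prod; apply: eq_bigr => a _; rewrite !hornerE.
pose h := r / d%:R.
have e0 : 0 < expR 1 :> R by exact: expR_gt0.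
apply: contrapT => H.
have : `|iter d (fdiff h) (horner p) r| <= 2 ^+ d * (r / (2 * expR 1)) ^+ d.
  apply: fdiff_le => k kd; rewrite leNgt; apply/negP => K.
  apply: H; exists (r + k%:R * h); last by rewrite -pE ltW.
  rewrite lerDl mulr_ge0 ?divr_ge0 ?(ltW r0)//= (_ : 2 * r = r + r) ?lerD2l; last by ring.
  rewrite /h mulrCA ler_piMr ?(ltW r0)// ler_pdivrMr// mul1r ler_nat//.
(* [d! (r / d)^d] exceeds [2^d (r / (2 e))^d = (r / e)^d], strictly, by [fact_expn]. *)
rewrite fdiff_poly ?sp// pd mul1r leNgt => /negP; apply.
rewrite ger0_norm ?mulr_ge0 ?exprn_ge0 ?divr_ge0 ?(ltW r0)//.
rewrite -exprMn (_ : 2 * (r / (2 * expR 1)) = r / expR 1); last first.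
  by field; rewrite gt_eqF.
rewrite /h !exprMn !exprVn mulrCA ltr_pM2l ?exprn_gt0//.
rewrite ltr_pdivlMr ?exprn_gt0// mulrC ltr_pdivrMr ?exprn_gt0//.
by rewrite mulrC; exact: fact_expn.
Qed.

(** The product of [r / (2 e)], the loss per root in [cartan_real], and [1 / (4 r)]. *)
Definition kappa : R := (8 * expR 1)^-1.

Lemma kappa_gt0 : 0 < kappa.
Proof. by rewrite invr_gt0 mulr_gt0// expR_gt0. Qed.

Lemma kappa_le : kappa <= 2^-1.
Proof.
have e1 : 1 <= expR 1 :> R by have := @expR_ge1Dx R 1; lra.
by rewrite lef_pV2 ?posrE ?mulr_gt0 ?expR_gt0//; lra.
Qed.

(** For the roots [a <= 4 r], [cartan_real] applies and [a^-1] is at least [1 / (4 r)]. For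
    [a > 4 r], [x <= 2 r < a / 2] makes the factor at least [1/2], hence at least [kappa]. *)
Lemma cartan_ratio (s : seq R) (r : R) (N : nat) : 0 < r ->
  {in s, forall a, 0 < a} -> (size s <= N)%N ->
  exists2 x, r <= x <= 2 * r & kappa ^+ N <= \prod_(a <- s) (`|x - a| / a).
Proof.
move=> r0 s0 sN.
pose s1 := [seq a <- s | a <= 4 * r]; pose s2 := [seq a <- s | ~~ (a <= 4 * r)].
have [x xr xP] := cartan_real s1 r0.
exists x => //.
have k0 := kappa_gt0.
have k1 : kappa <= 1 by have := kappa_le; lra.
apply: (@le_trans _ _ (kappa ^+ size s)).
  by apply: ler_wiXn2l => //; exact: ltW.
rewrite -(count_predC (fun a => a <= 4 * r) s) -!size_filter exprD.
rewrite (bigID (fun a => a <= 4 * r)) /=.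
rewrite -(big_filter s (fun a => a <= 4 * r)) -(big_filter s (fun a => ~~ (a <= 4 * r))).
apply: ler_pM; rewrite ?exprn_ge0 ?(ltW k0)//.
  rewrite -/s1 big_split /=.
  have -> : kappa ^+ size s1 = (r / (2 * expR 1)) ^+ size s1 * (4 * r)^-1 ^+ size s1.
    rewrite -exprMn; congr (_ ^+ _); rewrite /kappa; field.
    by rewrite !gt_eqF// expR_gt0.
  apply: ler_pM => //; rewrite ?exprn_ge0 ?divr_ge0 ?mulr_ge0 ?invr_ge0 ?(ltW r0) ?expR_ge0//.
    by rewrite mulr_ge0// ltW.
  have : {in s1, forall a, (4 * r)^-1 <= a^-1}.
    move=> a; rewrite mem_filter => /andP[ar /s0 a0].
    by rewrite lef_pV2// posrE// mulr_gt0.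
  elim: (s1) => [|a l IH] H; first by rewrite big_nil expr0.
  rewrite big_cons exprS; apply: ler_pM; rewrite ?exprn_ge0 ?invr_ge0 ?mulr_ge0 ?(ltW r0)//.
    by apply: H; rewrite mem_head.
  by apply: IH => b bl; apply: H; rewrite in_cons bl orbT.
rewrite -/s2.
have : {in s2, forall a, kappa <= `|x - a| / a}.
  move=> a; rewrite mem_filter -ltNge => /andP[ar /s0 a0].
  rewrite (le_trans kappa_le)// ler_pdivlMr//.
  by rewrite distrC ger0_norm; lra.
elim: (s2) => [|a l IH] H; first by rewrite big_nil expr0.
rewrite big_cons exprS; apply: ler_pM; rewrite ?exprn_ge0 ?(ltW k0)//.
  by apply: H; rewrite mem_head.
by apply: IH => b bl; apply: H; rewrite in_cons bl orbT.
Qed.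

(** [|z - a| >= | |z| - |a| |] replaces the roots by their moduli, so that one radius from the real
    case serves the whole circle. Up to sign the constant term is the leading coefficient times the
    product of the roots; dividing by it produces the ratios of [cartan_ratio]. *)
Lemma cartan_complex (p : {poly C}) (r : R) (N : nat) : 0 < r ->
  p`_0 != 0 -> (size p <= N.+1)%N ->
  exists2 x, r <= x <= 2 * r &
    forall z : C, nc z = x -> nc p`_0 * kappa ^+ N <= nc p.[z].
Proof.
move=> r0 p0 sp.
have pn0 : p != 0 by apply: contraNneq p0 => ->; rewrite coef0.
have [s E] := closed_field_poly_normal p.
have sE : size p = (size s).+1.
  by rewrite {1}E size_scale ?lead_coef_eq0// size_prod_XsubC.
have pz z : p.[z] = lead_coef p * \prod_(a <- s) (z - a).
  rewrite {1}E hornerZ horner_prod; congr (_ * _).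
  by apply: eq_bigr => a _; rewrite !hornerE.
have s0 : {in s, forall a : C, 0 < nc a}.
  move=> a sa; rewrite nc_gt0; apply: contraNneq p0 => a0.
  rewrite -horner_coef0 pz (big_rem a sa) /= a0.
  by rewrite subr0 mul0r mulr0.
have [||x xr xP] := @cartan_ratio [seq nc a | a <- s] r N r0.
- by move=> _ /mapP[a sa ->]; exact: s0.
- by rewrite size_map -ltnS -sE.
exists x => // z zx.
rewrite -horner_coef0 !pz ncM ncM -mulrA ler_wpM2l ?nc_ge0//.
have nc_prod (F : C -> C) : nc (\prod_(a <- s) F a) = \prod_(a <- s) nc (F a).
  exact: (big_morph _ (@ncM R) (nc1 R)).
rewrite !nc_prod.
have h0 : 0 <= \prod_(a <- s) nc (0 - a) by apply: prodr_ge0 => a _; exact: nc_ge0.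
apply: (le_trans (ler_wpM2l h0 xP)).
rewrite big_map -big_split /= big_seq [leRHS]big_seq.
apply: ler_prod => a sa; have := s0 a sa => a0.
rewrite sub0r ncN mulrCA mulfV ?gt_eqF// mulr1 normr_ge0 /=.
rewrite ler_norml -zx nc_sub andbT lerNl opprB ncB.
exact: nc_sub.
Qed.

End Cartan.

(** * Lower bounds for [phi] on suitable circles *)

Section LowerBound.
Variable R : realType.
Local Notation C := R[i].
Variables (r : nat) (t : nat -> C) (M A : R).
Hypotheses (r0 : (0 < r)%N) (A0 : 0 < A).
Hypothesis tM : forall n, nc (t n) <= M * A ^+ n / n`!%:R ^+ r.

Lemma exp_term (x : R) n : 0 <= x -> x ^+ n / n`!%:R <= expR x.
Proof.
case: n => [|n] x0; first by rewrite expr0 fact0 divr1 -expR0 ler_expR.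
by rewrite (le_trans _ (expR_ge1Dxn n x0))// lerDr.
Qed.

Lemma fact_pow_gt0 n : 0 < n`!%:R ^+ r :> R.
Proof. by rewrite exprn_gt0// ltr0n fact_gt0. Qed.

Lemma bound_ge0 : 0 <= M.
Proof.
have := tM 0; rewrite expr0 fact0 expr1n mulr1 divr1.
exact: le_trans (nc_ge0 _).
Qed.

Lemma fact_decay_rapid : rapid t.
Proof.
move=> x x0; exists (M * expR (A * x)) => n.
have Ax : 0 <= A * x by rewrite mulr_ge0// ltW.
rewrite (le_trans (ler_wpM2r _ (tM n)))//; first by rewrite exprn_ge0// ltW.
rewrite -!mulrA ler_wpM2l ?bound_ge0//.
rewrite (le_trans _ (exp_term n Ax))// mulrCA mulrC -exprMn.
rewrite ler_wpM2l ?exprn_ge0//.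
rewrite lef_pV2 ?posrE ?fact_pow_gt0// ?ltr0n ?fact_gt0//.
rewrite -{1}[n`!%:R]expr1; apply: ler_weXn2l => //.
by rewrite ler1n fact_gt0.
Qed.

(** This is [phi] when [t] is the sequence attached to the functional; evaluated at [z^r] it also
    represents the r-even entire functions. *)
Definition pser (z : C) : C := csum (fun n => t n * z ^+ n).

(** Truncate at degree [N = L n]. For [m >= N] one has [n <= m / L], so on a circle of radius at
    most [2 n^r] the [m]-th term of the tail is at most [M (B / L^r)^m]: a large [L] makes this
    ratio beat [kappa]. *)
Lemma lower_bound0 : t 0 != 0 ->
  exists c b : R, [/\ 0 < c, 0 < b & forall n, (0 < n)%N ->
    exists2 x, n%:R ^+ r <= x <= 2 * n%:R ^+ r &
      forall z, nc z = x -> c <= b ^+ n * nc (pser z)].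
Proof.
move=> t0.
have T0 : 0 < nc (t 0) by rewrite nc_gt0.
have M0 : 0 < M.
  by have := tM 0; rewrite expr0 fact0 expr1n mulr1 divr1; exact: lt_le_trans.
have k0 := kappa_gt0 R; have k1 := kappa_le R.
set k := kappa R in k0 k1.
(* Chosen so that the tail, at most [2 M q^N <= 2 M kappa^N eta], takes at most half of Cartan's
   bound [nc (t 0) kappa^N]. *)
pose eta := Num.min 1 (nc (t 0) / (4 * M)).
have eta0 : 0 < eta by rewrite lt_min ltr01 divr_gt0// mulr_gt0.
have eta1 : eta <= 1 by rewrite ge_min lexx.
have eta2 : eta <= nc (t 0) / (4 * M) by rewrite ge_min lexx orbT.
pose q := k * eta.
have q0 : 0 < q by rewrite mulr_gt0.
have q1 : q <= 2^-1 by rewrite (le_trans _ k1)// ler_piMr// ltW.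
have e0 : 0 < expR 1 :> R by exact: expR_gt0.
(* Collects the factors raised to the power [m]: [A] from [tM], [e^r] from [1 / m! <= (e / m)^m],
   and 2 from the upper end of the range of radii. *)
pose B := 2 * A * expR 1 ^+ r.
have B0 : 0 < B by rewrite !mulr_gt0// exprn_gt0.
have [L0 HL0] : exists L : nat, B / q < L%:R.
  exists (Num.Def.archi_bound (B / q)); apply: archi_boundP.
  by rewrite divr_ge0// ltW.
pose L := L0.+1.
have LB : B / L%:R ^+ r <= q.
  rewrite ler_pdivrMr ?exprn_gt0 ?ltr0n// mulrC -ler_pdivrMr//.
  rewrite (le_trans (ltW HL0))// (@le_trans _ _ (L%:R ^+ 1))//.
    by rewrite expr1 ler_nat.
  by apply: ler_weXn2l => //; rewrite ler1n.
(* As [N = L n], the Cartan factor [kappa^N] is the inverse of the [n]-th power of [kappa^-L]. *)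
exists (nc (t 0) / 2), (k ^- L); split; first by lra.
  by rewrite invr_gt0 exprn_gt0.
move=> n n0; pose N := (L * n)%N.
have N0 : (0 < N)%N by rewrite muln_gt0.
have nR : 0 < n%:R :> R by rewrite ltr0n.
pose p := \poly_(j < N) t j.
have p0 : p`_0 = t 0 by rewrite coef_poly N0.
have [||x xr xP] := @cartan_complex _ p (n%:R ^+ r) N (exprn_gt0 r nR).
- by rewrite p0.
- by rewrite (leq_trans (size_poly _ _)).
exists x => // z zx.
have [M1 gM1] := rapid_gdom (nc z) fact_decay_rapid.
have {gM1}gz := gM1 z (lexx _).
have tail : nc (pser z - p.[z]) <= 2 * (M * q ^+ N).
  rewrite horner_poly (csum_shift N gz); apply: csum_le => j.
  set m := (N + j)%N.
  have m0 : (0 < m)%N by rewrite addn_gt0 N0.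
  have mR : 0 < m%:R :> R by rewrite ltr0n.
  rewrite -[leRHS]mulrA.
  rewrite ncM ncX (le_trans (ler_wpM2r _ (tM m)))//; first by rewrite exprn_ge0// nc_ge0.
  rewrite -!mulrA ler_wpM2l ?(ltW M0)//.
  apply: (@le_trans _ _ (q ^+ m)); last first.
    rewrite exprD ler_wpM2l ?exprn_ge0 ?(ltW q0)//.
    by apply: lerXn2r; rewrite ?nnegrE ?invr_ge0 ?(ltW q0).
  apply: (@le_trans _ _ ((B / L%:R ^+ r) ^+ m)); last first.
    by apply: lerXn2r; rewrite ?nnegrE ?(ltW q0)// divr_ge0 ?exprn_ge0 ?(ltW B0).
  have h1 : nc z <= 2 * (m%:R / L%:R) ^+ r.
    rewrite zx; case/andP: xr => _ /le_trans; apply; rewrite ler_wpM2l//.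
    apply: lerXn2r; rewrite ?nnegrE ?divr_ge0 ?ler0n//.
    by rewrite ler_pdivlMr ?ltr0n// -natrM ler_nat mulnC leq_addr.
  have h2 : (m`!%:R ^+ r)^-1 <= (expR 1 ^+ r / m%:R ^+ r) ^+ m :> R.
    rewrite -expr_div_n -exprM mulnC exprM -exprVn.
    apply: lerXn2r; rewrite ?nnegrE ?exprn_ge0 ?invr_ge0 ?divr_ge0 ?(ltW e0) ?ler0n//.
    rewrite expr_div_n -[leLHS]mul1r ler_pdivrMr ?ltr0n ?fact_gt0//.
    rewrite mulrAC ler_pdivlMr ?exprn_gt0// mul1r.
    exact/ltW/fact_expn.
  have h3 : nc z ^+ m <= (2 * (m%:R / L%:R) ^+ r) ^+ m.
    apply: lerXn2r; rewrite ?nnegrE ?nc_ge0// ?mulr_ge0 ?exprn_ge0 ?divr_ge0 ?ler0n//.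
  apply: (@le_trans _ _ (A ^+ m * ((expR 1 ^+ r / m%:R ^+ r) ^+ m *
      (2 * (m%:R / L%:R) ^+ r) ^+ m))).
    rewrite ler_wpM2l ?exprn_ge0 ?(ltW A0)//.
    by apply: ler_pM => //; rewrite ?invr_ge0 ?exprn_ge0 ?nc_ge0// ?ler0n.
  rewrite -!exprMn /B le_eqVlt; apply/orP; left; apply/eqP; congr (_ ^+ m).
  rewrite expr_div_n; field.
  by rewrite !expf_neq0// gt_eqF// ltr0n.
have h := xP z zx; rewrite p0 -/k in h.
have h5 : q ^+ N <= k ^+ N * eta.
  rewrite exprMn ler_wpM2l ?exprn_ge0 ?(ltW k0)//.
  by rewrite -[leRHS]expr1; apply: ler_wiXn2l => //; exact: ltW.
have kN : 0 < k ^+ N by rewrite exprn_gt0.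
have h6 : 2 * (M * q ^+ N) <= nc (t 0) / 2 * k ^+ N.
  rewrite ler_pdivlMr ?mulr_gt0// in eta2.
  have : M * q ^+ N <= M * (k ^+ N * eta) by rewrite ler_wpM2l// ltW.
  nra.
have h7 : nc p.[z] <= nc (pser z) + nc (pser z - p.[z]).
  by have := nc_sub p.[z] (pser z); rewrite (ncB p.[z]); lra.
have h8 : nc (t 0) / 2 * k ^+ N <= nc (pser z) by lra.
rewrite exprVn -exprM -/N [leRHS]mulrC ler_pdivlMr//.
Qed.

End LowerBound.

(** * Solution of [phi(S) u = g] in admissible sequences *)

Section Core.
Variable R : realType.
Local Notation C := R[i].

Lemma cont01M (f g : R -> C) : cont01 f -> cont01 g -> cont01 (fun x => f x * g x).
Proof.
move=> fc gc x e x01 e0.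
have fz0 := nc_ge0 (f x); have gz0 := nc_ge0 (g x).
pose K := nc (f x) + nc (g x) + 2.
have K0 : 0 < K by rewrite /K; lra.
have m0 : 0 < Num.min 1 (e / K) by rewrite lt_min ltr01 divr_gt0.
have [d1 d10 H1] := fc _ _ x01 m0; have [d2 d20 H2] := gc _ _ x01 m0.
exists (Num.min d1 d2); first by rewrite lt_min d10.
move=> w w01; rewrite !lt_min => /andP[/(H1 _ w01) + /(H2 _ w01)].
rewrite !lt_min !ltr_pdivlMr// => /andP[h1 h2] /andP[h3 h4].
rewrite (_ : _ - _ = (f w - f x) * (g w - g x) + (f w - f x) * g x + f x * (g w - g x));
  last by ring.
rewrite (le_lt_trans (ncD _ _))// (le_lt_trans (lerD (ncD _ _) (lexx _)))// !ncM.
have := nc_ge0 (f w - f x); have := nc_ge0 (g w - g x).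
rewrite /K in h2 h4; nra.
Qed.

Lemma cont01_comp (h : C -> C) (f : R -> C) : cont01 f ->
  (forall x, 0 <= x <= 1 -> ccont h (f x)) -> cont01 (fun x => h (f x)).
Proof.
move=> fc hc x e x01 e0; have [d d0 H] := hc x x01 e e0.
have [k k0 K] := fc x d x01 d0; exists k => // y y01 /(K _ y01); exact: H.
Qed.

(** Reduction to a nonzero constant term: if [q] is the first index with [t q != 0], then [z^q]
    factors out, and its modulus is at least 1 because the radii are. *)
Lemma lower_bound (r : nat) (t : nat -> C) (M A : R) : (0 < r)%N -> 0 < A ->
  (forall n, nc (t n) <= M * A ^+ n / n`!%:R ^+ r) -> (exists q, t q != 0) ->
  exists c b : R, [/\ 0 < c, 0 < b & forall n, (0 < n)%N ->
    exists2 x, n%:R ^+ r <= x <= 2 * n%:R ^+ r &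
      forall z, nc z = x -> c <= b ^+ n * nc (pser t z)].
Proof.
move=> r0 A0 tM tn0; case: (ex_minnP tn0) => q tq qmin.
have M0 := bound_ge0 tM.
have tr := fact_decay_rapid r0 A0 tM.
pose t' n := t (q + n)%N.
have tM' n : nc (t' n) <= M * A ^+ q * A ^+ n / n`!%:R ^+ r.
  rewrite (le_trans (tM _))// exprD -!mulrA !ler_wpM2l ?exprn_ge0 ?(ltW A0)//.
  rewrite lef_pV2 ?posrE ?exprn_gt0 ?ltr0n ?fact_gt0//.
  apply: lerXn2r; rewrite ?nnegrE ?ler0n// ler_nat.
  by apply: leq_fact; rewrite leq_addl.
have [|c [b [c0 b0 H]]] := lower_bound0 r0 A0 tM'.
  by rewrite /t' addn0.
exists c, b; split=> // n n0; have [x xr xP] := H n n0; exists x => // z zx.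
rewrite (le_trans (xP z zx))// ler_wpM2l ?exprn_ge0 ?(ltW b0)//.
have [M1 /(_ z (lexx _)) gz] := rapid_gdom (nc z) tr.
have -> : pser t z = z ^+ q * pser t' z.
  have := csum_shift q gz; rewrite big1 ?subr0 => [|k _]; last first.
    apply/eqP; rewrite mulf_eq0; apply/orP; left; apply/negPn/negP => /qmin.
    by rewrite leqNgt ltn_ord.
  rewrite /pser => ->.
  have [M2 /(_ z (lexx _)) gz'] := rapid_gdom (nc z) (fact_decay_rapid r0 A0 tM').
  by rewrite -(csumZ _ gz'); apply: csum_eq => k; rewrite exprD /t'; ring.
rewrite ncM ncX ler_peMl ?nc_ge0// exprn_ege1// zx.
case/andP: xr => + _; apply: le_trans.
by rewrite exprn_ege1// ler1n.
Qed.

Lemma circ_monomial (s : R) (m j : nat) :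
  circ (fun w => w ^+ m * w^-1 ^+ j) s = (if j == m then 1 else 0 : C).
Proof.
have w0 (w : C) : nc w = expR s -> w != 0.
  by move=> E; rewrite -nc_gt0 E expR_gt0.
case: (ltngtP j m) => [jm|mj|->].
- rewrite -(@circ_X R s (m - j).-1); apply: circ_eq => w /w0 wn.
  rewrite prednK ?subn_gt0// -{1}(subnK (ltnW jm)) exprD -mulrA -exprMn.
  by rewrite mulfV// expr1n mulr1.
- rewrite -(@circ_VX R s (j - m).-1); apply: circ_eq => w /w0 wn.
  rewrite prednK ?subn_gt0// -{1}(subnKC (ltnW mj)) exprD mulrA -exprMn.
  by rewrite mulfV// expr1n mul1r.
- rewrite -[RHS](mean_cst (1 : C)); apply: mean_eq => x _.
  by rewrite -exprMn mulfV ?circle_pt_neq0// expr1n.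
Qed.

Lemma leq_fact_expn (j : nat) : (j`! <= j.+1 ^ j)%N.
Proof.
elim: j => // j IH; rewrite factS expnS leq_mul// (leq_trans IH)//.
by case: j {IH} => // j; rewrite leq_exp2r.
Qed.

(** A binomial coefficient is at most a power of 2. As in Pascal's rule, [(k+1) (k+m+1)!] and
    [(m+1) (k+m+1)!] add up to [(k+m+2)!]. *)
Lemma leq_factD (k m : nat) : ((k + m)`! <= 2 ^ (k + m) * (k`! * m`!))%N.
Proof.
elim: k m => [|k IHk] m.
  by rewrite add0n fact0 mul1n leq_pmull// expn_gt0.
elim: m => [|m IHm]; first by rewrite addn0 fact0 muln1 leq_pmull// expn_gt0.
have h1 := leq_mul (leqnn k.+1) (IHk m.+1).
have h2 := leq_mul (leqnn m.+1) IHm.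
rewrite addSnnS in h2.
rewrite addSn factS expnS !factS in h1 h2 *.
move: (k + m.+1)`! (2 ^ (k + m.+1))%N (k`!) (m`!) h1 h2 => N P a b h1 h2.
nia.
Qed.

Section Solve.
Variables (r : nat) (t : nat -> C) (M A : R).
Hypotheses (r0 : (0 < r)%N) (A0 : 0 < A).
Hypothesis tM : forall n, nc (t n) <= M * A ^+ n / n`!%:R ^+ r.

(** The admissible sequences: coordinates of r-even entire functions in the basis
    [z^(rn) / alpha_n], since [alpha_n] is [(n!)^r] up to exponential factors. *)
Definition srapid (u : nat -> C) := rapid (fun n => u n / (n`!%:R ^+ r)).

Lemma srapidP (u : nat -> C) : srapid u <->
  forall x : R, 0 < x -> exists K, forall n, nc (u n) * x ^+ n <= K * n`!%:R ^+ r.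
Proof.
have E n (y K : R) : (nc (u n / n`!%:R ^+ r) * y <= K) = (nc (u n) * y <= K * n`!%:R ^+ r).
  by rewrite ncM ncV ncX nc_nat mulrAC ler_pdivrMr// exprn_gt0// ltr0n fact_gt0.
by split=> H x /H[K HK]; exists K => n; rewrite ?E// -E.
Qed.

(** The factor [(X j)^-j <= (j!)^-r] cancels the growth allowed to [g j]. Through [exp_term],
    [(X j)^m] is at most [(m!)^r] times a small power in [m] and an exponential in [j]; that
    exponential and [b^j] are paid for by the decay of [g]. *)
Lemma solve_bound (g : nat -> C) (v : nat -> nat -> C) (X : nat -> R) (c b : R) :
  0 < c -> 0 < b -> srapid g ->
  (forall j, j.+1%:R ^+ r <= X j <= 2 * j.+1%:R ^+ r) ->
  (forall j m, nc (v j m) <= X j ^+ m * (X j)^-1 ^+ j * (b ^+ j.+1 / c)) ->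
  forall h : R, 0 < h -> exists2 K, 0 <= K & forall j m,
    nc (g j * v j m) <= K * m`!%:R ^+ r * h^-1 ^+ m * 2^-1 ^+ j.
Proof.
move=> c0 b0 /srapidP gr Xr vX h h0.
(* [x >= 2 h] turns [2^m / x^m] into [h^-m]; [x >= 1] allows [x^(-m r)] to be bounded by [x^-m]. *)
pose x := Num.max 1 (2 * h).
have x1 : 1 <= x by rewrite le_max lexx.
have x0 : 0 < x by lra.
have xh : 2 * h <= x by rewrite le_max lexx orbT.
pose y := expR x ^+ r.
have y0 : 0 < y by rewrite exprn_gt0// expR_gt0.
(* Absorbs [b^j] and [y^j], and leaves [2^-j]. *)
pose s := 2 * b * y.
have s0 : 0 < s by rewrite !mulr_gt0.
have [G HG] := gr s s0.
have G0 : 0 <= G.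
  by have := HG 0%N; rewrite expr0 fact0 expr1n !mulr1; apply: le_trans (nc_ge0 _).
exists (G * y * b / c); first by rewrite !mulr_ge0 ?invr_ge0// ltW.
move=> j m.
have F0 (n : nat) : 0 < n`!%:R ^+ r :> R by rewrite exprn_gt0// ltr0n fact_gt0.
have J0 : 0 < j.+1%:R :> R by rewrite ltr0n.
have XJ : 0 < X j.
  by have /andP[+ _] := Xr j; apply: lt_le_trans; rewrite exprn_gt0.
have hg : nc (g j) <= G * j`!%:R ^+ r / s ^+ j.
  by rewrite ler_pdivlMr ?exprn_gt0.
have h1 : X j ^+ m <= 2 ^+ m * (m`!%:R ^+ r * y ^+ j.+1 / x ^+ m).
  apply: (@le_trans _ _ ((2 * j.+1%:R ^+ r) ^+ m)).
    by apply: lerXn2r; rewrite ?nnegrE ?mulr_ge0 ?exprn_ge0 ?(ltW XJ)//; case/andP: (Xr j).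
  rewrite exprMn ler_wpM2l ?exprn_ge0// -exprM mulnC exprM.
  have h2 : j.+1%:R ^+ m <= m`!%:R * expR x ^+ j.+1 / x ^+ m.
    rewrite ler_pdivlMr ?exprn_gt0// -exprMn [leRHS]mulrC -expRM_natl.
    have := @exp_term R (j.+1%:R * x) m; rewrite ler_pdivrMr ?ltr0n ?fact_gt0//.
    by apply; rewrite mulr_ge0// ltW.
  apply: (@le_trans _ _ ((m`!%:R * expR x ^+ j.+1 / x ^+ m) ^+ r)).
    apply: lerXn2r; rewrite ?nnegrE ?exprn_ge0 ?divr_ge0 ?mulr_ge0 ?exprn_ge0 ?expR_ge0 ?(ltW x0)//.
  rewrite expr_div_n exprMn -[X in _ * X / _]exprM mulnC exprM -/y.
  rewrite ler_wpM2l ?mulr_ge0 ?exprn_ge0 ?ler0n ?(ltW y0)//.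
  rewrite lef_pV2 ?posrE ?exprn_gt0//.
  rewrite -[leLHS]expr1; apply: ler_weXn2l => //.
  exact: exprn_ege1.
have h3 : (X j)^-1 ^+ j <= (j`!%:R ^+ r)^-1.
  rewrite exprVn lef_pV2 ?posrE ?exprn_gt0//.
  apply: (@le_trans _ _ ((j.+1%:R ^+ r) ^+ j)); last first.
    by apply: lerXn2r; rewrite ?nnegrE ?exprn_ge0 ?(ltW XJ)//; case/andP: (Xr j).
  rewrite -exprM mulnC exprM; apply: lerXn2r; rewrite ?nnegrE ?exprn_ge0 ?ler0n//.
  by rewrite -natrX ler_nat leq_fact_expn.
have h4 : 2 ^+ m / x ^+ m <= h^-1 ^+ m.
  rewrite -expr_div_n; apply: lerXn2r; rewrite ?nnegrE ?divr_ge0 ?invr_ge0 ?(ltW x0) ?(ltW h0)//.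
  rewrite ler_pdivrMr// mulrC ler_pdivlMr//.
have bc0 : 0 <= b ^+ j.+1 / c by rewrite divr_ge0 ?exprn_ge0// ltW.
rewrite ncM.
apply: (@le_trans _ _ ((G * j`!%:R ^+ r / s ^+ j) *
   ((2 ^+ m * (m`!%:R ^+ r * y ^+ j.+1 / x ^+ m)) * (j`!%:R ^+ r)^-1 * (b ^+ j.+1 / c)))).
  apply: ler_pM; rewrite ?nc_ge0//; apply: (le_trans (vX j m)).
  apply: ler_wpM2r => //.
  by apply: ler_pM => //; rewrite ?exprn_ge0 ?invr_ge0 ?(ltW XJ).
apply: (@le_trans _ _ (G * y * b / c * m`!%:R ^+ r * (2 ^+ m / x ^+ m) * 2^-1 ^+ j)); last first.
  rewrite ler_wpM2r ?exprn_ge0 ?invr_ge0// ler_wpM2l// mulr_ge0 ?(ltW (F0 m))//.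
  by rewrite !mulr_ge0 ?invr_ge0// ltW.
rewrite le_eqVlt; apply/orP; left; apply/eqP.
rewrite /s !exprMn !exprS exprVn; field.
have nz (a : R) n : 0 < a -> a ^+ n != 0 by move=> a0; rewrite gt_eqF// exprn_gt0.
by rewrite !nz// ?ltr0n ?fact_gt0// gt_eqF.
Qed.

Lemma solve (g : nat -> C) : (exists q, t q != 0) -> srapid g ->
  exists2 u, srapid u & forall m, csum (fun n => t n * u (n + m)%N) = g m.
Proof.
move=> tn0 gr.
have M0 := bound_ge0 tM.
have tr := fact_decay_rapid r0 A0 tM.
have [c [b [c0 b0 H]]] := lower_bound r0 A0 tM tn0.
have H' j : exists x, j.+1%:R ^+ r <= x <= 2 * j.+1%:R ^+ r /\
      forall z, nc z = x -> c <= b ^+ j.+1 * nc (pser t z).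
  by have [x] := H j.+1 (ltn0Sn _); exists x.
have [X XP] := choice H'.
have Xr j : j.+1%:R ^+ r <= X j <= 2 * j.+1%:R ^+ r by have [] := XP j.
have XJ j : 0 < X j.
  by have /andP[+ _] := Xr j; apply: lt_le_trans; rewrite exprn_gt0// ltr0n.
pose P j := circle_pt (ln (X j)).
have ncP j x : nc (P j x) = X j by rewrite nc_circle_pt lnK// posrE.
have phi0 j x : pser t (P j x) != 0.
  rewrite -nc_gt0 lt_neqAle nc_ge0 andbT eq_sym.
  apply/eqP => E; have [_ /(_ _ (ncP j x))] := XP j; rewrite E mulr0; lra.
have Pc j : cont01 (P j).
  by apply: (@circ_cont01 _ id) => w _; exact: ccont_id.
have phic z : ccont (pser t) z by exact: cderiv_ccont (csum_cderiv z tr).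
have PXc j m : cont01 (fun x => P j x ^+ m).
  by apply: (@circ_cont01 _ (fun w => w ^+ m)) => w _; apply: ccontX; exact: ccont_id.
have PVc j m : cont01 (fun x => (P j x)^-1 ^+ m).
  apply: (@circ_cont01 _ (fun w => w^-1 ^+ m)) => w w0.
  by apply: ccontX; exact: ccont_inv.
have ic j : cont01 (fun x => (pser t (P j x))^-1).
  apply: (@cont01_comp (fun w => w^-1)); last by move=> x _; exact: ccont_inv.
  by apply: cont01_comp.
(* The geometric sequence [l^(m-j)] divided by its eigenvalue [phi(l)], at the point [l = P j x] of
   the [j]-th circle. *)
pose w j m x := P j x ^+ m * (P j x)^-1 ^+ j * (pser t (P j x))^-1.
have wc j m : cont01 (w j m) by do 2 apply: cont01M => //.
pose v j m := mean (w j m).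
have bc0 j : 0 <= b ^+ j.+1 / c by rewrite divr_ge0 ?exprn_ge0// ltW.
have nw j m x : nc (w j m x) <= X j ^+ m * (X j)^-1 ^+ j * (b ^+ j.+1 / c).
  rewrite /w !ncM !ncX !ncV ncP ler_wpM2l ?mulr_ge0 ?exprn_ge0 ?invr_ge0 ?(ltW (XJ j))//.
  rewrite ler_pdivlMr// mulrC ler_pdivrMr ?nc_gt0//.
  by have [_] := XP j; apply.
have vX j m : nc (v j m) <= X j ^+ m * (X j)^-1 ^+ j * (b ^+ j.+1 / c).
  by apply: mean_le => // x _.
(* [v j] solves the equation for the [j]-th unit sequence: under the mean the sum over [k] rebuilds
   [phi] and cancels the denominator, which leaves [circ_monomial]. *)
have vsum j m : csum (fun k => t k * v j (k + m)%N) = (if j == m then 1 else 0).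
  have [M1 gM1] := rapid_gdom (X j) tr.
  pose K := X j ^+ m * (X j)^-1 ^+ j * (b ^+ j.+1 / c).
  have K0 : 0 <= K by apply: le_trans (nc_ge0 _) (nw j m 0).
  apply: (@csum_unique _ (K * (2 * M1))) => n.
  rewrite -(circ_monomial (ln (X j))).
  have wck k : cont01 (fun x => t k * w j (k + m)%N x) by exact: cont01Z.
  have [c1 E1] := mean_sum (index_enum 'I_n) (fun k : 'I_n => wck k).
  have -> : \sum_(k < n) t k * v j (k + m)%N = \sum_(k < n) mean (fun x => t k * w j (k + m)%N x).
    by apply: eq_bigr => k _; rewrite meanZ.
  have cPP := cont01M (PXc j m) (PVc j j).
  rewrite -E1 /circ -mulN1r -meanZ// -meanD; [|exact: cPP|exact: cont01Z c1].
  apply: mean_le; first by apply: cont01D; [exact: cPP|exact: cont01Z c1].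
  move=> x _; rewrite -/(P j x).
  rewrite (_ : _ + _ = w j m x * (pser t (P j x) - \sum_(k < n) t k * P j x ^+ k)).
    rewrite ncM -mulrA; apply: ler_pM; rewrite ?nc_ge0//.
    by apply: csum_approx; apply: gM1; rewrite ncP.
  rewrite mulrBr; congr (_ + _); first by rewrite /w mulfVK.
  rewrite mulN1r; congr (- _); rewrite mulr_sumr; apply: eq_bigr => k _.
  by rewrite /w exprD; ring.
have B := solve_bound c0 b0 gr Xr vX.
pose u m := csum (fun j => g j * v j m).
exists u.
  apply/srapidP => h h0; have [K K0 HK] := B h h0.
  exists (2 * K) => m.
  have gd : gdom (K * m`!%:R ^+ r * h^-1 ^+ m) (fun j => g j * v j m) by move=> j; exact: HK.
  have := ler_wpM2r (exprn_ge0 m (ltW h0)) (csum_le gd).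
  move=> /le_trans; apply; rewrite le_eqVlt; apply/orP; left; apply/eqP.
  by rewrite exprVn; field; rewrite expf_neq0// gt_eqF.
move=> m.
(* [h^-k] has to offset [A^k] from [t] and [2^(r k)] from [leq_factD], and still leave [2^-k], so
   that the two sums can be exchanged. *)
pose h := 2 * A * 2 ^+ r.
have h0 : 0 < h by rewrite !mulr_gt0// exprn_gt0.
have [K K0 HK] := B h h0.
have gu k : gdom (K * (k + m)`!%:R ^+ r * h^-1 ^+ (k + m)) (fun j => g j * v j (k + m)%N).
  by move=> j; exact: HK.
transitivity (csum (fun k => csum (fun j => t k * (g j * v j (k + m)%N)))).
  by apply: csum_eq => k; rewrite (csumZ _ (gu k)).
have D k j : nc (t k * (g j * v j (k + m)%N)) <=
    (M * K * m`!%:R ^+ r * 2 ^+ (m * r) * h^-1 ^+ m) * 2^-1 ^+ k * 2^-1 ^+ j.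
  rewrite ncM.
  apply: (@le_trans _ _ ((M * A ^+ k / k`!%:R ^+ r) *
     (K * (2 ^+ (k + m) * (k`!%:R * m`!%:R)) ^+ r * h^-1 ^+ (k + m) * 2^-1 ^+ j))).
    apply: ler_pM; rewrite ?nc_ge0//; apply: (le_trans (HK _ _)).
    rewrite !ler_wpM2r ?exprn_ge0 ?invr_ge0 ?(ltW h0)// ler_wpM2l//.
    apply: lerXn2r; rewrite ?nnegrE ?mulr_ge0 ?exprn_ge0 ?ler0n//.
    by rewrite -natrX -!natrM ler_nat leq_factD.
  rewrite le_eqVlt; apply/orP; left; apply/eqP.
  have kn0 : k`!%:R != 0 :> R by rewrite gt_eqF// ltr0n fact_gt0.
  have n20 : 2 ^+ r != 0 :> R by rewrite gt_eqF// exprn_gt0.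
  have E2 i : (2 ^+ i) ^+ r = (2 ^+ r) ^+ i :> R by rewrite -!exprM mulnC.
  rewrite (exprM 2 m r) !exprD !exprMn !E2 /h !exprVn !exprMn; field.
  by rewrite !expf_neq0// ?gt_eqF.
rewrite (csum_exchange D) -(csum_delta m (g m)); apply: csum_eq => j.
have [M1 gM1] := rapid_gdom (X j) tr.
have gX : gdom M1 (fun k => t k * (X j)%:C ^+ k).
  by apply: gM1; rewrite ncR gtr0_norm.
have gv : gdom (M1 * (X j ^+ m * (X j)^-1 ^+ j * (b ^+ j.+1 / c)))
    (fun k => t k * v j (k + m)%N).
  move=> k; rewrite ncM.
  apply: (le_trans (ler_wpM2l (nc_ge0 _) (vX j (k + m)%N))).
  have := gX k; rewrite ncM ncX ncR gtr0_norm// => hk.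
  have L0 : 0 <= X j ^+ m * (X j)^-1 ^+ j * (b ^+ j.+1 / c).
    by rewrite mulr_ge0 ?bc0// mulr_ge0 ?exprn_ge0 ?invr_ge0 ?(ltW (XJ j)).
  apply: (@le_trans _ _ ((M1 * 2^-1 ^+ k) * (X j ^+ m * (X j)^-1 ^+ j * (b ^+ j.+1 / c)))).
    apply: le_trans (ler_wpM2r L0 hk).
    by rewrite exprD le_eqVlt; apply/orP; left; apply/eqP; ring.
  by rewrite le_eqVlt; apply/orP; left; apply/eqP; ring.
transitivity (csum (fun k => g j * (t k * v j (k + m)%N))).
  by apply: csum_eq => k; rewrite mulrCA.
rewrite (csumZ _ gv) vsum.
by case: eqP => [->|_]; rewrite ?mulr1 ?mulr0.
Qed.

End Solve.
End Core.

(** * The Gamma function: functional equation and positivity *)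

Section GammaFunction.
Variable R : realType.
Implicit Types (x t a b : R).
Local Notation mu := (@lebesgue_measure R).

Definition gam x t : R := t `^ (x - 1) * expR (- t).

(** With extended real values, the functional equation can be proved before finiteness, and
    finiteness deduced from it. *)
Definition gamI x : \bar R := \int[mu]_(t in `]0, +oo[) (gam x t)%:E.

Lemma GammaE x : Gamma x = fine (gamI x).
Proof. by []. Qed.

Lemma gam_ge0 x t : 0 <= gam x t.
Proof. by rewrite mulr_ge0 ?powR_ge0 ?expR_ge0. Qed.

Lemma measurable_expN (c : R) (D : set R) : measurable_fun D (fun t : R => expR (c * t)).
Proof.
by apply: measurable_funTS; apply: measurableT_comp.
Qed.

Lemma measurable_gam x (D : set R) : measurable_fun D (gam x).
Proof.
apply: measurable_funM.
  by apply: measurable_funTS; exact: measurable_powR.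
rewrite (_ : (fun _ => _) = fun t => expR (-1 * t)); first exact: measurable_expN.
by apply/funext => t; rewrite mulN1r.
Qed.

Lemma measurable_gamE x (D : set R) : measurable_fun D (fun t : R => (gam x t)%:E).
Proof. by apply/measurable_EFinP; exact: measurable_gam. Qed.

Lemma derivable_continuous_at (f : R -> R) t : derivable f t 1 -> {for t, continuous f}.
Proof. by move=> fd; apply: differentiable_continuous; exact/derivable1_diffP. Qed.

Lemma derivable_pos_LR (f : R -> R) a b : 0 < a -> a < b ->
  (forall t, 0 < t -> derivable f t 1) -> derivable_oo_LRcontinuous f a b.
Proof.
move=> a0 ab fd.
have fc t : 0 < t -> {for t, continuous f}.
  by move=> t0; apply: derivable_continuous_at; exact: fd.
split.
- by move=> t; rewrite in_itv /= => /andP[at_ _]; apply: fd; exact: lt_trans at_.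
- by apply: cvg_at_right_filter; exact: fc.
- by apply: cvg_at_left_filter; apply: fc; exact: lt_trans ab.
Qed.

Lemma gam_parts x a b : 0 < x -> 0 < a -> a < b ->
  (\int[mu]_(t in `[a, b]) (gam (x + 1) t)%:E =
   (a `^ x * expR (- a) - b `^ x * expR (- b))%:E +
   x%:E * \int[mu]_(t in `[a, b]) (gam x t)%:E)%E.
Proof.
move=> x0 a0 ab.
have E (t : R) : is_derive t 1 (fun t => - expR (- t)) (expR (- t)).
  have h : is_derive t 1 (fun t : R => expR (- t)) (expR (- t) * (- 1)).
    exact: is_derive1_comp.
  have := is_deriveN h; rewrite mulrN1 opprK; apply.
have := @integration_by_parts R (fun t => t `^ x) (fun t => - expR (- t))
   (fun t => x * t `^ (x - 1)) (fun t => expR (- t)) a b ab.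
have P t : 0 < t -> is_derive t 1 (fun t => t `^ x) (x * t `^ (x - 1)).
  by move=> t0; exact: is_derive1_powR.
have C1 : {within `[a, b], continuous (fun t => x * t `^ (x - 1))}.
  apply: continuous_in_subspaceT => t; rewrite inE /= in_itv /= => /andP[at_ _].
  have t0 : 0 < t by exact: lt_le_trans at_.
  apply: cvgM; first exact: cvg_cst.
  have := @derivable_continuous_at (fun t => t `^ (x - 1)) t; apply.
  by apply: ex_derive; exact: is_derive1_powR.
have C2 : {within `[a, b], continuous (fun t : R => expR (- t))}.
  apply: continuous_subspaceT => t.
  by apply: continuous_comp; [exact: continuousN|exact: continuous_expR].
move=> /(_ C1) H.
have D1 : derivable_oo_LRcontinuous (fun t => t `^ x) a b.
  by apply: derivable_pos_LR => // t t0; apply: ex_derive; exact: P.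
have D2 : derivable_oo_LRcontinuous (fun t : R => - expR (- t)) a b.
  by apply: derivable_pos_LR => // t t0; apply: ex_derive; exact: E.
have D3 : {in `]a, b[, (fun t => t `^ x)^`()%classic =1 (fun t => x * t `^ (x - 1))}.
  move=> t; rewrite in_itv /= => /andP[at_ _].
  by rewrite powR_derive1// in_itv /= andbT (lt_trans a0).
have D4 : {in `]a, b[, (fun t : R => - expR (- t))^`()%classic =1 (fun t => expR (- t))}.
  by move=> t _; rewrite derive1E; have [_ ->] := E t.
have := H D1 D3 C2 D2 D4.
have -> : (\int[mu]_(t in `[a, b]) (t `^ x * expR (- t))%:E =
    \int[mu]_(t in `[a, b]) (gam (x + 1) t)%:E)%E.
  by apply: eq_integral => t _; rewrite /gam addrK.
move=> ->.
have -> : (\int[mu]_(t in `[a, b]) (x * t `^ (x - 1) * - expR (- t))%:E =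
    - (x%:E * \int[mu]_(t in `[a, b]) (gam x t)%:E))%E.
  rewrite -ge0_integralZl//; last 3 first.
  - exact: measurable_gamE.
  - by move=> t _; rewrite lee_fin gam_ge0.
  - by rewrite lee_fin ltW.
  rewrite -integral_ge0N; last first.
    by move=> t _; rewrite mule_ge0// lee_fin ?gam_ge0// ltW.
  by apply: eq_integral => t _; rewrite /gam -EFinM -EFinN mulrN mulrA.
rewrite oppeK; congr (_ + _)%E; congr (_%:E).
by rewrite !mulrN opprK addrC.
Qed.

(** The shift by 2 keeps the endpoints distinct already for [n = 0], as integration by parts
    needs. *)
Definition gball (n : nat) : set R := `[n.+2%:R^-1, n.+2%:R]%classic.

Lemma gam_lim x : (\int[mu]_(t in gball n) (gam x t)%:E @[n --> \oo] --> gamI x)%E.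
Proof.
have -> : gamI x = (\int[mu]_(t in \bigcup_n gball n) (gam x t)%:E)%E.
  rewrite /gamI; congr (integral _ _ _); apply/seteqP; split => t /=.
    rewrite in_itv /= andbT => t0.
    pose N := Num.Def.archi_bound (t + t^-1).
    have tN : t + t^-1 < N%:R by apply: archi_boundP; rewrite addr_ge0 ?invr_ge0// ltW.
    have N2 : N%:R <= N.+2%:R :> R by rewrite ler_nat -addn2 leq_addr.
    have ti : 0 < t^-1 by rewrite invr_gt0.
    exists N => //=; rewrite /gball /= in_itv /=; apply/andP; split; last by lra.
    by rewrite -[leRHS]invrK lef_pV2 ?posrE//; lra.
  move=> [n _]; rewrite /gball /= !in_itv /= andbT => /andP[+ _].
  by apply: lt_le_trans; rewrite invr_gt0.
apply: ge0_nondecreasing_set_cvg_integral => //=.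
- move=> n m nm; rewrite subsetEset => t; rewrite /gball /= !in_itv /= => /andP[h1 h2].
  have nm2 : n.+2%:R <= m.+2%:R :> R by rewrite ler_nat !ltnS.
  apply/andP; split; last exact: le_trans nm2.
  by apply: le_trans h1; rewrite lef_pV2 ?posrE.
- by move=> n; exact: measurable_itv.
- by move=> n; exact: measurable_gamE.
- by move=> n t _; rewrite lee_fin gam_ge0.
Qed.

(** The term of order [k + 1] of the exponential series, one more than [x] demands, leaves a factor
    [1 / t]. *)
Lemma powR_expRN_le (k : nat) x t : 1 <= t -> x <= k%:R ->
  t `^ x * expR (- t) <= k.+1`!%:R / t.
Proof.
move=> t1 xk; have t0 : 0 < t by lra.
rewrite expRN ler_pdivrMr ?expR_gt0// mulrAC ler_pdivlMr//.
apply: (@le_trans _ _ (t ^+ k.+1)).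
  rewrite exprSr ler_wpM2r ?(ltW t0)// -powR_mulrn ?(ltW t0)//.
  exact: ler_powR.
by have := @exp_term R t k.+1 (ltW t0); rewrite ler_pdivrMr ?ltr0n ?fact_gt0// mulrC.
Qed.

(* Integrating by parts over the compact intervals [gball n] and passing to the
   limit in the extended reals, no integrability is needed. *)
Lemma gamID x : 0 < x -> gamI (x + 1) = (x%:E * gamI x)%E.
Proof.
move=> x0.
pose d (n : nat) : R := n.+2%:R^-1 `^ x * expR (- n.+2%:R^-1) - n.+2%:R `^ x * expR (- n.+2%:R).
have L1 := @gam_lim (x + 1).
have E : (fun n => \int[mu]_(t in gball n) (gam (x + 1) t)%:E)%E =
    ((fun n => (d n)%:E) \+ (fun n => x%:E * \int[mu]_(t in gball n) (gam x t)%:E))%E.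
  apply/funext => n /=; apply: gam_parts => //.
  have h : 1 < n.+2%:R :> R by rewrite ltr1n.
  by apply: (lt_trans _ h); rewrite invf_lt1.
rewrite E in L1.
(* The boundary term at 0 vanishes in the limit because [x > 0], the one at infinity by
   [powR_expRN_le]. *)
have dl : (d n)%:E @[n --> \oo] --> 0%:E.
  apply: cvg_EFin; first by near=> n.
  apply/cvgrPdist_lt => e e0.
  have e20 : 0 < e / 2 by lra.
  have /cvgrPdist_lt/(_ _ e20)[y /= y0 H] := powR_cvg0 x0.
  pose k := Num.Def.archi_bound x; have xk : x <= k%:R by rewrite ltW// archi_boundP// ltW.
  pose K : R := k.+1`!%:R.
  have K0 : 0 < K by rewrite ltr0n fact_gt0.
  pose N := Num.Def.archi_bound (y^-1 + K * 2 / e).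
  have p1 : 0 < y^-1 by rewrite invr_gt0.
  have p2 : 0 < K * 2 / e by rewrite divr_gt0// mulr_gt0.
  have NP : y^-1 + K * 2 / e < N%:R by apply: archi_boundP; rewrite addr_ge0// ltW.
  exists N => // n /= Nn.
  have nn : N%:R <= n.+2%:R :> R by rewrite ler_nat (leq_trans Nn)// -addn2 leq_addr.
  have n0 : 0 < n.+2%:R :> R by [].
  have ny : n.+2%:R^-1 < y.
    by rewrite -[ltRHS]invrK ltf_pV2 ?posrE//; lra.
  have h1 : n.+2%:R^-1 `^ x < e / 2.
    have := H n.+2%:R^-1; rewrite /= !sub0r !normrN ger0_norm ?invr_ge0//.
    by rewrite ger0_norm ?powR_ge0// invr_gt0; exact.
  have h2 : n.+2%:R `^ x * expR (- n.+2%:R) <= e / 2.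
    have n1 : 1 <= n.+2%:R :> R by rewrite ler1n.
    rewrite (le_trans (powR_expRN_le n1 xk))// ler_pdivrMr// -/K.
    have : K * 2 / e * e <= n.+2%:R * e by rewrite ler_wpM2r ?(ltW e0)//; lra.
    by rewrite mulfVK ?gt_eqF//; lra.
  have h3 : 0 <= n.+2%:R^-1 `^ x * expR (- n.+2%:R^-1) <= n.+2%:R^-1 `^ x.
    by rewrite mulr_ge0 ?powR_ge0 ?expR_ge0//= ler_piMr ?powR_ge0//.
  have h4 : 0 <= n.+2%:R `^ x * expR (- n.+2%:R) by rewrite mulr_ge0 ?powR_ge0 ?expR_ge0.
  by rewrite sub0r normrN /d ltr_norml; apply/andP; split; lra.
have L2 : (((fun n => (d n)%:E) \+ (fun n => x%:E * \int[mu]_(t in gball n) (gam x t)%:E))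
    n @[n --> \oo] --> 0%:E + x%:E * gamI x)%E.
  apply: cvgeD => //.
  by apply: cvgeZl => //; exact: gam_lim.
rewrite add0e in L2.
exact: cvg_unique L1 L2.
Unshelve. all: by end_near. Qed.

(** For [1 <= x] the integrand has no singularity at 0: it is bounded below on [1, 2] and dominated
    by a multiple of [exp(-t/2)]. The functional equation then extends both conclusions to all
    positive [x]. *)
Lemma gamI_fin_pos x : 1 <= x -> (0 < gamI x < +oo)%E.
Proof.
move=> x1.
have m1 : measurable (`]0, +oo[%classic : set R) by [].
apply/andP; split.
  have s12 : (`[1, 2]%classic : set R) `<=` `]0, +oo[%classic.
    by move=> t /=; rewrite !in_itv /= andbT => /andP[+ _]; exact: lt_le_trans.
  apply: (@lt_le_trans _ _ (\int[mu]_(t in `[1%R, 2%R]) (expR (- 2))%:E)%E).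
    rewrite integral_cst//= lebesgue_measure_itv /= lte_fin ltr1n.
    by rewrite -EFinD -EFinM lte_fin mulr_gt0 ?expR_gt0//; lra.
  apply: (@le_trans _ _ (\int[mu]_(t in `[1%R, 2%R]) (gam x t)%:E)%E).
    apply: ge0_le_integral => //.
    - exact: measurable_gamE.
    - move=> t /=; rewrite in_itv /= => /andP[t1 t2]; rewrite lee_fin /gam.
      rewrite -[leLHS]mul1r; apply: ler_pM => //.
        by rewrite -[leLHS](powRr0 t); apply: ler_powR => //; lra.
      by rewrite ler_expR; lra.
  apply: ge0_subset_integral => //; first exact: measurable_gamE.
  by move=> t _; rewrite lee_fin gam_ge0.
pose k := Num.Def.archi_bound (x - 1).
have xk : x - 1 <= k%:R by rewrite ltW// archi_boundP//; lra.
(* The 1 covers [t <= 1]; for [t > 1], [t^k exp(-t/2) <= k! 2^k]. *)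
pose K : R := 1 + k`!%:R * 2 ^+ k.
have K0 : 0 <= K by rewrite addr_ge0// mulr_ge0// exprn_ge0.
apply: (@le_lt_trans _ _ (\int[mu]_(t in `[0%R, +oo[) (K * expR (- 2^-1 * t))%:E)%E).
  apply: (@le_trans _ _ (\int[mu]_(t in `]0%R, +oo[) (K * expR (- 2^-1 * t))%:E)%E).
    apply: ge0_le_integral => //.
    - by move=> t _; rewrite lee_fin gam_ge0.
    - exact: measurable_gamE.
    - apply/measurable_EFinP; apply: measurable_funM => //; exact: measurable_expN.
    - move=> t /=; rewrite in_itv /= andbT => t0; rewrite lee_fin /gam.
      have -> : expR (- t) = expR (- 2^-1 * t) * expR (- 2^-1 * t).
        by rewrite -expRD; congr expR; field.
      rewrite mulrA ler_wpM2r ?expR_ge0//.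
      have e1 : expR (- 2^-1 * t) <= 1 by rewrite expR_le1; lra.
      have e0 := expR_gt0 (- 2^-1 * t).
      have [t1|t1] := leP t 1.
        have h : t `^ (x - 1) <= 1.
          by rewrite -[leRHS](powRr0 t); apply: ger_powR; [rewrite t0|lra].
        rewrite (@le_trans _ _ 1)//.
          by rewrite -[leRHS]mul1r; apply: ler_pM => //; rewrite ?powR_ge0// ltW.
        by rewrite lerDl mulr_ge0// exprn_ge0.
      have h : t `^ (x - 1) <= t ^+ k.
        by rewrite -powR_mulrn ?(ltW t0)//; apply: ler_powR => //; exact: ltW.
      apply: (le_trans (ler_wpM2r (ltW e0) h)).
      have t20 : 0 <= t / 2 by lra.
      have := @exp_term R (t / 2) k t20.
      rewrite ler_pdivrMr ?ltr0n ?fact_gt0// expr_div_n ler_pdivrMr ?exprn_gt0// => h2.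
      apply: (le_trans (ler_wpM2r (ltW e0) h2)).
      have -> : - 2^-1 * t = - (t / 2) by ring.
      have -> : expR (t / 2) * k`!%:R * 2 ^+ k * expR (- (t / 2)) =
         (k`!%:R * 2 ^+ k) * (expR (t / 2) * expR (- (t / 2))) by ring.
      by rewrite expRxMexpNx_1 mulr1 lerDr.
  apply: ge0_subset_integral => //.
  - apply/measurable_EFinP; apply: measurable_funM => //; exact: measurable_expN.
  - by move=> t _; rewrite lee_fin mulr_ge0// expR_ge0.
  - by move=> t /=; rewrite !in_itv /= !andbT => /ltW.
have D (t : R) : is_derive t 1 (fun t => - 2 * K * expR (- 2^-1 * t)) (K * expR (- 2^-1 * t)).
  have h1 : is_derive t 1 (fun t : R => - 2^-1 * t) (- 2^-1).
    have := is_deriveZ (- 2^-1) (is_derive_id t (1 : R)).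
    by rewrite /GRing.scale /= mulr1; apply.
  have h2 : is_derive t 1 (fun t : R => expR (- 2^-1 * t)) (expR (- 2^-1 * t) * - 2^-1).
    exact: is_derive1_comp.
  have := is_deriveZ (- 2 * K) h2.
  rewrite /GRing.scale /= (_ : - 2 * K * _ = K * expR (- 2^-1 * t)); last by field.
  by apply.
have Dd t : derivable (fun t => - 2 * K * expR (- 2^-1 * t)) t 1 by apply: ex_derive; exact: D.
rewrite (@ge0_continuous_FTC2y _ _ (fun t => - 2 * K * expR (- 2^-1 * t)) 0 0).
- by rewrite -EFinB ltry.
- by move=> t _; rewrite mulr_ge0// expR_ge0.
- apply: continuous_subspaceT => t; apply: cvgM; first exact: cvg_cst.
  apply: continuous_comp; last exact: continuous_expR.
  by apply: cvgM; [exact: cvg_cst|exact: cvg_id].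
- rewrite -[X in _ --> X](mulr0 (- 2 * K)); apply: cvgM; first exact: cvg_cst.
  apply/cvgrPdist_lt => e e0.
  have /cvgrPdist_lt/(_ _ e0)[M [Mr HM]] := @cvgr_expR R.
  exists (2 * M); split; first by rewrite num_real.
  move=> t tM; have -> : - 2^-1 * t = - (t / 2) by ring.
  by apply: HM; lra.
- by move=> t _.
- apply: cvg_at_right_filter.
  exact: (derivable_continuous_at (Dd 0)).
- by move=> t _; rewrite derive1E; have [_ ->] := D t.
Qed.

(** If [gamI x] were infinite, [gamID] would make [gamI (x + 1)] infinite too; finiteness lets
    [fine] go through the product. *)
Lemma GammaD1 x : 0 < x -> Gamma (x + 1) = x * Gamma x.
Proof.
move=> x0; have x1 : 1 <= x + 1 by lra.
have g0 : (0 <= gamI x)%E by apply: integral_ge0 => t _; rewrite lee_fin gam_ge0.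
have gf : gamI x \is a fin_num.
  rewrite ge0_fin_numE// ltNge leye_eq; apply/negP => /eqP E.
  have /andP[_] := gamI_fin_pos x1.
  by rewrite gamID// E gt0_muley ?lte_fin.
by rewrite !GammaE gamID// fineM.
Qed.

Lemma Gamma_gt0 x : 0 < x -> 0 < Gamma x.
Proof.
move=> x0; have x1 : 1 <= x + 1 by lra.
have : 0 < Gamma (x + 1).
  by rewrite GammaE fine_gt0// gamI_fin_pos.
by rewrite GammaD1// pmulr_rgt0.
Qed.

End GammaFunction.

(** * Equivalence of the two forms of differentiability; operations on entire power series *)

Section Bridge.
Variable R : realType.
Local Notation C := R[i].
Implicit Types (u f g : C -> C) (a c d : nat -> C) (z w D : C) (e x : R).

Lemma derivable_cderiv u z : derivable u z 1 -> exists D, cderiv u z D.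
Proof.
move=> /cvg_ex[D uD]; exists D => e e0.
move/cvg_ncP : uD => /(_ e e0) /nbhs_ncP[d d0 H].
exists d => // w wd; have [->|wz] := eqVneq w z.
  by rewrite !subrr mulr0 subrr nc0 mulr0.
have wz0 : w - z != 0 by rewrite subr_eq0.
have := H (w - z); rewrite subr0 => /(_ wd wz0).
rewrite /GRing.scale /= mulr1 subrK => h.
rewrite (_ : _ - _ - _ = (w - z) * ((w - z)^-1 * (u w - u z) - D)); last by field.
by rewrite ncM mulrC ler_wpM2r ?nc_ge0// ltW.
Qed.

Lemma cderiv_is_derive u z D : cderiv u z D -> derivable u z 1 /\ u^`()%classic z = D.
Proof.
move=> uD.
have L : h^-1 *: (u (h *: (1 : C) + z) - u z) @[h --> (0 : C)^'] --> D.
  apply/cvg_ncP => e e0; have e20 : 0 < e / 2 by lra.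
  have [d d0 H] := uD _ e20.
  apply/nbhs_ncP; exists d => // h; rewrite subr0 => hd h0.
  have := H (h + z); rewrite addrK => /(_ hd).
  rewrite /GRing.scale /= mulr1 => k.
  rewrite (_ : _ - D = h^-1 * (u (h + z) - u z - D * h)); last by field.
  rewrite ncM ncV mulrC ltr_pdivrMr ?nc_gt0//.
  rewrite (le_lt_trans k)// ltr_pM2r ?nc_gt0//; lra.
split; first by apply/cvg_ex; exists D.
by rewrite derive1E; apply: cvg_lim.
Qed.

Lemma entireP u : entire u <-> forall z, exists D, cderiv u z D.
Proof.
by split=> H z; [exact: derivable_cderiv (H z)|have [D /cderiv_is_derive[]] := H z].
Qed.

Lemma rapid_gdom1 a z : rapid a -> exists M, gdom M (fun n => a n * z ^+ n).
Proof. by move=> /(rapid_gdom (nc z))[M /(_ z (lexx _))]; exists M. Qed.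

(** The factor [n <= 2^n] is paid for by doubling the radius. Each first-order factor of the
    hyper-Bessel operator multiplies coefficients by such an affine function of [n]. *)
Lemma rapid_linear a (k l : C) : rapid a -> rapid (fun n => (k * n%:R + l) * a n).
Proof.
move=> ar x x0; have x20 : 0 < 2 * x by lra.
have [M HM] := ar _ x20; exists ((nc k + nc l) * M) => n.
rewrite ncM.
have k0 := nc_ge0 k; have l0 := nc_ge0 l.
have n2 : n%:R <= 2 ^+ n :> R by rewrite -natrX ler_nat ltnW// ltn_expl.
have n1 : 1 <= 2 ^+ n :> R by rewrite exprn_ege1// ler1n.
have h : nc (k * n%:R + l) <= (nc k + nc l) * 2 ^+ n.
  by rewrite (le_trans (ncD _ _))// ncM nc_nat mulrDl lerD ?ler_wpM2l// ler_peMr.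
have := HM n; rewrite exprMn => h2.
apply: (@le_trans _ _ ((nc k + nc l) * 2 ^+ n * nc (a n) * x ^+ n)).
  by rewrite ler_wpM2r ?exprn_ge0 ?(ltW x0)// ler_wpM2r ?nc_ge0.
rewrite -!mulrA ler_wpM2l ?addr_ge0//.
by rewrite (le_trans _ h2)// le_eqVlt; apply/orP; left; apply/eqP; ring.
Qed.

Lemma rapid_shift a : rapid a -> rapid (fun n => a n.+1).
Proof.
move=> ar x x0; have [M HM] := ar _ x0; exists (M / x) => n.
by rewrite ler_pdivlMr// -mulrA -exprSr HM.
Qed.

Lemma pser_ext a d : a =1 d -> pser a = pser d.
Proof. by move=> /funext ->. Qed.

Lemma pserD a d z : rapid a -> rapid d -> pser (fun n => a n + d n) z = pser a z + pser d z.
Proof.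
move=> /(rapid_gdom1 z)[M aM] /(rapid_gdom1 z)[N dN].
by rewrite /pser -(csumD aM dN); apply: csum_eq => n; rewrite mulrDl.
Qed.

Lemma pserZ k a z : rapid a -> pser (fun n => k * a n) z = k * pser a z.
Proof.
move=> /(rapid_gdom1 z)[M aM].
by rewrite /pser -(csumZ _ aM); apply: csum_eq => n; rewrite mulrA.
Qed.

Lemma rapidZ k a : rapid a -> rapid (fun n => k * a n).
Proof.
move=> ar; have := rapid_linear 0 k ar.
by rewrite (_ : (fun n => _) = fun n => k * a n)//; apply/funext => n; rewrite mul0r add0r.
Qed.

Lemma rapid_natM a : rapid a -> rapid (fun n => n%:R * a n).
Proof.
move=> ar; have := rapid_linear 1 0 ar.
by rewrite (_ : (fun n => _) = fun n => n%:R * a n)//; apply/funext => n; rewrite mul1r addr0.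
Qed.

Lemma pser_deriv a z : rapid a ->
  cderiv (pser a) z (pser (fun n => n.+1%:R * a n.+1) z).
Proof.
move=> ar; have := csum_cderiv z ar.
rewrite (_ : csum _ = pser (fun n => n.+1%:R * a n.+1) z)//.
have r1 := rapid_shift (rapid_natM ar).
have [M gM] := rapid_gdom1 z r1.
have g2 : gdom (2 * M) (fun n => a n * (n%:R * z ^+ n.-1)).
  move=> [|n]; first by rewrite mul0r mulr0 nc0 expr0 mulr1 mulr_ge0// (gdom_ge0 gM).
  have := gM n; rewrite /= mulrA (mulrC (a _)) => /le_trans; apply.
  by rewrite (half_expS _ n) le_eqVlt; apply/orP; left; apply/eqP; ring.
rewrite (csum_recl g2) mul0r mulr0 add0r; apply: csum_eq => n /=.
by rewrite mulrA (mulrC (a _)).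
Qed.

Lemma pser_natM a z : rapid a ->
  pser (fun n => n%:R * a n) z = z * pser (fun n => n.+1%:R * a n.+1) z.
Proof.
move=> ar; have r0 := rapid_natM ar; have r1 := rapid_shift r0.
have [M gM] := rapid_gdom1 z r0; have [N gN] := rapid_gdom1 z r1.
rewrite /pser (csum_recl gM) !mul0r add0r -(csumZ _ gN).
by apply: csum_eq => n; rewrite exprS; ring.
Qed.

End Bridge.

(** * Roots of unity, and r-even entire functions as power series in [z^r] *)

Section RootsOfUnity.
Variables (R : realType) (r : nat).
Hypothesis r2 : (2 <= r)%N.
Local Notation C := R[i].
Implicit Types (u : C -> C) (a : nat -> C) (z : C).

Lemma omegaE n : omega R r ^+ n = cexp (0 +i* (2 * pi / r%:R * n%:R)).
Proof.
elim: n => [|n IH].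
  by rewrite mulr0 expr0 /cexp /= expR0 cos0 sin0 mul1r.
rewrite exprS IH -[omega R r]mul1r.
have -> : (1 * omega R r) = cexp (0 +i* (2 * pi / r%:R)).
  by rewrite /cexp /= expR0 mul1r.
rewrite -cexpD; congr cexp; apply/eqP; rewrite eq_complex /= addr0 eqxx /=.
by apply/eqP; rewrite -natr1; ring.
Qed.

Lemma omega_r : omega R r ^+ r = 1.
Proof.
rewrite omegaE mulfVK; last by rewrite pnatr_eq0 -lt0n (leq_trans _ r2).
by have := cexp_period (0 : C); rewrite add0r cexp0.
Qed.

(** Modulo [r] the angle lies strictly between 0 and [2 pi], where [1 - cos] is twice the square of
    the nonzero sine of the half angle. *)
Lemma omega_neq1 n : ~~ (r %| n)%N -> omega R r ^+ n != 1.
Proof.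
move=> rn.
have r0 : (0 < r)%N by rewrite (leq_trans _ r2).
have rR : 0 < r%:R :> R by rewrite ltr0n.
rewrite (divn_eq n r) exprD mulnC exprM omega_r expr1n mul1r.
set m := (n %% r)%N.
have m0 : (0 < m)%N by rewrite lt0n.
have mr : (m < r)%N by rewrite ltn_mod.
rewrite omegaE /cexp /= expR0 mul1r eq_complex /=.
have -> : 2 * pi / r%:R * m%:R = (pi / r%:R * m%:R) *+ 2 :> R by rewrite -mulr_natl; ring.
rewrite cos_mulr2n cos2sin2.
have s0 : 0 < sin (pi / r%:R * m%:R : R).
  apply: sin_gt0_pi; rewrite mulr_gt0 ?divr_gt0 ?pi_gt0 ?ltr0n//=.
  rewrite mulrAC ltr_pdivrMr// ltr_pM2l ?pi_gt0// ltr_nat//.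
rewrite negb_and; apply/orP; left; apply/eqP => E.
have : sin (pi / r%:R * m%:R : R) ^+ 2 > 0 by rewrite exprn_gt0.
by move: E; rewrite -mulr_natl; lra.
Qed.

Lemma sum_omega n : \sum_(k < r) (omega R r ^+ k) ^+ n = if (r %| n)%N then r%:R else 0.
Proof.
rewrite (eq_bigr (fun k : 'I_r => (omega R r ^+ n) ^+ k)); last first.
  by move=> k _; rewrite -!exprM mulnC.
case: ifPn => [/dvdnP[q ->]|/omega_neq1 rn].
  rewrite mulnC exprM omega_r expr1n (eq_bigr (fun=> 1)); last by move=> k _; rewrite expr1n.
  by rewrite sumr_const card_ord.
have : (omega R r ^+ n) ^+ r - 1 = 0 by rewrite -exprM mulnC exprM omega_r expr1n subrr.
rewrite subrX1 => /eqP; rewrite mulf_eq0 subr_eq0 (negbTE rn) => /eqP//.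
Qed.

(** The partial sum of length [N] of the thinned series is the partial sum of length [r N] of the
    original one. *)
Lemma csum_dvd (M : R) a : gdom M a -> (forall n, ~~ (r %| n)%N -> a n = 0) ->
  csum a = csum (fun n => a (r * n)%N).
Proof.
move=> aM a0; apply/esym/(@csum_unique _ (2 * M)) => N.
have -> : \sum_(k < N) a (r * k)%N = \sum_(k < r * N) a k.
  elim: N => [|N IH]; first by rewrite muln0 !big_ord0.
  rewrite big_ord_recr /= IH mulnS addnC -!(big_mkord xpredT) /=.
  rewrite (@big_cat_nat _ _ _ (r * N) 0 (r * N + r))//= ?leq_addr//; congr (_ + _).
  rewrite -{2}[(r * N)%N]add0n big_addn addnC addnK big_mkord.
  have r0 : (0 < r)%N by rewrite (leq_trans _ r2).
  rewrite (bigD1 (Ordinal r0))//= add0n big1 ?addr0// => k kn.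
  apply: a0; rewrite dvdn_addl ?dvdn_mulr//; apply/negP => /dvdn_leq.
  rewrite lt0n => H; have : (k : nat) != 0%N by apply: contraNneq kn => k0; rewrite -val_eqE /= k0.
  by move=> /H; rewrite leqNgt ltn_ord.
rewrite (le_trans (csum_approx _ aM))// ler_wpM2l ?mulr_ge0 ?(gdom_ge0 aM)//.
apply: ler_wiXn2l => //; first by rewrite invf_le1// ler1n.
by rewrite leq_pmull// (leq_trans _ r2).
Qed.

(** By r-evenness [r u(z)] is the sum of [u] over the [r] rotations of [z]; in the Taylor series
    [sum_omega] then kills every power not divisible by [r]. *)
Lemma Hr_series u : Hr r u -> exists2 a, rapid a & u = fun z => pser a (z ^+ r).
Proof.
move=> [/entireP ue uev]; have [b br ub] := entire_series ue.
have r0 : (0 < r)%N by rewrite (leq_trans _ r2).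
have rC : r%:R != 0 :> C by rewrite pnatr_eq0 -lt0n.
exists (fun n => b (r * n)%N).
  move=> x x0.
  have x1 : 0 < x + 1 by lra.
  have [M HM] := br _ x1; exists M => n; apply: le_trans (HM (r * n)%N).
  rewrite ler_wpM2l ?nc_ge0// (@le_trans _ _ ((x + 1) ^+ n))//.
    by apply: lerXn2r; rewrite ?nnegrE; lra.
  by apply: ler_weXn2l; [lra|rewrite leq_pmull].
apply/funext => z.
have uk (k : 'I_r) : u (omega R r ^+ k * z) = u z.
  case: k => -[|k] /= kr; first by rewrite expr0 mul1r.
  by apply: uev; rewrite /= -ltnS prednK.
have [M gM] := rapid_gdom (nc z) br.
have n1 k : nc (omega R r ^+ k) = 1.
  by rewrite omegaE nc_cexp /= expR0.
have gk (k : 'I_r) : gdom M (fun n => b n * (omega R r ^+ k * z) ^+ n).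
  by apply: gM; rewrite ncM n1 mul1r.
have [_ F] := csum_sum (index_enum 'I_r) gk.
have E : r%:R * u z = csum (fun n => \sum_(k < r) b n * (omega R r ^+ k * z) ^+ n).
  rewrite F (eq_bigr (fun=> u z)); last by move=> k _; rewrite -ub uk.
  by rewrite sumr_const card_ord mulr_natl.
apply: (mulfI rC); rewrite E.
have gz : gdom M (fun n => b n * z ^+ n) by exact: gM.
pose c n : C := if (r %| n)%N then 1 else 0.
have gc : gdom M (fun n => c n * (b n * z ^+ n)).
  move=> n; rewrite /c; case: ifP => _; first by rewrite mul1r.
  by rewrite mul0r nc0 mulr_ge0 ?(gdom_ge0 gz)// exprn_ge0.
transitivity (csum (fun n => r%:R * (c n * (b n * z ^+ n)))).
  apply: csum_eq => n; rewrite (eq_bigr (fun k : 'I_r => b n * z ^+ n * (omega R r ^+ k) ^+ n)).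
    by rewrite -mulr_sumr sum_omega /c; case: ifP => _; ring.
  by move=> k _; rewrite exprMn; ring.
rewrite (csumZ _ gc) (csum_dvd gc); last by move=> n /negbTE rn; rewrite /c rn mul0r.
congr (_ * _); apply: csum_eq => n.
by rewrite /c dvdn_mulr// mul1r exprM.
Qed.

Lemma series_Hr a : rapid a -> Hr r (fun z => pser a (z ^+ r)).
Proof.
move=> ar; split.
  apply/entireP => z; have [D zD] := cderivX r (cderiv_id z).
  eexists; apply: cderiv_comp zD _; exact: pser_deriv.
move=> z k _; rewrite exprMn -exprM mulnC exprM omega_r expr1n mul1r//.
Qed.

End RootsOfUnity.

(** * The hyper-Bessel operator as a weighted shift, and the growth of [alpha] *)

Section Bessel.
Variables (R : realType) (r : nat).
Hypothesis r2 : (2 <= r)%N.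
Variable gamma : 'I_r.-1 -> R.
Local Notation C := R[i].
Implicit Types (u : C -> C) (a d : nat -> C) (z : C).

Lemma cderiv_X n z : cderiv (fun w => w ^+ n) z (n%:R * z ^+ n.-1).
Proof.
elim: n => [|n IH].
  by rewrite mul0r (_ : (fun _ => _) = fun=> 1)//; exact: cderiv_cst.
rewrite (_ : (fun _ => _) = fun w => w * w ^+ n); last first.
  by apply/funext => w; rewrite exprS.
rewrite (_ : _ * _ = 1 * z ^+ n + z * (n%:R * z ^+ n.-1)).
  exact: cderivM (cderiv_id z) IH.
by case: n {IH} => [|n] /=; rewrite ?expr0 ?exprS -?natr1; ring.
Qed.

(* These functions are stable under the first-order factors of the operator. *)
Definition wser d z : C := z ^+ r.-1 * pser d (z ^+ r).

(** [z d/dz] multiplies [z^(rn + r - 1)] by its exponent. *)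
Lemma wser_theta (k : C) d : rapid d ->
  (fun w => w * (wser d)^`()%classic w + k * wser d w) =
  wser (fun n => ((r * n + r.-1)%:R + k) * d n).
Proof.
move=> dr; apply/funext => z.
have D : cderiv (wser d) z (r.-1%:R * z ^+ r.-1.-1 * pser d (z ^+ r) + z ^+ r.-1 *
    (pser (fun n => n.+1%:R * d n.+1) (z ^+ r) * (r%:R * z ^+ r.-1))).
  apply: cderivM; first exact: cderiv_X.
  by apply: cderiv_comp; [exact: cderiv_X|exact: pser_deriv].
have [_ ->] := cderiv_is_derive D.
have r1 : rapid (fun n => r%:R * (n%:R * d n)) by apply: rapidZ; exact: rapid_natM.
have r3 : rapid (fun n => (r.-1%:R + k) * d n) by exact: rapidZ.
rewrite /wser; rewrite (_ : pser (fun n => ((r * n + r.-1)%:R + k) * d n) =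
   pser (fun n => r%:R * (n%:R * d n) + (r.-1%:R + k) * d n)); last first.
  by apply: pser_ext => n; rewrite natrD natrM; ring.
rewrite pserD// !pserZ//; last exact: rapid_natM.
rewrite pser_natM//.
have e1 : z ^+ r.-1 = z * z ^+ r.-1.-1 by rewrite -exprS prednK// -subn1 subn_gt0.
have e2 : z ^+ r = z * z ^+ r.-1 by rewrite -exprS prednK// (leq_trans _ r2).
set p1 := pser d _; set p2 := pser _ _.
have -> : z * (r.-1%:R * z ^+ r.-1.-1 * p1 + z ^+ r.-1 * (p2 * (r%:R * z ^+ r.-1))) =
  r.-1%:R * (z * z ^+ r.-1.-1) * p1 + z ^+ r.-1 * (p2 * (r%:R * (z * z ^+ r.-1))) by ring.
by rewrite -e1 -e2; ring.
Qed.

Lemma big_theta (s : seq 'I_r.-1) d : rapid d ->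
  rapid (fun n => \prod_(i <- s) ((r * n + r.-1)%:R + (r%:R * gamma i + 1)%:C) * d n) /\
  (\big[(fun P Q => P \o Q)/id]_(i <- s)
     (fun (f : C -> C) (w : C) => w * f^`()%classic w + (r%:R * gamma i + 1)%:C * f w))
    (wser d) =
  wser (fun n => \prod_(i <- s) ((r * n + r.-1)%:R + (r%:R * gamma i + 1)%:C) * d n).
Proof.
move=> dr; elim: s => [|i s [IH1 IH2]].
  rewrite big_nil; have -> : (fun n => \prod_(i <- [::])
      ((r * n + r.-1)%:R + (r%:R * gamma i + 1)%:C) * d n) = d.
    by apply/funext => n; rewrite big_nil mul1r.
  by [].
have -> : (fun n => \prod_(j <- i :: s) ((r * n + r.-1)%:R + (r%:R * gamma j + 1)%:C) * d n)
  = (fun n => ((r * n + r.-1)%:R + (r%:R * gamma i + 1)%:C) *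
     (\prod_(j <- s) ((r * n + r.-1)%:R + (r%:R * gamma j + 1)%:C) * d n)).
  by apply/funext => n; rewrite big_cons mulrA.
split; last by rewrite big_cons /= IH2 wser_theta.
have := rapid_linear r%:R (r.-1%:R + (r%:R * gamma i + 1)%:C) IH1.
rewrite (_ : (fun n => _) = (fun n => ((r * n + r.-1)%:R + (r%:R * gamma i + 1)%:C) *
     (\prod_(j <- s) ((r * n + r.-1)%:R + (r%:R * gamma j + 1)%:C) * d n)))//.
by apply/funext => n; rewrite natrD natrM addrA.
Qed.

(* [bratio n] is the ratio alpha_(n+1) / alpha_n. *)
Definition bratio (n : nat) : R := r%:R ^+ r * n.+1%:R * \prod_(i < r.-1) (n.+1%:R + gamma i).

(** The derivative of a series in [z^r] is [z^(r-1)] times another one, hence of the form [wser].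
    The [i]-th factor then multiplies the [n]-th coefficient by [r n + r - 1 + r gamma_i + 1 = r (n
    + 1 + gamma_i)]. *)
Lemma Bessel_formula_series a : rapid a -> exists2 d, rapid d & forall z,
  hyper_Bessel_formula gamma (fun w => pser a (w ^+ r)) z =
  (z ^+ r.-1)^-1 * wser d z /\ d =1 (fun n => (bratio n)%:C * a n.+1).
Proof.
move=> ar.
have r0 : (0 < r)%N by rewrite (leq_trans _ r2).
pose d0 n : C := r%:R * (n.+1%:R * a n.+1).
have d0r : rapid d0 by apply: rapidZ; exact: (rapid_shift (rapid_natM ar)).
have uE : (fun w => pser a (w ^+ r))^`()%classic = wser d0.
  apply/funext => z.
  have D := cderiv_comp (cderiv_X r z) (pser_deriv (z ^+ r) ar).
  have [_ ->] := cderiv_is_derive D.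
  rewrite /wser pserZ; last exact: (rapid_shift (rapid_natM ar)).
  by ring.
have [H1 H2] := big_theta (index_enum 'I_r.-1) d0r.
exists (fun n => \prod_(i < r.-1) ((r * n + r.-1)%:R + (r%:R * gamma i + 1)%:C) * d0 n) => // z.
split; first by rewrite /hyper_Bessel_formula uE H2.
move=> n; rewrite /bratio /d0.
have -> : \prod_(i < r.-1) ((r * n + r.-1)%:R + (r%:R * gamma i + 1)%:C) =
    ((r%:R ^+ r.-1 * \prod_(i < r.-1) (n.+1%:R + gamma i))%:C : C).
  have -> : r%:R ^+ r.-1 = \prod_(i < r.-1) (r%:R : R) by rewrite prodr_const card_ord.
  rewrite -big_split /= rmorph_prod.
  apply: eq_bigr => i _.
  rewrite -[X in X + _](rmorph_nat (real_complex R)) -rmorphD; congr (_%:C).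
  have -> : (r * n + r.-1)%:R = r%:R * n.+1%:R - 1 :> R.
    apply: (addIr 1); rewrite subrK natr1 -natrM -addnS prednK//.
    by rewrite mulnS addnC.
  by ring.
have -> : r%:R = (r%:R)%:C :> C by rewrite rmorph_nat.
have -> : n.+1%:R = (n.+1%:R)%:C :> C by rewrite rmorph_nat.
rewrite mulrA mulrA -!rmorphM; congr (_%:C * _).
have -> : r%:R ^+ r = r%:R * r%:R ^+ r.-1 :> R by rewrite -exprS prednK.
by ring.
Qed.

(** Away from 0 the powers [z^(r-1)] cancel; at 0 the limit is read off from the continuity of the
    resulting series. *)
Lemma hyper_Bessel_series a : rapid a ->
  rapid (fun n => (bratio n)%:C * a n.+1) /\
  hyper_Bessel gamma (fun z => pser a (z ^+ r)) =
  fun z => pser (fun n => (bratio n)%:C * a n.+1) (z ^+ r).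
Proof.
move=> ar; have [d dr H] := Bessel_formula_series ar.
have [_ /funext dE] := H 0; rewrite -dE; split => //.
have r0 : (0 < r)%N by rewrite (leq_trans _ r2).
have F z : z != 0 -> hyper_Bessel_formula gamma (fun w => pser a (w ^+ r)) z = pser d (z ^+ r).
  by move=> z0; have [-> _] := H z; rewrite /wser mulKf// expf_neq0.
apply/funext => z; rewrite /hyper_Bessel; case: eqVneq => [->|]; last exact: F.
apply: cvg_lim => //; apply/cvg_ncP => e e0.
have c : ccont (fun z => pser d (z ^+ r)) 0.
  have := cderiv_comp (cderiv_X r 0) (pser_deriv (0 ^+ r) dr).
  exact: cderiv_ccont.
have [k k0 K] := c e e0.
apply/nbhs_ncP; exists k => // w wk w0.
by rewrite F//; exact: K.
Qed.

Hypothesis hgamma : forall k : 'I_r.-1, - 1 + k.+1%:R / r%:R <= gamma k.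

Let rR : 0 < r%:R :> R. Proof. by rewrite ltr0n (leq_trans _ r2). Qed.

(** The lower bound is proportional to [n + 1], so it bounds [bratio] from below by a multiple of
    [(n+1)^r] and keeps the arguments of [Gamma] positive. *)
Lemma gamma_gt n (i : 'I_r.-1) : n.+1%:R / r%:R <= n.+1%:R + gamma i.
Proof.
have := hgamma i.
have h1 : (1 : R) / r%:R <= i.+1%:R / r%:R.
  by rewrite ler_pM2r ?invr_gt0// ler1n.
have h2 : n%:R / r%:R <= n%:R :> R.
  by rewrite ler_pdivrMr// ler_peMr// ler1n (leq_trans _ r2).
by rewrite -natr1 mulrDl; lra.
Qed.

Lemma gamma_pos n (i : 'I_r.-1) : 0 < n.+1%:R + gamma i.
Proof. by apply: lt_le_trans (gamma_gt n i); rewrite divr_gt0. Qed.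

Lemma alpha0 : alpha gamma 0 = 1.
Proof.
rewrite /alpha muln0 expr0 fact0 !mul1r big1// => i _.
rewrite addr0 divff// gt_eqF// Gamma_gt0//.
by have := gamma_pos 0 i; rewrite addrC.
Qed.

Lemma alphaS n : alpha gamma n.+1 = bratio n * alpha gamma n.
Proof.
rewrite /alpha /bratio mulnS exprD factS natrM.
have -> : \prod_(i < r.-1) (Gamma (gamma i + n.+1%:R + 1) / Gamma (gamma i + 1)) =
   \prod_(i < r.-1) (n.+1%:R + gamma i) *
   \prod_(i < r.-1) (Gamma (gamma i + n%:R + 1) / Gamma (gamma i + 1)).
  rewrite -big_split /=; apply: eq_bigr => i _.
  have -> : gamma i + n.+1%:R = gamma i + n%:R + 1 by rewrite -natr1 addrA.
  rewrite GammaD1; last by have := gamma_pos n i; rewrite -natr1; lra.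
  by rewrite -natr1; ring.
by ring.
Qed.

Lemma bratio_bounds : exists c0 c1 : R, [/\ 0 < c0, 0 < c1 &
  forall n, c0 * n.+1%:R ^+ r <= bratio n <= c1 * n.+1%:R ^+ r].
Proof.
have r0 : (0 < r)%N by rewrite (leq_trans _ r2).
pose G := 1 + \sum_(i < r.-1) `|gamma i|.
have G0 : 0 < G by rewrite ltr_wpDr// sumr_ge0.
(* Each of the [r - 1] factors [n + 1 + gamma_i] lies between [(n + 1) / r] and [(n + 1) G]. *)
exists (r%:R ^+ r * r%:R^-1 ^+ r.-1), (r%:R ^+ r * G ^+ r.-1); split.
- by rewrite mulr_gt0 ?exprn_gt0 ?invr_gt0.
- by rewrite mulr_gt0 ?exprn_gt0.
move=> n; have n0 : 0 < n.+1%:R :> R by [].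
have rr : 0 <= r%:R ^+ r * n.+1%:R :> R by rewrite mulr_ge0 ?exprn_ge0// ltW.
have nr : n.+1%:R ^+ r = n.+1%:R * n.+1%:R ^+ r.-1 :> R by rewrite -exprS prednK.
have P (c : R) : \prod_(i < r.-1) (c : R) = c ^+ r.-1 by rewrite prodr_const card_ord.
apply/andP; split.
  have -> : r%:R ^+ r * r%:R^-1 ^+ r.-1 * n.+1%:R ^+ r =
     r%:R ^+ r * n.+1%:R * (n.+1%:R / r%:R) ^+ r.-1 :> R by rewrite nr exprMn; ring.
  rewrite ler_wpM2l// -P; apply: ler_prod => i _.
  by rewrite gamma_gt divr_ge0// ltW.
have -> : r%:R ^+ r * G ^+ r.-1 * n.+1%:R ^+ r =
     r%:R ^+ r * n.+1%:R * (n.+1%:R * G) ^+ r.-1 :> R by rewrite nr exprMn; ring.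
rewrite ler_wpM2l// -P; apply: ler_prod => i _.
rewrite (ltW (gamma_pos n i)) /= /G mulrDr mulr1 lerD2l.
rewrite (le_trans (ler_norm _))// (bigD1 i)//= mulrDr.
have s0 : 0 <= \sum_(j < r.-1 | j != i) `|gamma j| by rewrite sumr_ge0.
have n1 : 1 <= n.+1%:R :> R by rewrite ler1n.
have := normr_ge0 (gamma i); nra.
Qed.

Lemma alpha_bounds : exists c0 c1 : R, [/\ 0 < c0, 0 < c1 &
  forall n, c0 ^+ n * n`!%:R ^+ r <= alpha gamma n <= c1 ^+ n * n`!%:R ^+ r].
Proof.
have [c0 [c1 [c00 c10 H]]] := bratio_bounds.
exists c0, c1; split => //; elim => [|n /andP[IH1 IH2]].
  by rewrite alpha0 !expr0 fact0 expr1n mulr1 lexx.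
have /andP[h1 h2] := H n.
have a0 : 0 <= alpha gamma n.
  by apply: le_trans IH1; rewrite mulr_ge0 ?exprn_ge0// ltW.
have b0 : 0 <= bratio n by apply: le_trans h1; rewrite mulr_ge0 ?exprn_ge0// ltW.
have E (c : R) : c ^+ n.+1 * n.+1`!%:R ^+ r = (c * n.+1%:R ^+ r) * (c ^+ n * n`!%:R ^+ r).
  by rewrite factS natrM exprMn exprS; ring.
rewrite !E alphaS; apply/andP; split; apply: ler_pM => //.
  by rewrite mulr_ge0 ?exprn_ge0// ltW.
by rewrite mulr_ge0 ?exprn_ge0// ltW.
Qed.

Lemma alpha_gt0 n : 0 < alpha gamma n.
Proof.
have [c0 [_ [c00 _ /(_ n) /andP[+ _]]]] := alpha_bounds.
by apply: lt_le_trans; rewrite mulr_gt0 ?exprn_gt0// ltr0n fact_gt0.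
Qed.

(** From Taylor coefficients in [z^r] to coordinates in the basis [z^(rn) / alpha_n]; [srapid_rapid]
    is the way back. The exponential factors of [alpha_bounds] only change the radius. *)
Lemma rapid_srapid a : rapid a -> srapid r (fun n => (alpha gamma n)%:C * a n).
Proof.
move=> ar; apply/srapidP => x x0.
have [c0 [c1 [_ c10 H]]] := alpha_bounds.
have [K HK] := ar (c1 * x) (mulr_gt0 c10 x0); exists K => n.
have /andP[_ h] := H n.
rewrite ncM ncR gtr0_norm ?alpha_gt0//.
apply: (@le_trans _ _ (c1 ^+ n * n`!%:R ^+ r * nc (a n) * x ^+ n)).
  by rewrite ler_wpM2r ?exprn_ge0 ?(ltW x0)// ler_wpM2r ?nc_ge0.
have F0 : 0 <= n`!%:R ^+ r :> R by rewrite exprn_ge0.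
have := ler_wpM2r F0 (HK n); apply: le_trans.
by rewrite exprMn le_eqVlt; apply/orP; left; apply/eqP; ring.
Qed.

Lemma srapid_rapid (v : nat -> C) : srapid r v -> rapid (fun n => v n / (alpha gamma n)%:C).
Proof.
move=> /srapidP vr x x0.
have [c0 [c1 [c00 _ H]]] := alpha_bounds.
have [K HK] := vr (x / c0) (divr_gt0 x0 c00); exists K => n.
have /andP[h _] := H n.
rewrite ncM ncV ncR gtr0_norm ?alpha_gt0// mulrAC ler_pdivrMr ?alpha_gt0//.
have K0 : 0 <= K.
  by have := HK 0%N; rewrite !expr0 fact0 expr1n !mulr1; apply: le_trans (nc_ge0 _).
apply: le_trans (ler_wpM2l K0 h).
have c0n : 0 <= c0 ^+ n by rewrite exprn_ge0// ltW.
have := ler_wpM2l c0n (HK n).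
rewrite mulrCA -exprMn (mulrC c0) mulfVK ?gt_eqF// => /le_trans; apply.
by rewrite mulrCA.
Qed.

End Bessel.

(** * Continuity of the functional as a seminorm bound *)

Section Dual.
Variables (R : realType) (r : nat).
Hypothesis r2 : (2 <= r)%N.
Local Notation C := R[i].
Variable T : {family compact, C -> C} -> C.
Hypothesis dT : dual_Hr r T.
Implicit Types (u v : C -> C) (a : nat -> C) (z c : C).

Lemma Hr_lin c u v : Hr r u -> Hr r v -> Hr r (c *: u + v : C -> C).
Proof.
move=> [/entireP ue uev] [/entireP ve vev]; split.
  apply/entireP => z; have [D uD] := ue z; have [E vE] := ve z.
  by exists (0 * u z + c * D + E); apply: cderivD => //; exact: cderivM (cderiv_cst c z) uD.
by move=> z k kr; rewrite /= !fctE uev// vev.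
Qed.

Lemma Hr_cst0 : Hr r (fun=> 0 : C).
Proof. by split=> [|//]; apply/entireP => z; exists 0; exact: cderiv_cst. Qed.

Lemma dual_lin c u v : Hr r u -> Hr r v -> T (fun z => c * u z + v z) = c * T u + T v.
Proof. by move=> ur vr; rewrite -(dT.1 c u v ur vr). Qed.

Lemma dual_cst0 : T (fun=> 0) = 0.
Proof.
have := dual_lin 1 Hr_cst0 Hr_cst0.
rewrite (_ : (fun z : C => _) = fun=> 0 : C); last by apply/funext => z; rewrite mulr0 addr0.
by rewrite mul1r => /eqP; rewrite -subr_eq0 opprD addrA subrr add0r oppr_eq0 => /eqP.
Qed.

Lemma compact_nc_bounded (A : set C) : compact A -> exists M : R, forall z, A z -> nc z <= M.
Proof.
move=> cA.
have cn : continuous (@nc R).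
  move=> z B /nbhs_ballP[e /= e0 eB]; apply/nbhs_ncP; exists e => // w wz.
  apply: eB; rewrite /ball /=; apply: le_lt_trans wz; rewrite ler_norml; apply/andP; split.
    by rewrite lerNl opprB; exact: nc_sub.
  by rewrite ncB; exact: nc_sub.
have /compact_bounded[M [Mr HM]] : compact (@nc R @` A).
  by apply: continuous_compact => //; exact: continuous_subspaceT.
exists (M + 1) => z Az.
have : `|nc z| <= M + 1 by apply: HM; [rewrite ltrDl|exists z].
by rewrite ger0_norm ?nc_ge0.
Qed.

(* Otherwise there are [v n] in [Hr] tending to 0 uniformly on compact sets with
   [1 <= nc (T (v n))]. *)
Lemma dual_small : exists n : nat, forall v, Hr r v ->
  (forall z, nc z <= n.+1%:R -> nc (v z) <= n.+1%:R^-1) -> nc (T v) < 1.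
Proof.
apply: contrapT => H.
have H' n : exists v : {family compact, C -> C}, Hr r v /\
    ((forall z, nc z <= n.+1%:R -> nc (v z) <= n.+1%:R^-1) /\ 1 <= nc (T v)).
  apply: contrapT => K; apply: H; exists n => v vr vs.
  by rewrite ltNge; apply/negP => Tv; apply: K; exists v.
have [v vP] := choice H'.
have v0 : {family compact, v @ \oo --> (fun=> 0 : C)}.
  apply/fam_cvgP => A /compact_nc_bounded[M HM] P /uniform_nbhs[E [entE EP]].
  have /nbhs_ncP[e e0 He] := nbhs_entourage (0 : C) entE.
  (* From [N] on, the disc of radius [n + 1] contains [A], and [1 / (n + 1) < e]. *)
  pose N := Num.Def.archi_bound (`|M| + e^-1).
  have e1 : 0 < e^-1 by rewrite invr_gt0.
  have NP : `|M| + e^-1 < N%:R by apply: archi_boundP; rewrite addr_ge0// ltW.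
  exists N => // n /= Nn; apply: EP => y Ay.
  have nn : N%:R <= n.+1%:R :> R by rewrite ler_nat (leq_trans Nn).
  have [_ [vs _]] := vP n.
  have yn : nc y <= n.+1%:R.
    by rewrite (le_trans (HM y Ay))// (le_trans (ler_norm _))//; lra.
  have : nc (v n y - 0) < e.
    rewrite subr0 (le_lt_trans (vs y yn))// -[ltRHS]invrK ltf_pV2 ?posrE//.
    by have := normr_ge0 M; lra.
  by move=> /He; rewrite /xsection /= inE.
have /subspace_continuousP/(_ _ Hr_cst0)/cvg_ncP/(_ 1 ltr01) := dT.2.
rewrite /from_subspace dual_cst0 => W.
have : \forall n \near \oo, Hr r (v n) -> nc (T (v n) - 0) < 1 by exact: v0 W.
move=> [N _ /(_ N (leqnn N))] /=; have [vr [_ Tv]] := vP N.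
by move=> /(_ vr); rewrite subr0 ltNge Tv.
Qed.

(** By homogeneity: [v / ((n + 1) S)] satisfies the assumption of [dual_small]. *)
Lemma dual_bound : exists p M : R, [/\ 0 < p, 0 < M & forall v (S : R), Hr r v -> 0 < S ->
  (forall z, nc z <= p -> nc (v z) <= S) -> nc (T v) <= M * S].
Proof.
have [n H] := dual_small.
have n0 : 0 < n.+1%:R :> R by [].
exists n.+1%:R, n.+1%:R; split => // v S vr S0 vS.
pose c : R := (n.+1%:R * S)^-1.
have c0 : 0 < c by rewrite invr_gt0 mulr_gt0.
have := H _ (Hr_lin c%:C vr Hr_cst0).
have E : T (c%:C *: (v : C -> C) + (fun=> 0)) = c%:C * T v.
  by rewrite (dT.1 c%:C _ _ vr Hr_cst0) dual_cst0 addr0.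
rewrite E ncM ncR gtr0_norm// => K.
have : c * nc (T v) < 1.
  apply: K => z zn; rewrite !fctE addr0 /GRing.scale /= ncM ncR gtr0_norm//.
  rewrite /c invfM -mulrA ler_piMr ?invr_ge0// mulrC ler_pdivrMr// mul1r.
  exact: vS.
by rewrite /c mulrC ltr_pdivrMr ?mulr_gt0// mul1r => /ltW.
Qed.

End Dual.

(** * The convolution in coordinates, and its surjectivity *)

Section Convolution.
Variables (R : realType) (r : nat).
Hypothesis r2 : (2 <= r)%N.
Variable gamma : 'I_r.-1 -> R.
Hypothesis hgamma : forall k : 'I_r.-1, - 1 + k.+1%:R / r%:R <= gamma k.
Local Notation C := R[i].
Variable T : {family compact, C -> C} -> C.
Hypothesis dT : dual_Hr r T.
Implicit Types (u : C -> C) (a v : nat -> C) (z c : C).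

Let r0 : (0 < r)%N. Proof. exact: leq_trans r2. Qed.
Let al_gt0 n : 0 < alpha gamma n. Proof. exact: alpha_gt0. Qed.
Let fact_gt0R n : 0 < n`!%:R ^+ r :> R. Proof. by rewrite exprn_gt0// ltr0n fact_gt0. Qed.

(** The number [t_n] is [moment n / alpha_n]. *)
Definition moment n : C := T (fun z => (z ^+ r) ^+ n).

Lemma Hr_monomial n : Hr r (fun z : C => (z ^+ r) ^+ n).
Proof.
split; last by move=> z k _; rewrite exprMn -(exprM _ k) mulnC exprM omega_r// expr1n mul1r.
by apply/entireP => z; exact: (cderivX n (cderiv_X r z)).
Qed.

Lemma moment_bound : exists M A : R, [/\ 0 < M, 0 < A & forall n, nc (moment n) <= M * A ^+ n].
Proof.
have [p [M [p0 M0 H]]] := dual_bound dT.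
exists M, (p ^+ r); split; rewrite ?exprn_gt0// => n.
apply: H; first exact: Hr_monomial.
  by rewrite !exprn_gt0.
by move=> z zp; rewrite !ncX !lerXn2r ?nnegrE ?exprn_ge0 ?nc_ge0 ?(ltW p0).
Qed.

(** [dual_bound] applied to the remainders of the series, which are uniformly small on the disc of
    radius [p]. *)
Lemma dual_series a : rapid a ->
  T (fun z => pser a (z ^+ r)) = csum (fun n => a n * moment n).
Proof.
move=> ar; have [p [M [p0 M0 H]]] := dual_bound dT.
have [M1 gM1] := rapid_gdom (p ^+ r) ar.
have M10 : 0 <= M1 by apply: (gdom_ge0 (gM1 0 _)); rewrite nc0 exprn_ge0// ltW.
(* Removing one monomial at a time shows by linearity that every remainder is in [Hr] and what [T]
   does to it. *)
pose V N z := pser a (z ^+ r) - \sum_(k < N) a k * (z ^+ r) ^+ k.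
have VP N : Hr r (V N) /\ T (V N) = T (fun z => pser a (z ^+ r)) - \sum_(k < N) a k * moment k.
  elim: N => [|N [IH1 IH2]].
    have -> : V 0%N = fun z => pser a (z ^+ r).
      by apply/funext => z; rewrite /V big_ord0 subr0.
    rewrite big_ord0 subr0; split; [exact: (series_Hr r2 ar)|reflexivity].
  have E : V N.+1 = fun z => - a N * (z ^+ r) ^+ N + V N z.
    by apply/funext => z; rewrite /V big_ord_recr /=; ring.
  split; first by rewrite E; exact: (Hr_lin (- a N) (Hr_monomial N) IH1).
  rewrite E (dual_lin dT (- a N) (Hr_monomial N) IH1) IH2 big_ord_recr /= -/(moment N).
  by ring.
(* [M1] may be 0, whereas [dual_bound] takes a positive bound [S]; hence [M1 + 1]. *)
apply/esym/(@csum_unique _ (M * (2 * (M1 + 1)))) => N.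
have [h1 <-] := VP N; rewrite -!mulrA mulrA.
have hN : 0 < 2^-1 ^+ N :> R by rewrite exprn_gt0.
rewrite -[leRHS]mulrA; apply: H => //.
  by rewrite !mulr_gt0//; lra.
move=> z zp.
have zr : nc (z ^+ r) <= p ^+ r.
  by rewrite ncX lerXn2r ?nnegrE ?nc_ge0 ?(ltW p0).
apply: (le_trans (csum_approx N (gM1 _ zr))).
by nra.
Qed.

(** [leq_factD] separates the two indices; its factor [2^(r (n+m))] is absorbed by using
    admissibility at [2^r k] instead of [k]. *)
Lemma srapid_shift v (k : R) : srapid r v -> 0 < k -> exists2 K, 0 <= K & forall n m,
  nc (v (n + m)%N) <= K * n`!%:R ^+ r * m`!%:R ^+ r * k^-1 ^+ n * k^-1 ^+ m.
Proof.
move=> /srapidP vr k0.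
have k20 : 0 < 2 ^+ r * k by rewrite mulr_gt0 ?exprn_gt0.
have [K HK] := vr _ k20.
have K0 : 0 <= K.
  by have := HK 0%N; rewrite expr0 fact0 expr1n !mulr1; apply: le_trans (nc_ge0 _).
exists K => // n m; have := HK (n + m)%N.
rewrite -ler_pdivlMr ?exprn_gt0// => /le_trans; apply.
apply: (@le_trans _ _ (K * (2 ^+ (n + m) * (n`!%:R * m`!%:R)) ^+ r / (2 ^+ r * k) ^+ (n + m))).
  rewrite ler_wpM2r ?invr_ge0 ?exprn_ge0 ?(ltW k20)// ler_wpM2l//.
  by rewrite lerXn2r ?nnegrE ?mulr_ge0 ?exprn_ge0 ?ler0n// -natrX -!natrM ler_nat leq_factD.
rewrite le_eqVlt; apply/orP; left; apply/eqP.
have E i : (2 ^+ i) ^+ r = (2 ^+ r) ^+ i :> R by rewrite -!exprM mulnC.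
rewrite !exprMn E !exprD !exprVn; field.
by rewrite !expf_neq0// gt_eqF// ?exprn_gt0.
Qed.

(** At each application [bratio] cancels against the ratio of consecutive [alpha], which leaves a
    pure shift of [v]. *)
Lemma iter_Bessel a n : rapid a ->
  let v m := (alpha gamma m)%:C * a m in
  rapid (fun m => v (n + m)%N / (alpha gamma m)%:C) /\
  iter n (hyper_Bessel gamma) (fun z => pser a (z ^+ r)) =
  fun z => pser (fun m => v (n + m)%N / (alpha gamma m)%:C) (z ^+ r).
Proof.
move=> ar v.
have aC m : (alpha gamma m)%:C != 0 :> C by rewrite -nc_gt0 ncR gtr0_norm.
elim: n => [|n [IH1 IH2]].
  have -> : (fun m => v (0 + m)%N / (alpha gamma m)%:C) = a.
    by apply/funext => m; rewrite /v add0n mulrAC mulfV// mul1r.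
  by [].
have [h1 h2] := hyper_Bessel_series r2 gamma IH1.
have E : (fun m => (bratio gamma m)%:C * (v (n + m.+1)%N / (alpha gamma m.+1)%:C)) =
    (fun m => v (n.+1 + m)%N / (alpha gamma m)%:C).
  apply/funext => m; rewrite addnS -addSn.
  have aS : (alpha gamma m.+1)%:C = (bratio gamma m)%:C * (alpha gamma m)%:C :> C.
    by rewrite (alphaS r2 hgamma); exact: (rmorphM (real_complex R)).
  have bC : (bratio gamma m)%:C != 0 :> C.
    by have := aC m.+1; rewrite aS mulf_eq0 negb_or => /andP[].
  by rewrite aS; field; rewrite aC bC.
by rewrite iterS IH2 h2 -E.
Qed.

Lemma moment_decay : exists M A : R, [/\ 0 < M, 0 < A & forall n,
  nc (moment n / (alpha gamma n)%:C) <= M * A ^+ n / n`!%:R ^+ r].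
Proof.
have [c0 [c1 [c00 c10 alb]]] := alpha_bounds r2 hgamma.
have [M [A [M0 A0 HM]]] := moment_bound.
exists M, (A / c0); split; rewrite ?divr_gt0// => n.
rewrite ncM ncV ncR gtr0_norm// ler_pdivrMr//.
apply: (le_trans (HM n)); have /andP[h _] := alb n.
have MA : 0 <= M * (A / c0) ^+ n / n`!%:R ^+ r.
  by rewrite divr_ge0 ?mulr_ge0 ?exprn_ge0 ?divr_ge0 ?ltW.
apply: le_trans (ler_wpM2l MA h).
rewrite le_eqVlt; apply/orP; left; apply/eqP.
rewrite expr_div_n; field.
by rewrite (gt_eqF (fact_gt0R n)) expf_neq0// gt_eqF.
Qed.

(** [dual_series] turns [T] of the translate into the sum over [n] of [t_n (B_r^n u)(z)], and each
    [B_r^n u] is a shifted series, so the formula is an exchange of two sums. The free parameter [h]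
    in [wb] and [xb] yields both convergence and admissibility of the resulting sequences. *)
Lemma convolution_series a : rapid a ->
  let v m := (alpha gamma m)%:C * a m in
  let w m := csum (fun n => moment n / (alpha gamma n)%:C * v (n + m)%N) in
  srapid r w /\
  convolution gamma T (fun z => pser a (z ^+ r)) =
  fun z => pser (fun m => w m / (alpha gamma m)%:C) (z ^+ r).
Proof.
move=> ar v w.
have [c0 [c1 [c00 c10 alb]]] := alpha_bounds r2 hgamma.
have [M [A [M0 Apos tb]]] := moment_decay.
have vr : srapid r v by exact: rapid_srapid.
pose t n := moment n / (alpha gamma n)%:C.
have wb (h : R) : 0 < h -> exists2 K, 0 <= K & forall n m,
    nc (t n * v (n + m)%N) <= K * m`!%:R ^+ r * h^-1 ^+ m * 2^-1 ^+ n.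
  (* With [k = 2 A + h], [(A / k)^n <= 2^-n] and [k^-m <= h^-m]. *)
  move=> h0; have k0 : 0 < 2 * A + h by lra.
  have [K K0 HK] := srapid_shift vr k0.
  exists (M * K); first by rewrite mulr_ge0// ltW.
  move=> n m; rewrite ncM.
  apply: (le_trans (ler_pM (nc_ge0 _) (nc_ge0 _) (tb n) (HK n m))).
  have hm : (2 * A + h)^-1 ^+ m <= h^-1 ^+ m.
    by rewrite lerXn2r ?nnegrE ?invr_ge0 ?(ltW k0) ?(ltW h0)// lef_pV2 ?posrE//; lra.
  have hn : A ^+ n * (2 * A + h)^-1 ^+ n <= 2^-1 ^+ n.
    rewrite -exprMn lerXn2r ?nnegrE ?mulr_ge0 ?invr_ge0 ?(ltW k0) ?(ltW Apos)//.
    by rewrite ler_pdivrMr//; lra.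
  rewrite [leLHS](_ : _ = M * K * m`!%:R ^+ r *
    ((2 * A + h)^-1 ^+ m * (A ^+ n * (2 * A + h)^-1 ^+ n))).
    rewrite -[leRHS]mulrA ler_wpM2l//.
      by rewrite !mulr_ge0// ltW.
    by apply: ler_pM; rewrite ?mulr_ge0 ?exprn_ge0 ?invr_ge0 ?(ltW k0) ?(ltW Apos).
  by field; rewrite (gt_eqF (fact_gt0R n)).
have wr : srapid r w.
  apply/srapidP => h h0; have [K K0 HK] := wb h h0; exists (2 * K) => m.
  have g : gdom (K * m`!%:R ^+ r * h^-1 ^+ m) (fun n => t n * v (n + m)%N).
    by move=> n; exact: HK.
  have := ler_wpM2r (exprn_ge0 m (ltW h0)) (csum_le g).
  move=> /le_trans; apply; rewrite le_eqVlt; apply/orP; left; apply/eqP.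
  by rewrite exprVn; field; rewrite expf_neq0// gt_eqF.
split => //; apply/funext => z; set x := z ^+ r.
have xb (h : R) : 0 < h -> exists2 K, 0 <= K & forall n m,
    nc (v (n + m)%N / (alpha gamma m)%:C * x ^+ m) <= K * n`!%:R ^+ r * h^-1 ^+ n * 2^-1 ^+ m.
  move=> h0; have X0 := nc_ge0 x.
  (* Ensures [nc x / (c0 k) <= 1/2] for the sum over [m], and [k^-n <= h^-n]. *)
  pose k := h + 2 * nc x / c0.
  have kX : 0 <= 2 * nc x / c0 by rewrite divr_ge0 ?mulr_ge0// ltW.
  have k0 : 0 < k by rewrite /k; lra.
  have [K K0 HK] := srapid_shift vr k0.
  exists K => // n m.
  rewrite (ncM _ (x ^+ m)) (ncM (v _)) ncV ncR gtr0_norm// ncX.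
  have ha : (alpha gamma m)^-1 <= (c0 ^+ m * m`!%:R ^+ r)^-1.
    have /andP[h1 _] := alb m.
    by rewrite lef_pV2 ?posrE// mulr_gt0// exprn_gt0.
  have p1 : 0 <= (alpha gamma m)^-1 by rewrite invr_ge0 ltW.
  have p2 : 0 <= nc x ^+ m by rewrite exprn_ge0.
  apply: (le_trans (ler_wpM2r p2 (ler_pM (nc_ge0 _) p1 (HK n m) ha))).
  have hn : k^-1 ^+ n <= h^-1 ^+ n.
    by rewrite lerXn2r ?nnegrE ?invr_ge0 ?(ltW k0) ?(ltW h0)// lef_pV2 ?posrE// /k; lra.
  have hm : (nc x / c0 / k) ^+ m <= 2^-1 ^+ m.
    rewrite lerXn2r ?nnegrE ?divr_ge0 ?(ltW k0) ?(ltW c00)// ler_pdivrMr// /k; lra.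
  rewrite [leLHS](_ : _ = K * n`!%:R ^+ r * (k^-1 ^+ n * (nc x / c0 / k) ^+ m)).
    rewrite -[leRHS]mulrA ler_wpM2l//.
      by rewrite !mulr_ge0// ltW.
    by apply: ler_pM; rewrite ?exprn_ge0 ?divr_ge0 ?invr_ge0 ?(ltW k0) ?(ltW c00).
  rewrite !expr_div_n !exprVn; field.
  by rewrite !expf_neq0 ?(gt_eqF k0) ?(gt_eqF c00)//= (gt_eqF (fact_gt0R m)).
(* [Z n] is [(B_r^n u)(z)]; its admissibility in [n] makes the translate an r-even entire function
   of its second variable. *)
pose Z n := pser (fun m => v (n + m)%N / (alpha gamma m)%:C) x.
have Zr : srapid r Z.
  apply/srapidP => h h0; have [K K0 HK] := xb h h0; exists (2 * K) => n.
  have g : gdom (K * n`!%:R ^+ r * h^-1 ^+ n)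
      (fun m => v (n + m)%N / (alpha gamma m)%:C * x ^+ m) by move=> m; exact: HK.
  have := ler_wpM2r (exprn_ge0 n (ltW h0)) (csum_le g).
  move=> /le_trans; apply; rewrite le_eqVlt; apply/orP; left; apply/eqP.
  by rewrite exprVn; field; rewrite expf_neq0// gt_eqF.
have trE : translation gamma z (fun z => pser a (z ^+ r)) =
    fun w => pser (fun n => Z n / (alpha gamma n)%:C) (w ^+ r).
  apply/funext => y; rewrite /translation /pser -/(csum _); apply: csum_eq => n.
  by have [_ ->] := iter_Bessel n ar; rewrite -exprM /Z /x; ring.
rewrite /convolution trE dual_series; last exact: srapid_rapid.
transitivity (csum (fun n => csum (fun m => t n * (v (n + m)%N / (alpha gamma m)%:C * x ^+ m)))).
  apply: csum_eq => n.
  have [K K0 HK] := xb 1 ltr01.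
  have g : gdom (K * n`!%:R ^+ r * 1^-1 ^+ n)
      (fun m => v (n + m)%N / (alpha gamma m)%:C * x ^+ m) by move=> m; exact: HK.
  by rewrite (csumZ _ g) /t /Z /pser; ring.
(* The decay [(2 A)^-n] offsets the [A^n] in the bound on [t] and leaves [2^-n]. *)
have A20 : 0 < 2 * A by lra.
have [K K0 HK] := xb _ A20.
rewrite (@csum_exchange _ (M * K)); last first.
  move=> n m; rewrite ncM.
  apply: (le_trans (ler_pM (nc_ge0 _) (nc_ge0 _) (tb n) (HK n m))).
  rewrite le_eqVlt; apply/orP; left; apply/eqP.
  rewrite !exprVn exprMn; field.
  by rewrite (gt_eqF (fact_gt0R n)) !expf_neq0// gt_eqF.
apply: csum_eq => m.
have [K' K'0 HK'] := wb 1 ltr01.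
have g : gdom (K' * m`!%:R ^+ r * 1^-1 ^+ m) (fun n => t n * v (n + m)%N).
  by move=> n; exact: HK'.
have swap1 (p q y : C) : y / q * p = p / q * y by ring.
have swap2 (p q s y : C) : p * (q / s * y) = y / s * (p * q) by ring.
transitivity (x ^+ m / (alpha gamma m)%:C * csum (fun n => t n * v (n + m)%N)).
  apply: etrans (csumZ _ g); apply: csum_eq => n.
  exact: (swap2 (t n) (v (n + m)%N)).
exact: (swap1 (w m)).
Qed.

Lemma convolution_maps : set_fun (Hr r) (Hr r) (convolution gamma T).
Proof.
move=> u /(Hr_series r2)[a ar ->].
have [wr ->] := convolution_series ar.
by apply: series_Hr => //; exact: srapid_rapid.
Qed.

Lemma convolution_surj : (exists u, Hr r u /\ T u <> 0) ->
  set_surj (Hr r) (Hr r) (convolution gamma T).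
Proof.
move=> [u0 [/(Hr_series r2)[a0 a0r ->] Tu0]] g /(Hr_series r2)[b br ->].
have aC m : (alpha gamma m)%:C != 0 :> C by rewrite -nc_gt0 ncR gtr0_norm.
have [M [A [M0 Apos tb]]] := moment_decay.
pose t n := moment n / (alpha gamma n)%:C.
(* If every [t_n] vanished, [dual_series] would give [T = 0] on every series in [z^r], in particular
   on the function where [T] is nonzero. *)
have tn0 : exists q, t q != 0.
  apply: contrapT => H; apply: Tu0; rewrite dual_series// -[RHS](csum0 R).
  apply: csum_eq => n; apply/eqP/negPn/negP => an; apply: H; exists n.
  move: an; rewrite mulf_eq0 negb_or => /andP[_ mn].
  by rewrite mulf_neq0// invr_neq0.
have [u ur uE] := solve r0 Apos tb tn0 (rapid_srapid r2 hgamma br).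
have uar := srapid_rapid r2 hgamma ur.
exists (fun z => pser (fun n => u n / (alpha gamma n)%:C) (z ^+ r)).
  exact: series_Hr.
have [_ ->] := convolution_series uar.
apply/funext => z; congr (pser _ _); apply/funext => m.
transitivity ((alpha gamma m)%:C * b m / (alpha gamma m)%:C); last by rewrite mulrC mulKf.
rewrite -uE; congr (_ / _).
apply: csum_eq => n; congr (_ * _).
by rewrite mulrC mulfVK.
Qed.

End Convolution.

Theorem proposition4p11 (R : realType) (r : nat) (gamma : 'I_r.-1 -> R)
  (T : {family compact, R[i] -> R[i]} -> R[i]) :
  (2 <= r)%N ->
  (forall k : 'I_r.-1, - 1 + k.+1%:R / r%:R <= gamma k) ->
  dual_Hr r T ->
  (exists u, Hr r u /\ T u <> 0) ->
  set_fun (Hr r) (Hr r) (convolution gamma T) /\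
  set_surj (Hr r) (Hr r) (convolution gamma T).
Proof.
by move=> r2 hg dT Tn0; split; [exact: convolution_maps|exact: convolution_surj].
Qed.
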